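(* (a) For any initial state $(X_0,Y_0)=(x,y)\in[0,\infty)^2$, as $t\to\infty$ the pair $(X_t,Y_t)$ converges in distribution to $(S\epsilon,\,S(1-\epsilon))$, where $\epsilon$ is $\mathrm{Beta}(2,2)$-distributed and $S=X_0+Y_0$. (b) The set of invariant probability measures of the process $(X_t,Y_t)_{t\ge0}$ contained in $\mathcal P_f$ is given by the distributions of the random vectors $(S\epsilon,\,S(1-\epsilon))$, where $S$ is a $[0,\infty)$-valued random variable with arbitrary distribution satisfying the finite moments condition, and $\epsilon$ is $\mathrm{Beta}(2,2)$-distributed and independent of $S$.
   Context: $(X_t,Y_t)_{t\ge 0}$ is the continuous-time Markov jump process on $[0,\infty)^2$ with generator $$Lf(x,y)=\int_0^1\int_0^1\big(f(x(1-u)+yv,\;y(1-v)+xu)-f(x,y)\big)\,du\,dv,$$ i.e. at rate 1 the state $(x,y)$ is replaced by $(x(1-U)+yV,\;y(1-V)+xU)$ with $U,V$ i.i.d. uniform on $(0,1)$; the sum $X_t+Y_t$ is conserved. $\mathcal P_f$ is the set of probability measures on $[0,\infty)^2$ that have finite moments of all orders and are uniquely determined by their moments. A probability measure on $[0,\infty)$ satisfies the finite moments condition if it has finite moments of all orders and is uniquely determined by its moments. *)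

(* Defs.v *)
From HB Require Import structures.
From mathcomp Require Import all_boot all_order all_algebra.
From mathcomp Require Import all_classical all_reals all_analysis.

Set Implicit Arguments.
Unset Strict Implicit.
Unset Printing Implicit Defensive.

Import Order.TTheory GRing.Theory Num.Theory.
Import numFieldTopology.Exports numFieldNormedType.Exports.

Local Open Scope classical_set_scope.
Local Open Scope ring_scope.

(* The state space [0, oo)^2 is the Borel subset [quadrant] of R * R. Measures
   on it are Borel measures on R * R giving full mass to [quadrant]; whatever
   kernels and functions do outside of [quadrant] is irrelevant. *)
Definition quadrant (R : realType) : set (R * R) :=
  [set z | 0 <= z.1 /\ 0 <= z.2].

Definition exchange (R : realType) (z : R * R) (u v : R) : R * R :=
  (z.1 * (1 - u) + z.2 * v, z.2 * (1 - v) + z.1 * u).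

Definition exchange_generator (R : realType) (f : R * R -> R) (z : R * R) : R :=
  \int[@lebesgue_measure R]_(u in `[0, 1])
    \int[@lebesgue_measure R]_(v in `[0, 1]) (f (exchange z u v) - f z).

(* Time is a real parameter; nothing is required at negative times. *)
Definition transition_function (R : realType)
    (P : R -> R.-pker (R * R) ~> (R * R)%type) : Prop :=
  [/\ forall t z, 0 <= t -> quadrant z -> P t z (@quadrant R) = 1%E,
      forall z A, quadrant z -> measurable A -> P 0 z A = \d_z A &
      forall s t z A, 0 <= s -> 0 <= t -> quadrant z -> measurable A ->
        P (s + t) z A = (\int[P s z]_w P t w A)%E].

(* The generator is bounded, so its domain is the space of all bounded
   measurable functions, with convergence in the supremum norm on the state
   space. *)
Definition has_generator (R : realType)
    (P : R -> R.-pker (R * R) ~> (R * R)%type)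
    (L : (R * R -> R) -> R * R -> R) : Prop :=
  forall f : R * R -> R, measurable_fun setT f -> bounded_fun f ->
  forall e : R, 0 < e ->
    \forall t \near 0^'+, forall z, quadrant z ->
      `| (\int[P t z]_w f w - f z) / t - L f z | <= e.

Definition natural_filtration (R : realType) d (T : measurableType d)
    (Z : R -> T -> R * R) (s : R) : set (set T) :=
  <<s \bigcup_(r in `[0, s]) preimage_set_system setT (Z r) measurable >>.

Definition jump_path (R : realType) (path : R -> R * R) : Prop :=
  exists tau : nat -> R,
    [/\ tau 0%N = 0, forall n, tau n < tau n.+1,
        tau n @[n --> \oo] --> +oo &
        forall n t, tau n <= t -> t < tau n.+1 -> path t = path (tau n)].

Definition markov_jump_process (R : realType) d (T : measurableType d)
    (Pr : probability T R) (P : R -> R.-pker (R * R) ~> (R * R)%type)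
    (Z : R -> {RV Pr >-> (R * R)%type}) : Prop :=
  [/\ forall t w, 0 <= t -> quadrant (Z t w),
      {ae Pr, forall w, jump_path (fun t => Z t w)} &
      forall s t A B, 0 <= s -> 0 <= t ->
        natural_filtration Z s A -> measurable B ->
        Pr (A `&` Z (s + t) @^-1` B) = (\int[Pr]_(w in A) P t (Z s w) B)%E].
Arguments markov_jump_process {R d T} Pr P Z.

Definition invariant_probability (R : realType)
    (P : R -> R.-pker (R * R) ~> (R * R)%type)
    (mu : probability (R * R)%type R) : Prop :=
  mu (@quadrant R) = 1%E /\
  forall t A, 0 <= t -> measurable A -> (\int[mu]_z P t z A)%E = mu A.

Definition finite_moments2 (R : realType) (mu : probability (R * R)%type R) :=
  forall i j : nat, mu.-integrable setT (fun z => (z.1 ^+ i * z.2 ^+ j)%:E).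

(* Moment determinacy is understood within the probability measures on
   [0, oo)^2, here, and on [0, oo), in [finite_moments_condition]. Measures are
   compared on measurable sets only, since their values elsewhere are
   unspecified. *)
Definition in_Pf (R : realType) (mu : probability (R * R)%type R) : Prop :=
  [/\ mu (@quadrant R) = 1%E, finite_moments2 mu &
      forall nu : probability (R * R)%type R,
        nu (@quadrant R) = 1%E -> finite_moments2 nu ->
        (forall i j : nat, (\int[nu]_z (z.1 ^+ i * z.2 ^+ j)%:E =
                            \int[mu]_z (z.1 ^+ i * z.2 ^+ j)%:E)%E) ->
        forall A, measurable A -> nu A = mu A].

Definition finite_moments1 (R : realType) (mu : probability R R) :=
  forall n : nat, mu.-integrable setT (fun s => (s ^+ n)%:E).

Definition finite_moments_condition (R : realType) (mu : probability R R) :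
    Prop :=
  [/\ mu `[0, +oo[%classic = 1%E, finite_moments1 mu &
      forall nu : probability R R,
        nu `[0, +oo[%classic = 1%E -> finite_moments1 nu ->
        (forall n : nat, (\int[nu]_s (s ^+ n)%:E = \int[mu]_s (s ^+ n)%:E)%E) ->
        forall A, measurable A -> nu A = mu A].

Definition beta22_distributed (R : realType) d (T : measurableType d)
    (Pr : probability T R) (eps : {RV Pr >-> R}) : Prop :=
  forall A : set R, measurable A -> distribution Pr eps A = beta_prob 2 2 A.
Arguments beta22_distributed {R d T} Pr eps.

Definition independent_rv (R : realType) d (T : measurableType d)
    (Pr : probability T R) (X Y : {RV Pr >-> R}) : Prop :=
  forall A B : set R, measurable A -> measurable B ->
    Pr (X @^-1` A `&` Y @^-1` B) = (Pr (X @^-1` A) * Pr (Y @^-1` B))%E.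
Arguments independent_rv {R d T} Pr X Y.

Definition split_state (R : realType) (s e : R) : R * R := (s * e, s * (1 - e)).

(* Main.v *)
(* The lines x + y = s are invariant and, on each of them, the generator is
   G - I where G averages over one exchange. G is a contraction for the
   oscillation on a line (Doeblin), because the law of one exchange from any
   point of the line dominates half the uniform law of a fixed subinterval, and
   the Beta(2,2) mean on the line is G-invariant. Hence the semigroup converges,
   uniformly on the state space, to the Beta(2,2) mean; this gives (a), the
   invariance in (b), and the fact that an invariant mu is the image of
   m \x Beta(2,2) under (s, e) |-> (s e, s (1 - e)), m being its law of x + y.

   What remains is that this image is moment determinate if m is. Let nu have
   the same moments; its law of s = x + y is m by determinacy. With p = x / s,
   the variables W = p^i - E[e^i] satisfy E[W s^(i+n)] = 0 for all n. As m is
   determinate, M. Riesz's theorem gives polynomials b with b(-1) = 1 and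
   arbitrarily small integral of b(s)^2 s / (1 + s); with their help the relations
   E[W s^i q(s)] = 0 for polynomials q imply E[W s^i q(s) / (1 + s)] = 0, and this
   can be repeated. After i steps the bounded variable
   v = W (s / (1 + s))^i satisfies E[v s^n] = 0 for all n, so that the law of s
   under the density 1 + v has the moments of m, hence is m. Therefore W has
   mean zero given s on s > 0, and Hausdorff's theorem identifies the law of p
   given s with Beta(2,2). *)

Require Import Defs.
From HB Require Import structures.
From mathcomp Require Import all_boot all_order all_algebra.
From mathcomp Require Import all_classical all_reals all_analysis.
From mathcomp Require Import measurable_realfun complex ring lra.
Import Order.TTheory GRing.Theory Num.Theory.
Import numFieldTopology.Exports numFieldNormedType.Exports.
Local Open Scope classical_set_scope.
Local Open Scope ring_scope.

Set Implicit Arguments.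
Unset Strict Implicit.
Unset Printing Implicit Defensive.

(** * Integration of bounded measurable functions *)

(** The generator hypothesis is a derivative at time 0 in the supremum norm over the quadrant. No
    exponential series is formed: Euler steps of length [d] with error [d e] are chained, and the
    accumulated error stays proportional to [e]. The measure dominated in Doeblin's argument is half
    of Lebesgue measure on [[1/4, 1/2]]; its mass 1/8 makes the contraction factor 7/8. The obstacle
    in (b) is that the moments see [p] only through [x ^ i = p ^ i s ^ i]: the relations start at
    degree [i], so the density [1 + W] cannot be used, its moments of order below [i] being unknown.
    The descent trades powers of [s] for powers of [s / (1 + s)], which is bounded and of the same
    order near 0. For Riesz's theorem, the moment functional is extended to all polynomially bounded
    functions with a prescribed value at [1 / (1 + s)]. The extension is only finitely additive; its
    measure is obtained as the law of a quantile function. Conditional laws are avoided: Hausdorff's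
    theorem is applied with indicators of events of [s] as weights, and on [s = 0], where [p] is
    meaningless, an independent Beta(2,2) variable is inserted. *)

Section mixture.
Context d d' (X : measurableType d) (Y : measurableType d') (R : realType).
Local Open Scope ereal_scope.
Import HBNNSimple.

(** Passes from sets to functions by simple approximations common to all the measures involved and
    monotone convergence at both levels. It serves for Chapman-Kolmogorov, for invariance and for
    measures given by a density. *)
Lemma ge0_integral_mixture (mu : {measure set X -> \bar R})
    (k : R.-ker X ~> Y) (nu : {measure set Y -> \bar R})
    (nuE : forall A, measurable A -> nu A = \int[mu]_x k x A)
    (f : Y -> \bar R) : measurable_fun setT f -> (forall y, 0 <= f y) ->
  \int[nu]_y f y = \int[mu]_x \int[k x]_y f y.
Proof.
move=> mf f0; pose g := nnsfun_approx measurableT mf.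
have gE (m : {measure set Y -> \bar R}) :
    \int[m]_y f y = limn (fun n => \int[m]_y (g n y)%:E).
  rewrite -monotone_convergence//; last 3 first.
    by move=> n; exact/measurable_EFinP.
    by move=> n y _; rewrite lee_fin.
    by move=> y _ a b ab; rewrite lee_fin; exact/lefP/nd_nnsfun_approx.
  by apply: eq_integral => y _; apply/esym/cvg_lim => //;
    exact: cvg_nnsfun_approx.
have gsE (m : {measure set Y -> \bar R}) (h : {nnsfun Y >-> R}) :
    \int[m]_y (h y)%:E = \sum_(r \in range h) r%:E * m (h @^-1` [set r]).
  by rewrite integralT_nnsfun sintegralE.
have mgn n : measurable_fun setT (fun x => \int[k x]_y (g n y)%:E).
  apply: measurable_fun_integral_kernel => //.
  - exact: measurable_kernel.
  - by move=> y; rewrite lee_fin.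
  - exact/measurable_EFinP.
rewrite gE; under eq_integral do rewrite gE.
rewrite monotone_convergence//; last 2 first.
  by move=> n x _; apply: integral_ge0 => y _; rewrite lee_fin.
  move=> x _ a b ab; apply: ge0_le_integral => //.
  - by move=> y _; rewrite lee_fin.
  - exact/measurable_EFinP.
  - exact/measurable_EFinP.
  - by move=> y _; rewrite lee_fin; exact/lefP/nd_nnsfun_approx.
apply: congr_lim; apply/funext => n; rewrite gsE.
under [RHS]eq_integral do rewrite gsE.
rewrite ge0_integral_fsum//; last 2 first.
  by move=> r; apply: measurable_funeM; exact: measurable_kernel.
  move=> r x _; have [r0|r0] := leP 0%R r; first by rewrite mule_ge0.
  by rewrite preimage_nnfun0// measure0 mule0.
apply: eq_fsbigr => r _; rewrite nuE//.
have [r0|r0] := leP 0%R r; first by rewrite ge0_integralZl//; exact: measurable_kernel.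
rewrite preimage_nnfun0//; under eq_integral do rewrite measure0.
by rewrite integral0 mule0 integral0_eq// => x _; rewrite measure0 mule0.
Qed.

End mixture.

Section bounded_measurable.
Context d (T : measurableType d) (R : realType).
Implicit Types f g : T -> R.

Definition bmeas f := measurable_fun setT f /\ exists M, forall x, `|f x| <= M.

Lemma bmeas_bounded f : bmeas f -> bounded_fun f.
Proof.
move=> [_ [M fM]]; exists M; split; first exact: num_real.
by move=> y My x _ /=; rewrite (le_trans (fM x))// ltW.
Qed.

Lemma bounded_bmeas f : measurable_fun setT f -> bounded_fun f -> bmeas f.
Proof.
move=> mf [M [_ fM]]; split => //; exists (M + 1) => x.
by apply: (fM (M + 1)) => //; rewrite ltrDl.
Qed.

Lemma bmeas_cst (c : R) : bmeas (fun=> c).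
Proof. by split; [exact: measurable_cst|exists `|c|]. Qed.

Lemma bmeasD f g : bmeas f -> bmeas g -> bmeas (fun x => f x + g x).
Proof.
move=> [mf [M fM]] [mg [N gN]]; split; first exact: measurable_funD.
by exists (M + N) => x; rewrite (le_trans (ler_normD _ _))// lerD.
Qed.

Lemma bmeasM f g : bmeas f -> bmeas g -> bmeas (fun x => f x * g x).
Proof.
move=> [mf [M fM]] [mg [N gN]]; split; first exact: measurable_funM.
by exists (M * N) => x; rewrite normrM ler_pM.
Qed.

Lemma bmeasZ (c : R) f : bmeas f -> bmeas (fun x => c * f x).
Proof. by move=> bf; apply: bmeasM => //; exact: bmeas_cst. Qed.

Lemma bmeasB f g : bmeas f -> bmeas g -> bmeas (fun x => f x - g x).
Proof.
move=> [mf [M fM]] [mg [N gN]]; split; first exact: measurable_funB.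
by exists (M + N) => x; rewrite (le_trans (ler_normB _ _))// lerD.
Qed.

Lemma bmeas_indic (A : set T) : measurable A -> bmeas (\1_A : T -> R).
Proof.
move=> mA; split; first exact: measurable_indic.
exists 1 => x; rewrite indicE; case: (_ \in _); first by rewrite normr1.
by rewrite normr0.
Qed.

Variable mu : {measure set T -> \bar R}.
Hypothesis muT : mu setT = 1%E.

Lemma bmeas_integrable f : bmeas f -> mu.-integrable setT (EFin \o f).
Proof.
move=> [mf [M fM]]; apply: measurable_bounded_integrable => //.
  by rewrite muT ltry.
by exists M; split; [exact: num_real|move=> y My x _ /=; rewrite (le_trans (fM x))// ltW].
Qed.

Lemma expect_cst (c : R) : \int[mu]_x c = c.
Proof. by rewrite Rintegral_cst// muT mulr1. Qed.

Lemma expectD f g : bmeas f -> bmeas g ->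
  \int[mu]_x (f x + g x) = \int[mu]_x f x + \int[mu]_x g x.
Proof. by move=> bf bg; apply: RintegralD => //; exact: bmeas_integrable. Qed.

Lemma expectB f g : bmeas f -> bmeas g ->
  \int[mu]_x (f x - g x) = \int[mu]_x f x - \int[mu]_x g x.
Proof. by move=> bf bg; apply: RintegralB => //; exact: bmeas_integrable. Qed.

Lemma expectZ (c : R) f : bmeas f -> \int[mu]_x (c * f x) = c * \int[mu]_x f x.
Proof. by move=> bf; apply: RintegralZl => //; exact: bmeas_integrable. Qed.

Lemma expect_indic (A : set T) : measurable A ->
  (\int[mu]_x \1_A x)%:E = mu A.
Proof.
move=> mA; rewrite /Rintegral integral_indic// setIT fineK//.
rewrite ge0_fin_numE//; apply: (@le_lt_trans _ _ (mu setT)).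
  by apply: le_measure => //; rewrite inE.
by rewrite muT ltry.
Qed.

Lemma expect_le_on (D : set T) f g : measurable D -> mu D = 1%E ->
  bmeas f -> bmeas g -> (forall x, D x -> f x <= g x) ->
  \int[mu]_x f x <= \int[mu]_x g x.
Proof.
move=> mD muD bf bg fg; rewrite -subr_ge0 -expectB//.
have [_ [M hM]] : bmeas (fun x => g x - f x) by exact: bmeasB.
have mDC : measurable (~` D) by exact: measurableC.
have bD : bmeas (fun x => M * \1_(~` D) x) by apply/bmeasZ/bmeas_indic.
have DC0 : \int[mu]_x (\1_(~` D) x : R) = 0.
  apply/EFin_inj; rewrite expect_indic//.
  have muDoo : (mu setT < +oo)%E by rewrite muT ltry.
  have := measureD measurableT mD muDoo.
  rewrite setTD setTI => ->.
  rewrite [X in (X - _)%E](_ : _ = 1%E)// [X in (_ - X)%E](_ : _ = 1%E)//.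
  by rewrite subee.
(* Adding [M] off [D] makes the integrand nonnegative at every point and leaves the integral
   unchanged. *)
have <- : \int[mu]_x (g x - f x + M * \1_(~` D) x) = \int[mu]_x (g x - f x).
  by rewrite expectD//; [rewrite expectZ ?DC0 ?mulr0 ?addr0//; exact: bmeas_indic
    |exact: bmeasB].
apply: Rintegral_ge0 => x _; rewrite indicE in_setC.
have [xD|_] := boolP (x \in D).
  by rewrite mulr0 addr0 subr_ge0; apply: fg; exact: set_mem.
by rewrite mulr1; have := hM x; rewrite ler_norml; case/andP; lra.
Qed.

Lemma expect_eq_on (D : set T) f g : measurable D -> mu D = 1%E ->
  bmeas f -> bmeas g -> (forall x, D x -> f x = g x) ->
  \int[mu]_x f x = \int[mu]_x g x.
Proof.
move=> mD muD bf bg fg; apply/eqP; rewrite eq_le; apply/andP; split.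
  by apply: (expect_le_on mD) => // x /fg ->.
by apply: (expect_le_on mD) => // x /fg ->.
Qed.

Lemma expect_norm_on (D : set T) f c : measurable D -> mu D = 1%E ->
  bmeas f -> (forall x, D x -> `|f x| <= c) -> `|\int[mu]_x f x| <= c.
Proof.
move=> mD muD bf fc; rewrite ler_norml -{1}(expect_cst (- c)) -{2}(expect_cst c).
apply/andP; split; apply: (expect_le_on mD) => //; try exact: bmeas_cst;
  by move=> x /fc; rewrite ler_norml => /andP[].
Qed.

Lemma fin_integral_bmeas f : bmeas f ->
  (\int[mu]_x (f x)%:E)%E = (\int[mu]_x f x)%:E.
Proof.
move=> bf; rewrite /Rintegral fineK//.
by apply: integrable_fin_num => //; exact: bmeas_integrable.
Qed.

End bounded_measurable.

Section expect_mixture.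
Context d d' (X : measurableType d) (Y : measurableType d') (R : realType).
Variable k : R.-pker X ~> Y.

Let kT x : k x setT = 1%E. Proof. exact: prob_kernel. Qed.

(** Reduces bounded functions to nonnegative ones, to which Tonelli and monotone convergence apply.
    The constant [M] does not depend on the measure, so one shift serves all measures of a kernel at
    once. *)
Lemma bmeas_shift d0 (T : measurableType d0) (f : T -> R) : bmeas f ->
  exists M, [/\ bmeas (fun x => f x + M), forall x, 0 <= f x + M &
    forall mu : {measure set T -> \bar R}, mu setT = 1%E ->
      \int[mu]_x (f x + M) = \int[mu]_x f x + M].
Proof.
move=> bf; have [_ [M fM]] := bf; exists M; split.
- by apply: bmeasD => //; exact: bmeas_cst.
- by move=> x; have := fM x; rewrite ler_norml => /andP[]; lra.
- by move=> mu muT; rewrite expectD// ?expect_cst//; exact: bmeas_cst.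
Qed.

Lemma bmeas_expect_kernel (f : Y -> R) : bmeas f ->
  bmeas (fun x => \int[k x]_y f y).
Proof.
move=> bf; split; last first.
  have [_ [M fM]] := bf; exists M => x.
  by apply: (@expect_norm_on _ _ _ _ (kT x) setT).
have [M [bfM f0 fME]] := bmeas_shift bf.
rewrite (_ : (fun x => _) = (fun x => \int[k x]_y (f y + M) - M)); last first.
  by apply/funext => x; rewrite fME// addrK.
apply: measurable_funB => //.
apply: measurableT_comp => //; apply: measurable_fun_integral_kernel => //.
- exact: measurable_kernel.
- by apply/measurable_EFinP; case: bfM.
Qed.

Lemma expect_mixture (mu : {measure set X -> \bar R})
    (nu : {measure set Y -> \bar R}) (muT : mu setT = 1%E)
    (nuE : forall A, measurable A -> nu A = (\int[mu]_x k x A)%E)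
    (f : Y -> R) : bmeas f ->
  \int[nu]_y f y = \int[mu]_x \int[k x]_y f y.
Proof.
move=> bf; have [M [bfM f0 fME]] := bmeas_shift bf.
have nuT : nu setT = 1%E.
  by rewrite nuE//; under eq_integral do rewrite kT; rewrite integral_cst// mul1e.
apply: (addIr M); rewrite -fME//.
rewrite -[in RHS](expect_cst muT M) -expectD//; last 2 first.
- exact: bmeas_expect_kernel.
- exact: bmeas_cst.
rewrite /Rintegral; congr fine.
rewrite (ge0_integral_mixture nuE)//; last by case: bfM => /measurable_EFinP.
apply: eq_integral => x _.
exact: (etrans (fin_integral_bmeas (kT x) bfM) (congr1 EFin (fME _ (kT x)))).
Qed.

End expect_mixture.

Definition image_measure d d' (X : measurableType d) (Y : measurableType d')
    (R : realType) (m : {measure set X -> \bar R}) (phi : X -> Y)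
    (mphi : measurable_fun setT phi) : {measure set Y -> \bar R} :=
  measure_function_pushforward__canonical__measure_function_Measure m mphi.

Section expect_product.
Context d d' (X : measurableType d) (Y : measurableType d') (R : realType).
Variables (m1 : probability X R) (m2 : probability Y R).

Let m2T : m2 setT = 1%E. Proof. exact: probability_setT. Qed.

Lemma bmeas_comp (f : Y -> R) (phi : X -> Y) :
  measurable_fun setT phi -> bmeas f -> bmeas (f \o phi).
Proof.
move=> mphi [mf [M fM]]; split; first exact: measurableT_comp.
by exists M => x; exact: fM.
Qed.

Lemma bmeas_section (h : X * Y -> R) x : bmeas h -> bmeas (fun y => h (x, y)).
Proof.
move=> [mh [M hM]]; split; last by exists M.
by apply: (measurableT_comp mh); exact: measurable_pair1.
Qed.

Lemma bmeas_expect_prod (h : X * Y -> R) : bmeas h ->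
  bmeas (fun x => \int[m2]_y h (x, y)).
Proof.
move=> bh; split; last first.
  have [_ [M hM]] := bh; exists M => x.
  by apply: (@expect_norm_on _ _ _ _ m2T setT) => //; exact: bmeas_section.
have [M [bhM h0 hME]] := bmeas_shift bh.
rewrite (_ : (fun x => _) = (fun x => \int[m2]_y (h (x, y) + M) - M)); last first.
  apply/funext => x; rewrite expectD//; last 2 first.
    exact: bmeas_section.
    exact: bmeas_cst.
  by rewrite expect_cst// addrK.
apply: measurable_funB => //; apply: measurableT_comp => //.
apply: (measurable_fun_fubini_tonelli_F (fun z => (h z + M)%:E)) => //.
by apply/measurable_EFinP; case: bhM.
Qed.

Lemma expect_prod (h : X * Y -> R) : bmeas h ->
  \int[m1]_x \int[m2]_y h (x, y) = \int[(m1 \x m2)%E]_z h z.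
Proof.
move=> bh; have ih : (m1 \x m2)%E.-integrable setT (EFin \o h).
  by apply: bmeas_integrable => //; exact: probability_setT.
rewrite /Rintegral -(integral12_prod_meas1 ih); congr fine.
apply: eq_integral => x _; rewrite /fubini_F.
by rewrite -(fin_integral_bmeas m2T (bmeas_section x bh)).
Qed.

End expect_product.

Section lebesgue_affine.
Context (R : realType).
Notation leb := (@lebesgue_measure R).
Local Open Scope ereal_scope.

Lemma measurable_affine (c d : R) : measurable_fun setT (fun x : R => c * x + d)%R.
Proof. by apply: measurable_funD => //; exact: measurable_funM. Qed.

(** The right-hand side is a measure in [A] whose value on half-open intervals is their length,
    which characterizes Lebesgue measure. For negative [c] the preimage of []a, b]] is closed on the
    left instead. *)
Lemma lebesgue_measure_affine (c d : R) (A : set R) : (c != 0)%R -> measurable A ->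
  leb A = `|c|%:E * leb ((fun x => c * x + d)%R @^-1` A).
Proof.
move=> c0 mA; pose phi : R -> measurableTypeR R := fun x => (c * x + d)%R.
have mphi : measurable_fun setT phi by exact: measurable_affine.
pose m := mscale (NngNum (normr_ge0 c)) (image_measure leb mphi).
have -> : `|c|%:E * leb (phi @^-1` A) = m A by [].
apply: lebesgue_measure_unique => // _ [[a b] _ <-] /=.
rewrite /m /mscale/= /pushforward lebesgue_measure_itv/= lte_fin.
have [ab|ba] := ltP a b; last first.
  rewrite (_ : _ @^-1` _ = set0) ?measure0 ?mule0//.
  apply/seteqP; split => // x /=; rewrite in_itv/= => /andP[ax xb].
  by have := lt_le_trans ax xb; rewrite ltNge ba.
have [cp|cn|ce] := ltgtP c 0%R; last by rewrite ce eqxx in c0.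
- rewrite (_ : _ @^-1` _ = `[((b - d) / c)%R, ((a - d) / c)%R[%classic); last first.
    apply/seteqP; split => x /=; rewrite !in_itv/= ler_ndivrMr// ltr_ndivlMr// /phi;
      by rewrite mulrC => /andP[? ?]; apply/andP; split; lra.
  rewrite lebesgue_measure_itv/= lte_fin ltr_nM2r ?invr_lt0// ifT; last by lra.
  rewrite ltr0_norm// -EFinB -EFinM; congr EFin; field.
  exact: c0.
- rewrite (_ : _ @^-1` _ = `]((a - d) / c)%R, ((b - d) / c)%R]%classic); last first.
    apply/seteqP; split => x /=; rewrite !in_itv/= ltr_pdivrMr// ler_pdivlMr// /phi;
      by rewrite mulrC => /andP[? ?]; apply/andP; split; lra.
  rewrite lebesgue_measure_itv/= lte_fin ltr_pM2r ?invr_gt0// ifT; last by lra.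
  rewrite gtr0_norm// -EFinB -EFinM; congr EFin; field.
  exact: c0.
Qed.

Lemma ge0_integral_affine (c d : R) (D : set R) (g : R -> \bar R) :
  (c != 0)%R -> measurable D -> measurable_fun setT g -> (forall x, 0 <= g x) ->
  \int[leb]_(x in D) g x =
  `|c|%:E * \int[leb]_(x in (fun x => c * x + d)%R @^-1` D) g (c * x + d)%R.
Proof.
move=> c0 mD mg g0; pose phi : R -> measurableTypeR R := fun x => (c * x + d)%R.
have mphi : measurable_fun setT phi by exact: measurable_affine.
pose m := mscale (NngNum (normr_ge0 c)) (image_measure leb mphi).
rewrite (eq_measure_integral m); last first.
  by move=> A mA _; exact: lebesgue_measure_affine.
rewrite ge0_integral_mscale//; last exact: measurable_funTS.
by rewrite ge0_integral_pushforward//; exact: measurable_funTS.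
Qed.

(** Keeping [c] as a factor includes [c = 0], where both sides are 0; this occurs for the fractions
    0 and 1. *)
Lemma ge0_integral_unit_affine (c d : R) (g : R -> \bar R) :
  (0 <= c)%R -> measurable_fun setT g -> (forall x, 0 <= g x) ->
  c%:E * \int[leb]_(v in `[0%R, 1%R]) g (c * v + d)%R =
  \int[leb]_(x in `[d, (d + c)%R]) g x.
Proof.
rewrite le_eqVlt => /predU1P[<- mg g0|c0 mg g0].
  by rewrite mul0e addr0 set_itv1 integral_set1.
rewrite [RHS](@ge0_integral_affine c d) ?gt_eqF//.
rewrite gtr0_norm//; congr (_ * integral _ _ _).
apply/seteqP; split => x /=; rewrite !in_itv/= => /andP[? ?]; apply/andP; split;
  nra.
Qed.

Lemma ge0_integral_unit_onem (g : R -> \bar R) :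
  measurable_fun setT g -> (forall x, 0 <= g x) ->
  \int[leb]_(v in `[0%R, 1%R]) g (1 - v)%R = \int[leb]_(v in `[0%R, 1%R]) g v.
Proof.
move=> mg g0; rewrite [RHS](@ge0_integral_affine (-1) 1) ?oppr_eq0 ?oner_eq0//.
rewrite normrN normr1 mul1e.
rewrite (_ : _ @^-1` _ = `[0%R, 1%R]%classic).
  by apply: eq_integral => x _; rewrite mulN1r addrC.
by apply/seteqP; split => x /=; rewrite !in_itv/= => /andP[? ?];
  apply/andP; split; lra.
Qed.

End lebesgue_affine.

Lemma integral_probability_cst d (T : measurableType d) (R : realType)
  (P : probability T R) (c : \bar R) : (\int[P]_x c = c)%E.
Proof.
by rewrite integral_cst// [X in (_ * X)%E](_ : _ = 1%E) ?mule1//; exact: probability_setT.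
Qed.

(** * One exchange and the Beta(2,2) law *)

Section unit_square.
Context (R : realType).
Notation leb := (@lebesgue_measure R).
Local Open Scope ereal_scope.

(* The library puts these distributions on [measurableTypeR R]. *)
Definition Rid : measurableTypeR R -> R := idfun.

HB.instance Definition _ :=
  isMeasurableFun.Build _ _ _ _ Rid (@measurable_id _ _ setT).

Definition unif : probability R R := distribution (uniform_prob (@ltr01 R)) Rid.

Definition beta22 : probability R R := distribution (@beta_prob R 2 2) Rid.

Lemma ge0_integral_unif (g : R -> \bar R) :
  measurable_fun setT g -> (forall x, 0 <= g x) ->
  \int[unif]_x g x = \int[leb]_(x in `[0%R, 1%R]) g x.
Proof.
move=> mg g0; rewrite ge0_integral_distribution//.
by rewrite integral_uniform// subr0 invr1 mul1e.
Qed.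

Lemma unif01 : unif `[0%R, 1%R]%classic = 1.
Proof.
rewrite /unif/= /distribution /pushforward/= /uniform_prob.
exact: integral_uniform_pdf1.
Qed.

Lemma beta2201 : beta22 `[0%R, 1%R]%classic = 1.
Proof. by rewrite /beta22/= /distribution /pushforward/=; exact: beta_prob01. Qed.

Lemma ge0_integral_beta22 (g : R -> \bar R) :
  measurable_fun setT g -> (forall x, 0 <= g x) ->
  \int[beta22]_x g x < +oo ->
  \int[beta22]_x g x = \int[leb]_x (g x * (beta_pdf 2 2 x)%:E).
Proof.
move=> mg g0; rewrite ge0_integral_distribution// => glty.
rewrite integral_beta_prob//.
by rewrite (eq_integral (g \o Rid))// => x _; rewrite gee0_abs/=.
Qed.

Lemma expect_unif (h : R -> R) : bmeas h ->
  (\int[unif]_x h x = \int[leb]_(x in `[0%R, 1%R]) h x)%R.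
Proof.
move=> bh; have [M [bhM h0 hME]] := bmeas_shift bh.
apply: (addIr M); rewrite /= -(hME unif (probability_setT _)).
have lebI : leb `[0%R, 1%R]%classic = 1.
  by rewrite lebesgue_measure_itv/= lte_fin ltr01 oppr0 adde0.
have Ih (f : R -> R) : bmeas f ->
    leb.-integrable `[0%R, 1%R] (EFin \o f).
  move=> [mf [N fN]]; apply: measurable_bounded_integrable.
  - exact: measurable_itv.
  - by have := ltry (1%R : R); rewrite -lebI.
  - exact: measurable_funTS.
  - by exists N; split; [exact: num_real|move=> y Ny x _ /=; rewrite (le_trans (fN x))// ltW].
rewrite -[M in RHS](_ : \int[leb]_(x in `[0%R, 1%R]) M = M)%R; last first.
  by rewrite Rintegral_cst// [X in fine X](_ : _ = 1) ?mulr1.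
rewrite -RintegralD//; [|exact: Ih|by apply: Ih; exact: bmeas_cst].
rewrite /Rintegral ge0_integral_unif//.
by apply/measurable_EFinP; case: bhM.
Qed.

Lemma lebesgue_tonelli (F : R -> R -> \bar R) :
  measurable_fun setT (fun w : R * R => F w.1 w.2) -> (forall x y, 0 <= F x y) ->
  \int[leb]_x \int[leb]_y F x y = \int[leb]_y \int[leb]_x F x y.
Proof.
move=> mF F0.
by apply: (@fubini_tonelli _ _ (measurableTypeR R) (measurableTypeR R) R leb leb (fun w : R * R => F w.1 w.2)) => // w.
Qed.

(** The fraction of the total held by the first component after an exchange that starts from the
    fraction [p]: on a line [x + y = s] the dynamics of the fraction does not involve [s]. *)
Definition mix (p u v : R) : R := (p * (1 - u) + (1 - p) * v)%R.

Lemma mixE p u v : mix p u v = ((1 - p) * v + p * (1 - u))%R.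
Proof. by rewrite /mix addrC. Qed.

Lemma mix01 p u v : (0 <= p <= 1 -> 0 <= u <= 1 -> 0 <= v <= 1 ->
  0 <= mix p u v <= 1)%R.
Proof. by rewrite /mix => /andP[? ?] /andP[? ?] /andP[? ?]; apply/andP; split; nra. Qed.

Lemma measurable_mix : measurable_fun setT (fun w : R * R * R => mix w.1.1 w.1.2 w.2).
Proof.
rewrite /mix; apply: measurable_funD; apply: measurable_funM => //=.
- by apply: measurableT_comp => //; exact: measurable_fst.
- apply: measurable_funB => //.
  by apply: measurableT_comp => //; exact: measurable_fst.
- apply: measurable_funB => //.
  by apply: measurableT_comp => //; exact: measurable_fst.
Qed.

Lemma measurable_mix2 p : measurable_fun setT (fun w : R * R => mix p w.1 w.2).
Proof.
rewrite /mix; apply: measurable_funD; apply: measurable_funM => //=;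
  exact: measurable_funB.
Qed.

(** Doeblin's condition. For [p <= 1/2] freeze [u] in [[1/2, 1]]: the segment of length [1 - p]
    swept by [v] starts at [p (1 - u) <= 1/4] and ends at [1 - p u >= 1/2]. For [p > 1/2] freeze [v]
    in [[0, 1/2]] and sweep with [u]. Freezing costs the factor 1/2. *)
Lemma mix_minor (p : R) (g : R -> \bar R) : (0 <= p <= 1)%R ->
  measurable_fun setT g -> (forall x, 0 <= g x) ->
  (2^-1)%:E * \int[leb]_(x in `[(4^-1)%R, (2^-1)%R]) g x <=
  \int[unif]_u \int[unif]_v g (mix p u v).
Proof.
move=> /andP[p0 p1] mg g0; set K := \int[leb]_(x in _) g x.
have K0 : 0 <= K by exact: integral_ge0.
have mgm : measurable_fun setT (fun w : R * R => g (mix p w.1 w.2)).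
  exact: (measurableT_comp mg (measurable_mix2 p)).
have half (F : R -> \bar R) (a b : R) : (b - a = 2^-1)%R -> (0 <= a)%R -> (b <= 1)%R ->
    measurable_fun setT F -> (forall x, 0 <= F x) ->
    (forall x, (a <= x <= b)%R -> K <= F x) -> (2^-1)%:E * K <= \int[unif]_x F x.
  move=> ba a0 b1 mF F0 KF; rewrite ge0_integral_unif//.
  apply: (@le_trans _ _ (\int[leb]_(x in `[a, b]) F x)); last first.
    apply: ge0_subset_integral => //.
      exact: measurable_funTS.
    by move=> x /=; rewrite !in_itv/= => /andP[? ?]; apply/andP; split; lra.
  apply: (@le_trans _ _ (\int[leb]_(x in `[a, b]) K)).
    rewrite integral_cst//= lebesgue_measure_itv/= lte_fin ifT; last by lra.
    by rewrite -EFinB ba muleC.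
  apply: ge0_le_integral => //; exact: measurable_funTS.
(* The segment [[d, d + c]] contains [[1/4, 1/2]], and the Jacobian [1 / c] is at least 1. *)
have seg (c d : R) : (0 <= c <= 1)%R -> (d <= 4^-1)%R -> (2^-1 <= d + c)%R ->
    K <= \int[unif]_v g (c * v + d)%R.
  move=> /andP[c0 c1] d4 dc.
  have mgc : measurable_fun setT (fun v => g (c * v + d)%R).
    exact: (measurableT_comp mg (measurable_affine _ _)).
  have I0 : 0 <= \int[leb]_(v in `[0%R, 1%R]) g (c * v + d)%R.
    exact: integral_ge0.
  rewrite ge0_integral_unif//.
  apply: (@le_trans _ _ (c%:E * \int[leb]_(v in `[0%R, 1%R]) g (c * v + d)%R)).
    rewrite ge0_integral_unit_affine//; apply: ge0_subset_integral => //.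
      exact: measurable_funTS.
    by move=> x /=; rewrite !in_itv/= => /andP[? ?]; apply/andP; split; lra.
  by rewrite -[leRHS]mul1e lee_wpmul2r// lee_fin.
have [p2|p2] := leP p (2^-1)%R.
  apply: (half _ (2^-1)%R 1%R) => //; first by lra.
  - exact: (measurable_fun_fubini_tonelli_F _ mgm).
  - by move=> x; apply: integral_ge0.
  - move=> u /andP[u2 u1]; under eq_integral do rewrite mixE.
    by apply: seg; nra.
rewrite (fubini_tonelli (fun w => g (mix p w.1 w.2)))//=.
apply: (half _ 0%R (2^-1)%R) => //; first by lra.
- by lra.
- exact: (measurable_fun_fubini_tonelli_G _ mgm).
- by move=> x; apply: integral_ge0.
- move=> v /andP[v0 v2].
  have mgp : measurable_fun setT (fun x => g (p * x + (1 - p) * v)%R).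
    exact: (measurableT_comp mg (measurable_affine _ _)).
  have -> : \int[unif]_u g (mix p u v) = \int[unif]_u g (p * u + (1 - p) * v)%R.
    rewrite !ge0_integral_unif//; last first.
      exact: (measurableT_comp mgm (measurable_pair2 v)).
    exact: (ge0_integral_unit_onem mgp).
  by apply: seg; nra.
Qed.

Lemma beta22_pdf (p : R) :
  beta_pdf 2 2 p = (if (0 <= p <= 1) then 6 * (p * (1 - p)) else 0)%R.
Proof.
rewrite /beta_pdf patchE mem_setE in_itv/=; case: ifP => _; last by rewrite mul0r.
rewrite beta_funE/= /XMonemX/= !expr1 /unstable.onem.
by rewrite (_ : 1`! = 1)%N// (_ : (1 + 2)`! = 6)%N//; field.
Qed.

(** Joint density of the old fraction [p], the kept amount [a = p (1 - u)] and the new fraction [x]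
    under a Beta(2,2) start. Its conditions read [0 <= a <= min p x] and [p + x <= 1 + a]: the
    symmetry in [p] and [x] is why Beta(2,2) is invariant. *)
Let k (p a x : R) : R :=
  (if [&& 0 <= a, a <= p, a <= x & x <= a + (1 - p)] then 6 else 0)%R.

Let measurable_k d (T : measurableType d) (p a x : T -> R) :
  measurable_fun setT p -> measurable_fun setT a -> measurable_fun setT x ->
  measurable_fun setT (fun t => k (p t) (a t) (x t)).
Proof.
move=> mp ma mx; apply: measurable_fun_ifT => //.
apply: measurable_and; first exact: measurable_fun_ler.
apply: measurable_and; first exact: measurable_fun_ler.
apply: measurable_and; first exact: measurable_fun_ler.
apply: measurable_fun_ler => //.
by apply: measurable_funD => //; apply: measurable_funB.
Qed.

Let k_ge0 p a x : (0 <= k p a x)%R. Proof. by rewrite /k; case: ifP. Qed.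

(* With a = p (1 - u) and x = a + (1 - p) v, the Jacobian p (1 - p) absorbs the
   Beta(2,2) density. *)
Let integral_k_l (g : R -> \bar R) (p : R) : measurable_fun setT g ->
  (forall x, 0 <= g x) ->
  (\int[unif]_u \int[unif]_v g (mix p u v)) * (beta_pdf 2 2 p)%:E =
  \int[leb]_a \int[leb]_x ((k p a x)%:E * g x).
Proof.
move=> mg g0; rewrite beta22_pdf; case: ifPn => [/andP[p0 p1]|p01]; last first.
  rewrite mule0; apply/esym/integral0_eq => a _; apply: integral0_eq => x _.
  rewrite /k ifF ?mul0e//; apply/negP => /and4P[? ? ? ?].
  by move/negP: p01; apply; apply/andP; split; lra.
have mgm : measurable_fun setT (fun w : R * R => g (mix p w.1 w.2)).
  exact: (measurableT_comp mg (measurable_mix2 p)).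
have mInner : measurable_fun setT (fun u => \int[unif]_v g (mix p u v)).
  apply: (@measurable_fun_fubini_tonelli_F _ _ R R R unif
    (fun w : R * R => g (mix p w.1 w.2))) => //.
rewrite ge0_integral_unif; last 2 first.
- exact: mInner.
- by move=> x; apply: integral_ge0.
pose H a := \int[leb]_(x in `[a, (a + (1 - p))%R]) g x.
have H0 a : 0 <= H a by apply: integral_ge0.
have HE a : H a = \int[leb]_x
    ((if (a <= x <= a + (1 - p))%R then 1 else 0)%R%:E * g x).
  rewrite /H integral_mkcond; apply: eq_integral => x _.
  by rewrite patchE mem_setE in_itv/=; case: ifP; rewrite ?mul1e ?mul0e.
have mH : measurable_fun setT H.
  rewrite (_ : H = fun a => \int[leb]_x
    ((if (a <= x <= a + (1 - p))%R then 1 else 0)%R%:E * g x)); last exact/funext.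
  apply: (@measurable_fun_fubini_tonelli_F _ _ R _ R leb (fun w : R * R =>
    ((if (w.1 <= w.2 <= w.1 + (1 - p))%R then 1 else 0)%R%:E * g w.2))) => /=.
    apply: emeasurable_funM; last exact: measurableT_comp.
    apply/measurable_EFinP; apply: measurable_fun_ifT => //.
    apply: measurable_and; first exact: measurable_fun_ler.
    by apply: measurable_fun_ler => //; exact: measurable_funD.
  by move=> w; rewrite mule_ge0//; case: ifP.
have innerE u : (1 - p)%:E * \int[unif]_v g (mix p u v) = H (p * (1 - u))%R.
  under eq_integral do rewrite mixE.
  rewrite ge0_integral_unif//; last exact: (measurableT_comp mg (measurable_affine _ _)).
  by rewrite ge0_integral_unit_affine//; lra.
rewrite muleC EFinM -muleA EFinM -muleA -[X in p%:E * X]ge0_integralZl//; last 3 first.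
- by apply: measurable_funTS; exact: mInner.
- by move=> x _; apply: integral_ge0.
- by rewrite lee_fin subr_ge0.
under eq_integral do rewrite innerE.
rewrite (ge0_integral_unit_onem (g := fun u => H (p * u)%R))//; last first.
  by apply: (measurableT_comp mH); exact: measurable_funM.
under eq_integral do rewrite -[(p * _)%R]addr0.
rewrite ge0_integral_unit_affine// add0r.
rewrite -ge0_integralZl//; last exact: measurable_funTS.
rewrite integral_mkcond; apply: eq_integral => a _.
rewrite patchE mem_setE in_itv/=; case: ifPn => [/andP[a0 ap]|ap].
  rewrite HE -ge0_integralZl//; last 2 first.
  - apply: emeasurable_funM => //.
    apply/measurable_EFinP; apply: measurable_fun_ifT => //.
    by apply: measurable_and; exact: measurable_fun_ler.
  - by move=> w _; rewrite mule_ge0//; case: ifP.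
  apply: eq_integral => x _; rewrite muleA; congr (_ * _).
  by rewrite /k a0 ap/=; case: ifP; rewrite ?mule1 ?mule0.
apply/esym/integral0_eq => x _; rewrite /k ifF ?mul0e//.
by apply/negP => /and4P[a0 ap']; rewrite a0 ap' in ap.
Qed.

(** For fixed [a <= x] the fraction [p] ranges over an interval of length [1 - x], whatever [a] is,
    and then [a] ranges over [[0, x]]; hence the density [6 x (1 - x)] again. *)
Let integral_k_r (g : R -> \bar R) (x : R) : (forall x, 0 <= g x) ->
  \int[leb]_a \int[leb]_p ((k p a x)%:E * g x) = g x * (beta_pdf 2 2 x)%:E.
Proof.
move=> g0; pose c : R := (if (0 <= x <= 1) then 6 * (1 - x) else 0)%R.
have c0 : (0 <= c)%R by rewrite /c; case: ifP => // /andP[]; lra.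
transitivity (\int[leb]_a (((if (0 <= a <= x) then c else 0)%R%:E) * g x)).
  apply: eq_integral => a _; rewrite ge0_integralZr//; last 2 first.
  - by apply/measurable_EFinP; apply: measurable_k.
  - by move=> p _; rewrite lee_fin k_ge0.
  congr (_ * _); case: ifPn => [/andP[a0 ax]|ax]; last first.
    apply: integral0_eq => p _; rewrite /k ifF//; apply/negP => /and4P[a0 _ ax' _].
    by rewrite a0 ax' in ax.
  transitivity (\int[leb]_(p in `[a, (1 + a - x)%R]) 6%:E).
    rewrite [RHS]integral_mkcond; apply: eq_integral => p _.
    rewrite patchE mem_setE in_itv/= /k a0 ax/=.
    by rewrite (_ : (x <= a + (1 - p))%R = (p <= 1 + a - x)%R)//;
      [case: ifP|apply/idP/idP; lra].
  rewrite integral_cst//= lebesgue_measure_itv/= lte_fin /c.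
  have -> : (0 <= x <= 1)%R = (x <= 1)%R by rewrite (le_trans a0 ax).
  have [x1|x1|->] := ltgtP x 1%R.
  - by rewrite ifT; [rewrite -EFinB -EFinM; congr EFin; ring|lra].
  - by rewrite ifF ?mule0//; apply/negbTE; rewrite -leNgt; lra.
  - by rewrite ifF ?mule0 ?subrr ?mulr0//; apply/negbTE; rewrite -leNgt; lra.
rewrite ge0_integralZr//; last 2 first.
- apply/measurable_EFinP; apply: measurable_fun_ifT => //.
  by apply: measurable_and; exact: measurable_fun_ler.
- by move=> a _; rewrite lee_fin; case: ifP.
rewrite muleC; congr (_ * _).
transitivity (\int[leb]_(a in `[0%R, x]) c%:E).
  rewrite [RHS]integral_mkcond; apply: eq_integral => a _.
  by rewrite patchE mem_setE in_itv/=; case: ifP.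
rewrite integral_cst//= lebesgue_measure_itv/= lte_fin beta22_pdf /c.
have [x0|x0|<-] := ltgtP 0%R x.
- by case: ifP => _; rewrite -EFinB -EFinM; congr EFin; ring.
- by rewrite mule0.
- by rewrite mule0 mul0r mulr0; case: ifP.
Qed.

(** Both sides are the triple integral of [k p a x] times [h x], in the orders [p, a, x] and
    [x, a, p]. The bound on [h] gives the finiteness that [ge0_integral_beta22] asks for. *)
Lemma beta22_mixE (h : R -> R) : bmeas h -> (forall x, 0 <= h x)%R ->
  \int[beta22]_p \int[unif]_u \int[unif]_v (h (mix p u v))%:E =
  \int[beta22]_x (h x)%:E.
Proof.
move=> bh h0; have [mh [M hM]] := bh; pose g := EFin \o h.
have mg : measurable_fun setT g by exact/measurable_EFinP.
have g0 x : 0 <= g x by rewrite lee_fin.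
have hle x : (h x <= M)%R by have := hM x; rewrite ger0_norm.
have M0 : (0 <= M)%R by exact: le_trans (hle 0%R).
have lty (F : R -> \bar R) : measurable_fun setT F -> (forall x, 0 <= F x) ->
    (forall x, F x <= M%:E) -> \int[beta22]_x F x < +oo.
  move=> mF F0 FM; apply: (@le_lt_trans _ _ (\int[beta22]_x M%:E)).
    by apply: ge0_le_integral.
  by rewrite integral_probability_cst ltry.
have mgm : measurable_fun setT (fun w : R * R * R => g (mix w.1.1 w.1.2 w.2)).
  exact: (measurableT_comp mg measurable_mix).
have mF : measurable_fun setT (fun p => \int[unif]_u \int[unif]_v g (mix p u v)).
  apply: (measurable_fun_fubini_tonelli_F (fun w => \int[unif]_v g (mix w.1 w.2 v))).
    exact: (measurable_fun_fubini_tonelli_F _ mgm).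
  by move=> w; apply: integral_ge0.
have F0 p : 0 <= \int[unif]_u \int[unif]_v g (mix p u v).
  by apply: integral_ge0 => u _; exact: integral_ge0.
have FM p : \int[unif]_u \int[unif]_v g (mix p u v) <= M%:E.
  apply: (@le_trans _ _ (\int[unif]_u M%:E)); last first.
    by rewrite integral_probability_cst.
  apply: ge0_le_integral => //.
  - by move=> u _; apply: integral_ge0.
  - apply: (measurable_fun_fubini_tonelli_F (fun w : R * R => g (mix p w.1 w.2))) => //.
    exact: (measurableT_comp mg (measurable_mix2 p)).
  - move=> u _; apply: (@le_trans _ _ (\int[unif]_v M%:E)); last first.
      by rewrite integral_probability_cst.
    apply: ge0_le_integral => //.
    + apply: (measurableT_comp mg).
      by rewrite /mix; apply: measurable_funD => //; exact: measurable_funM.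
    + by move=> v _; rewrite lee_fin.
rewrite [RHS](ge0_integral_beta22 mg g0); last first.
  by apply: lty => // x; rewrite lee_fin.
rewrite (ge0_integral_beta22 mF F0); last exact: lty.
under eq_integral do rewrite integral_k_l//.
under [RHS]eq_integral do rewrite -integral_k_r//.
have mk3 : measurable_fun setT (fun w : R * R * R => (k w.1.1 w.1.2 w.2)%:E * g w.2).
  apply: emeasurable_funM; last exact: measurableT_comp.
  apply/measurable_EFinP; apply: measurable_k => //;
    by apply: measurableT_comp => //; exact: measurable_fst.
have k30 p a x : 0 <= (k p a x)%:E * g x by rewrite mule_ge0// lee_fin k_ge0.
transitivity (\int[leb]_p \int[leb]_x \int[leb]_a ((k p a x)%:E * g x)).
  apply: eq_integral => p _.
  apply: (lebesgue_tonelli (F := fun a x => (k p a x)%:E * g x)) => //=.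
  have mw : measurable_fun setT (fun w : R * R => (p, w.1, w.2)).
    by apply: measurable_fun_pair => //; apply: measurable_fun_pair.
  exact: (measurableT_comp mk3 mw).
transitivity (\int[leb]_x \int[leb]_p \int[leb]_a ((k p a x)%:E * g x)).
  apply: (lebesgue_tonelli (F := fun p x => \int[leb]_a ((k p a x)%:E * g x))).
    apply: (@measurable_fun_fubini_tonelli_F _ _ (R * R)%type _ R leb
      (fun z : R * R * R => (k z.1.1 z.2 z.1.2)%:E * g z.1.2)) => //=.
    have mz : measurable_fun setT (fun z : R * R * R => (z.1.1, z.2, z.1.2)).
      by apply: measurable_fun_pair; [apply: measurable_fun_pair => //|];
        apply: measurableT_comp => //; exact: measurable_fst.
    exact: (measurableT_comp mk3 mz).
  by move=> p x; apply: integral_ge0.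
apply: eq_integral => x _.
apply: (lebesgue_tonelli (F := fun p a => (k p a x)%:E * g x)) => //=.
by apply: emeasurable_funM => //; apply/measurable_EFinP; exact: measurable_k.
Qed.

End unit_square.

Section exchange_operator.
Context (R : realType).
Implicit Types (f : R * R -> R) (h : R -> R) (z : R * R).
Notation leb := (@lebesgue_measure R).
Notation unif := (@unif R).
Notation beta22 := (@beta22 R).

Definition mixing f z : R := \int[unif]_u \int[unif]_v f (exchange z u v).

Definition equilibrate f z : R := \int[beta22]_e f (split_state (z.1 + z.2) e).

Lemma measurable_exchange :
  measurable_fun setT (fun w : R * R * R * R => exchange w.1.1 w.1.2 w.2).
Proof.
have m1 : measurable_fun setT (fun w : R * R * R * R => w.1.1.1).
  by apply: measurableT_comp => //; apply: measurableT_comp.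
have m2 : measurable_fun setT (fun w : R * R * R * R => w.1.1.2).
  by apply: measurableT_comp => //; apply: measurableT_comp.
have m3 : measurable_fun setT (fun w : R * R * R * R => w.1.2).
  by apply: measurableT_comp.
by apply: measurable_fun_pair; apply: measurable_funD; apply: measurable_funM => //;
  apply: measurable_funB.
Qed.

Lemma measurable_split : measurable_fun setT (fun w : R * R => split_state w.1 w.2).
Proof.
by apply: measurable_fun_pair; apply: measurable_funM => //; apply: measurable_funB.
Qed.

Lemma measurable_split1 (s : R) : measurable_fun setT (split_state s).
Proof.
by apply: measurable_fun_pair; apply: measurable_funM => //; apply: measurable_funB.
Qed.

Lemma measurable_quadrant : measurable (@quadrant R).
Proof.
rewrite (_ : @quadrant R = `[0, +oo[%classic `*` `[0, +oo[%classic).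
  by apply: measurableX.
by apply/seteqP; split => -[x y] /=; rewrite /quadrant/= !in_itv/= !andbT.
Qed.

Lemma bmeas_split f : bmeas f -> forall s, bmeas (fun p => f (split_state s p)).
Proof. by move=> bf s; exact: (bmeas_comp (measurable_split1 s) bf). Qed.

Let bmeas_exchange f : bmeas f ->
  bmeas (fun w : R * R * R * R => f (exchange w.1.1 w.1.2 w.2)).
Proof. by move=> bf; exact: (bmeas_comp measurable_exchange bf). Qed.

Let bmeas_exchange_inner f : bmeas f ->
  bmeas (fun w : R * R * R => \int[unif]_v f (exchange w.1 w.2 v)).
Proof. by move=> bf; exact: (bmeas_expect_prod unif (bmeas_exchange bf)). Qed.

Let bmeas_exchange_v f z u : bmeas f -> bmeas (fun v => f (exchange z u v)).
Proof. by move=> bf; exact: (bmeas_section (z, u) (bmeas_exchange bf)). Qed.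

Let bmeas_exchange_u f z : bmeas f ->
  bmeas (fun u => \int[unif]_v f (exchange z u v)).
Proof. by move=> bf; exact: (bmeas_section z (bmeas_exchange_inner bf)). Qed.

Lemma bmeas_mixing f : bmeas f -> bmeas (mixing f).
Proof. by move=> bf; exact: (bmeas_expect_prod unif (bmeas_exchange_inner bf)). Qed.

Lemma exchange_generatorE f z : bmeas f ->
  exchange_generator f z = mixing f z - f z.
Proof.
move=> bf; rewrite /exchange_generator /mixing.
have uT : unif setT = 1%E by exact: probability_setT.
have bi u : bmeas (fun v => f (exchange z u v) - f z).
  by apply: bmeasB; [exact: bmeas_exchange_v|exact: bmeas_cst].
have -> : (fun u => \int[leb]_(v in `[0, 1]) (f (exchange z u v) - f z)) =
          (fun u => \int[unif]_v f (exchange z u v) - f z).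
  apply/funext => u; rewrite -(expect_unif (bi u)) expectB//.
  - by rewrite expect_cst.
  - exact: bmeas_exchange_v.
  - exact: bmeas_cst.
rewrite -expect_unif; last by apply: bmeasB; [exact: bmeas_exchange_u|exact: bmeas_cst].
by rewrite expectB ?expect_cst//; [exact: bmeas_exchange_u|exact: bmeas_cst].
Qed.

Lemma quadrant_split z : quadrant z ->
  exists2 p, 0 <= p <= 1 & z = split_state (z.1 + z.2) p.
Proof.
case: z => x y [/= x0 y0]; have [s0|s0] := eqVneq (x + y) 0.
  exists 0; first by rewrite lexx ler01.
  by rewrite /split_state s0 !mul0r; congr pair; lra.
have s_gt0 : 0 < x + y by rewrite lt0r s0 addr_ge0.
exists (x / (x + y)).
  by rewrite divr_ge0 ?addr_ge0//= ler_pdivrMr// mul1r lerDl.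
by rewrite /split_state; congr pair; field.
Qed.

Lemma split_quadrant (s p : R) : 0 <= s -> 0 <= p <= 1 -> quadrant (split_state s p).
Proof. by move=> s0 /andP[p0 p1]; split => /=; rewrite mulr_ge0// subr_ge0. Qed.

Lemma exchange_split (s p u v : R) :
  exchange (split_state s p) u v = split_state s (mix p u v).
Proof. by rewrite /exchange /split_state /mix/=; congr pair; ring. Qed.

Lemma quadrant_sum_ge0 z : quadrant z -> 0 <= z.1 + z.2.
Proof. by move=> [? ?]; rewrite addr_ge0. Qed.

Lemma exchange_sum z u v : (exchange z u v).1 + (exchange z u v).2 = z.1 + z.2.
Proof. by rewrite /exchange/=; ring. Qed.

Lemma bmeas_integrable_itv (a b : R) h : bmeas h ->
  leb.-integrable `[a, b] (EFin \o h).
Proof.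
move=> [mh [M hM]]; apply: measurable_bounded_integrable.
- exact: measurable_itv.
- have lebab : (leb `[a, b]%classic < +oo)%E.
    by rewrite lebesgue_measure_itv/=; case: ifP => _; rewrite ?ltry// -EFinB ltry.
  exact: lebab.
- exact: measurable_funTS.
- by exists M; split; [exact: num_real|move=> y My x _ /=; rewrite (le_trans (hM x))// ltW].
Qed.

(** Both [g = h - l] and [m - g] are nonnegative on [[0, 1]], and the minorization applies to each,
    with integrals [K] and [m / 4 - K]. One average gains [K / 2] at the bottom and loses
    [m / 8 - K / 2] at the top, so the range shrinks by [m / 8] whatever [K] is. *)
Lemma mix_contraction h l m : bmeas h ->
  (forall p, 0 <= p <= 1 -> l <= h p <= l + m) ->
  exists l', forall p, 0 <= p <= 1 ->
    l' <= \int[unif]_u \int[unif]_v h (mix p u v) <= l' + 7 / 8 * m.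
Proof.
move=> bh hlm.
have uT : unif setT = 1%E by exact: probability_setT.
have m01 : measurable (`[0, 1]%classic : set R) by [].
pose I : R -> R := \1_(`[0, 1]%classic).
have IE x : I x = if 0 <= x <= 1 then 1 else 0.
  by rewrite /I indicE mem_setE in_itv/=; case: ifP.
have bI : bmeas I by exact: bmeas_indic.
have h01 p : 0 <= p <= 1 -> l <= h p /\ h p <= l + m by move=> /hlm /andP.
have m0 : 0 <= m by have [] := h01 0 ltac:(by rewrite lexx ler01); lra.
(* Cut off outside [[0, 1]], because [minor] wants functions that are nonnegative on the whole line
   while [h] is controlled on [[0, 1]] only. *)
pose g x := (h x - l) * I x.
have bg : bmeas g by apply: bmeasM => //; apply: bmeasB => //; exact: bmeas_cst.
have bmix p (k : R -> R) : bmeas k -> bmeas (fun w : R * R => k (mix p w.1 w.2)).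
  by move=> bk; exact: (bmeas_comp (measurable_mix2 p) bk).
have minor (k : R -> R) p : bmeas k -> (forall x, 0 <= k x) -> 0 <= p <= 1 ->
    2^-1 * \int[leb]_(x in `[4^-1, 2^-1]) k x <=
    \int[unif]_u \int[unif]_v k (mix p u v).
  move=> bk k0 p01; have [mk _] := bk.
  have kI : leb.-integrable `[4^-1, 2^-1] (EFin \o k) by exact: bmeas_integrable_itv.
  rewrite -lee_fin EFinM [X in (_ * X <= _)%E]fineK; last exact: integrable_fin_num.
  rewrite -fin_integral_bmeas//; last exact: (bmeas_expect_prod unif (bmix p k bk)).
  under [leRHS]eq_integral.
    move=> u _; rewrite -fin_integral_bmeas//; last first.
      exact: (bmeas_section u (bmix p k bk)).
    over.
  by apply: (mix_minor (g := EFin \o k)) => //; exact/measurable_EFinP.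
have g0 x : 0 <= g x.
  rewrite /g IE; case: ifP => [/h01[? _]|_]; last by rewrite mulr0.
  by rewrite mulr1 subr_ge0.
have gm x : 0 <= m * I x - g x.
  rewrite /g IE; case: ifP => [/h01[_ ?]|_]; last by rewrite !mulr0 subr0.
  by rewrite !mulr1; lra.
pose K := \int[leb]_(x in `[4^-1, 2^-1]) g x.
have Kc : \int[leb]_(x in `[4^-1, 2^-1]) (m * I x - g x) = m / 4 - K.
  have leb4 : fine (leb `[4^-1, 2^-1]%classic) = 4^-1.
    rewrite lebesgue_measure_itv/= lte_fin ifT; first by rewrite /=; lra.
    by lra.
  transitivity (\int[leb]_(x in `[4^-1, 2^-1]) (m - g x)).
    apply: eq_Rintegral => x; rewrite mem_setE in_itv/= => /andP[? ?].
    by rewrite IE ifT ?mulr1//; apply/andP; split; lra.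
  rewrite RintegralB//; [|exact/bmeas_integrable_itv/bmeas_cst|exact: bmeas_integrable_itv].
  by rewrite Rintegral_cst// leb4.
exists (l + 2^-1 * K) => p p01.
have bgp := bmix p g bg.
have inner u : 0 <= u <= 1 ->
    \int[unif]_v h (mix p u v) = l + \int[unif]_v g (mix p u v).
  move=> u01; rewrite -{1}(expect_cst uT l) -expectD//; last 2 first.
  - exact: bmeas_cst.
  - exact: (bmeas_section u bgp).
  apply: (expect_eq_on uT m01 (@unif01 R)).
  - exact: (bmeas_section u (bmix p h bh)).
  - by apply: bmeasD; [exact: bmeas_cst|exact: (bmeas_section u bgp)].
  move=> v /=; rewrite in_itv/= => v01.
  by rewrite /g IE ifT ?mix01//; ring.
have bG : bmeas (fun u => \int[unif]_v g (mix p u v)).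
  exact: (bmeas_expect_prod unif bgp).
have -> : \int[unif]_u \int[unif]_v h (mix p u v) =
    l + \int[unif]_u \int[unif]_v g (mix p u v).
  rewrite -[l in RHS](expect_cst uT l) -expectD//; last exact: bmeas_cst.
  apply: (expect_eq_on uT m01 (@unif01 R)).
  - exact: (bmeas_expect_prod unif (bmix p h bh)).
  - by apply: bmeasD => //; exact: bmeas_cst.
  - by move=> u /=; rewrite in_itv/=; exact: inner.
have lo := minor g p bg g0 p01.
have bmg : bmeas (fun x => m * I x - g x) by apply: bmeasB => //; exact: bmeasZ.
have := minor _ p bmg gm p01; rewrite Kc.
have -> : \int[unif]_u \int[unif]_v (m * I (mix p u v) - g (mix p u v)) =
    m - \int[unif]_u \int[unif]_v g (mix p u v).
  rewrite -[m in RHS](expect_cst uT m) -expectB//; last exact: bmeas_cst.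
  apply: (expect_eq_on uT m01 (@unif01 R)).
  - exact: (bmeas_expect_prod unif (bmix p _ bmg)).
  - by apply: bmeasB => //; exact: bmeas_cst.
  move=> u /=; rewrite in_itv/= => u01.
  rewrite -[m in RHS](expect_cst uT m) -expectB//; last 2 first.
  - exact: bmeas_cst.
  - exact: (bmeas_section u bgp).
  apply: (expect_eq_on uT m01 (@unif01 R)).
  - exact: (bmeas_section u (bmix p _ bmg)).
  - by apply: bmeasB; [exact: bmeas_cst|exact: (bmeas_section u bgp)].
  by move=> v /=; rewrite in_itv/= => v01; rewrite IE ifT ?mulr1// mix01.
by move=> hi; apply/andP; split; rewrite -/K in lo; lra.
Qed.

Lemma bmeas_equilibrate f : bmeas f -> bmeas (equilibrate f).
Proof.
move=> bf; have ms : measurable_fun setT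
    (fun w : R * R * R => split_state (w.1.1 + w.1.2) w.2).
  have m1 : measurable_fun setT (fun w : R * R * R => w.1.1 + w.1.2).
    by apply: measurable_funD; apply: measurableT_comp => //; apply: measurableT_comp.
  by apply: measurable_fun_pair; apply: measurable_funM => //; apply: measurable_funB.
exact: (bmeas_expect_prod beta22 (bmeas_comp ms bf)).
Qed.

Lemma beta22_mix h : bmeas h ->
  \int[beta22]_p \int[unif]_u \int[unif]_v h (mix p u v) = \int[beta22]_x h x.
Proof.
move=> bh; have [M [bhM h0 hME]] := bmeas_shift bh.
have bT : beta22 setT = 1%E by exact: probability_setT.
have uT : unif setT = 1%E by exact: probability_setT.
have b3 : bmeas (fun w : R * R * R => h (mix w.1.1 w.1.2 w.2)).
  exact: (bmeas_comp (@measurable_mix R) bh).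
have b3M : bmeas (fun w : R * R * R => h (mix w.1.1 w.1.2 w.2) + M).
  exact: (bmeas_comp (@measurable_mix R) bhM).
have b2 : bmeas (fun w : R * R => \int[unif]_v h (mix w.1 w.2 v)).
  exact: (bmeas_expect_prod unif b3).
have b2M : bmeas (fun w : R * R => \int[unif]_v (h (mix w.1 w.2 v) + M)).
  exact: (bmeas_expect_prod unif b3M).
have b1 : bmeas (fun p => \int[unif]_u \int[unif]_v h (mix p u v)).
  exact: (bmeas_expect_prod unif b2).
have b1M : bmeas (fun p => \int[unif]_u \int[unif]_v (h (mix p u v) + M)).
  exact: (bmeas_expect_prod unif b2M).
apply: (addIr M); rewrite /= -(hME beta22 bT).
rewrite -[M in LHS](expect_cst bT M) -expectD//; last exact: bmeas_cst.
apply: EFin_inj; rewrite -[RHS]fin_integral_bmeas//.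
rewrite -(beta22_mixE bhM h0) -fin_integral_bmeas//; last first.
  by apply: bmeasD => //; exact: bmeas_cst.
apply: eq_integral => p _.
transitivity ((\int[unif]_u \int[unif]_v (h (mix p u v) + M))%:E)%E.
  congr EFin; rewrite -[M in LHS](expect_cst uT M) -expectD//; last 2 first.
  - exact: (bmeas_section p b2).
  - exact: bmeas_cst.
  apply: eq_Rintegral => u _; rewrite expectD//.
  - by rewrite (expect_cst uT).
  - exact: (bmeas_section (p, u) b3).
  - exact: bmeas_cst.
rewrite -fin_integral_bmeas//; last exact: (bmeas_section p b2M).
apply: eq_integral => u _; rewrite -fin_integral_bmeas//.
exact: (bmeas_section (p, u) b3M).
Qed.

Lemma equilibrate_mixing f z : bmeas f -> equilibrate (mixing f) z = equilibrate f z.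
Proof.
move=> bf; rewrite /equilibrate -(beta22_mix (bmeas_split bf (z.1 + z.2))).
apply: eq_Rintegral => p _; apply: eq_Rintegral => u _; apply: eq_Rintegral => v _.
by rewrite exchange_split.
Qed.

Lemma mixing_line_invariant f z : (forall w, f w = f (w.1 + w.2, 0)) ->
  mixing f z = f z.
Proof.
move=> fE; have uT : unif setT = 1%E by exact: probability_setT.
rewrite /mixing -[RHS](expect_cst uT); apply: eq_Rintegral => u _.
rewrite -[RHS](expect_cst uT); apply: eq_Rintegral => v _.
by rewrite fE exchange_sum -fE.
Qed.

Lemma equilibrate_line f z : equilibrate f z = equilibrate f (z.1 + z.2, 0).
Proof. by rewrite /equilibrate /= addr0. Qed.

End exchange_operator.

(** * Convergence of the semigroup *)

Section semigroup.
Context (R : realType) (P : R -> R.-pker (R * R) ~> (R * R)%type).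
Hypothesis P_transition : transition_function P.
Hypothesis P_generator : has_generator P (@exchange_generator R).
Implicit Types (f : R * R -> R) (z : R * R) (t : R).

Definition semigroup t f z : R := \int[P t z]_w f w.

Let PT t z : P t z setT = 1%E. Proof. exact: prob_kernel. Qed.

Let PQ t z : 0 <= t -> quadrant z -> P t z (@quadrant R) = 1%E.
Proof. by move=> t0 qz; case: P_transition => + _ _; exact. Qed.

Let mQ := @measurable_quadrant R.

Lemma bmeas_semigroup t f : bmeas f -> bmeas (semigroup t f).
Proof. exact: bmeas_expect_kernel. Qed.

Lemma semigroup0 f z : quadrant z -> bmeas f -> semigroup 0 f z = f z.
Proof.
move=> qz bf; rewrite /semigroup /Rintegral.
rewrite (eq_measure_integral (\d_z)); last first.
  by move=> A mA _; case: P_transition => _ + _; exact.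
rewrite integral_dirac//; last by case: bf => /measurable_EFinP.
by rewrite diracT mul1e.
Qed.

Lemma semigroupD s t f z : 0 <= s -> 0 <= t -> quadrant z -> bmeas f ->
  semigroup (s + t) f z = semigroup s (semigroup t f) z.
Proof.
move=> s0 t0 qz bf; apply: expect_mixture => // A mA.
by case: P_transition => _ _; exact.
Qed.

Lemma semigroup_small_step f e : bmeas f -> 0 < e ->
  exists2 d0, 0 < d0 & forall d z, 0 < d -> d < d0 -> quadrant z ->
    `|semigroup d f z - ((1 - d) * f z + d * mixing f z)| <= d * e.
Proof.
move=> bf e0; have := P_generator (bf.1) (bmeas_bounded bf) e0.
rewrite near_withinE => /nbhs_ballP[d0 /= d0_gt0 H].
exists d0 => // d z d_gt0 dd0 qz.
have := H d; rewrite /ball/= sub0r normrN gtr0_norm// => /(_ dd0 d_gt0 z qz).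
rewrite exchange_generatorE// -/(semigroup d f z) => ineq.
rewrite (_ : semigroup d f z - _ =
  d * ((semigroup d f z - f z) / d - (mixing f z - f z))); last first.
  by field; rewrite gt_eqF.
by rewrite normrM gtr0_norm// ler_pM2l.
Qed.

(** An Euler step at an arbitrary time: integration against [P t z] transports the expansion at time
    0 to time [t]. That [d0] depends neither on [t] nor on [z] lets the step be iterated. *)
Lemma semigroup_step f e : bmeas f -> 0 < e ->
  exists2 d0, 0 < d0 & forall d t z, 0 < d -> d < d0 -> 0 <= t -> quadrant z ->
    `|semigroup (t + d) f z -
      ((1 - d) * semigroup t f z + d * semigroup t (mixing f) z)| <= d * e.
Proof.
move=> bf e0; have [d0 d0_gt0 H] := semigroup_small_step bf e0.
exists d0 => // d t z d_gt0 dd0 t0 qz; rewrite semigroupD//; last exact: ltW.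
have bG := bmeas_mixing bf; have bd := bmeas_semigroup d bf.
rewrite /semigroup -!(expectZ (PT t z))// -(expectD (PT t z)); [|exact: bmeasZ..].
rewrite -(expectB (PT t z))//; last by apply: bmeasD; exact: bmeasZ.
apply: (expect_norm_on (PT t z) mQ (PQ t0 qz)); last by move=> w qw; exact: H.
by apply: bmeasB => //; apply: bmeasD; exact: bmeasZ.
Qed.

Lemma small_fraction t d0 : 0 <= t -> 0 < d0 ->
  exists n : nat, (0 < n)%N /\ t / n%:R < d0.
Proof.
move=> t0 d0_gt0; exists (Num.truncn (t / d0)).+1; split => //.
rewrite ltr_pdivrMr ?ltr0n// mulrC -ltr_pdivrMr//.
exact: truncnS_gt.
Qed.

(** As [mixing f = f] on the quadrant, an Euler step moves the semigroup by at most [d e]; [n] equal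
    steps shorter than [d0] cover [[0, t]] at the total cost [t e], with [e] arbitrary. *)
Lemma semigroup_invariant t f z : 0 <= t -> quadrant z -> bmeas f ->
  (forall w, quadrant w -> mixing f w = f w) -> semigroup t f z = f z.
Proof.
move=> t0 qz bf Gf; apply/eqP; rewrite -subr_eq0 -normr_le0.
have : forall e, 0 < e -> `|semigroup t f z - f z| <= t * e.
  move=> e e0; have [d0 d0_gt0 H] := semigroup_step bf e0.
  have [->|t_neq0] := eqVneq t 0; first by rewrite semigroup0// subrr normr0 mul0r.
  have t_gt0 : 0 < t by rewrite lt0r t_neq0.
  have [n [n0 td]] := small_fraction t0 d0_gt0; set d := t / n%:R in td.
  have d_gt0 : 0 < d by rewrite divr_gt0// ltr0n.
  have dn : d * n%:R = t by rewrite /d divfK// pnatr_eq0 -lt0n.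
  suff : forall k : nat, `|semigroup (d * k%:R) f z - f z| <= d * k%:R * e.
    by move/(_ n); rewrite dn.
  elim=> [|k IH]; first by rewrite mulr0 semigroup0// subrr normr0 mul0r.
  have dk0 : 0 <= d * k%:R by rewrite mulr_ge0 ?ler0n// ltW.
  have := H d (d * k%:R) z d_gt0 td dk0 qz.
  have -> : semigroup (d * k%:R) (mixing f) z = semigroup (d * k%:R) f z.
    apply: (expect_eq_on (PT _ z) mQ (PQ dk0 qz)) => //; exact: bmeas_mixing.
  rewrite -natr1 mulrDr mulr1 => ineq.
  have -> : (d * k%:R + d) * e = d * e + d * k%:R * e by ring.
  apply: le_trans (lerD ineq IH); apply: le_trans (ler_normD _ _).
  by rewrite le_eqVlt; apply/orP; left; apply/eqP; congr Num.norm; ring.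
move=> H; apply/ler_addgt0Pl => e e0; rewrite addr0.
apply: (le_trans (H (e / (t + 1)) _)); first by rewrite divr_gt0// ltr_wpDl.
by rewrite mulrA ler_pdivrMr ?ltr_wpDl// mulrC ler_pM2l// lerDl.
Qed.

Lemma geometric_small (r C e : R) : 0 <= r -> r < 1 -> 0 < e ->
  exists n : nat, r ^+ n * C <= e.
Proof.
move=> r0 r1 e0; have C1 : 0 < `|C| + 1 by rewrite ltr_wpDl.
have : (r ^+ n : R) @[n --> \oo] --> (0 : R) by apply: cvg_expr; rewrite ger0_norm.
move=> /cvgrPdist_le/(_ _ (divr_gt0 e0 C1))[N _ /(_ N (leqnn N))].
rewrite sub0r normrN ger0_norm ?exprn_ge0// ler_pdivlMr// => rN; exists N.
by apply: le_trans rN; rewrite ler_wpM2l ?exprn_ge0//; have := ler_norm C; lra.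
Qed.

Definition line_osc f m := forall s, 0 <= s ->
  exists l, forall p, 0 <= p <= 1 -> l <= f (split_state s p) <= l + m.

Lemma line_osc_mixing f m : bmeas f -> line_osc f m ->
  line_osc (mixing f) (7 / 8 * m).
Proof.
move=> bf fm s s0; have [l fl] := fm s s0.
have [l' Hl'] := mix_contraction (bmeas_split bf s) fl.
exists l' => p p01; have := Hl' p p01.
rewrite /mixing; under eq_Rintegral do under eq_Rintegral do rewrite -exchange_split.
by [].
Qed.

Lemma line_osc_equilibrate f m z : bmeas f -> line_osc f m -> quadrant z ->
  `|f z - equilibrate f z| <= m.
Proof.
move=> bf fm qz; have s0 := quadrant_sum_ge0 qz.
have [p p01 zE] := quadrant_split qz; have [l fl] := fm _ s0.
have bT : beta22 R setT = 1%E by exact: probability_setT.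
have m01 : measurable (`[0, 1]%classic : set R) by [].
have bs := bmeas_split bf (z.1 + z.2).
have lo : l <= equilibrate f z.
  rewrite -(expect_cst bT l); apply: (expect_le_on bT m01 (@beta2201 R)) => //.
    exact: bmeas_cst.
  by move=> x /=; rewrite in_itv/= => /fl /andP[].
have hi : equilibrate f z <= l + m.
  rewrite -[leRHS](expect_cst bT); apply: (expect_le_on bT m01 (@beta2201 R)) => //.
    exact: bmeas_cst.
  by move=> x /=; rewrite in_itv/= => /fl /andP[].
by have := fl p p01; rewrite -zE => /andP[? ?]; rewrite ler_norml; apply/andP; split; lra.
Qed.

Lemma semigroup_equilibrate t f z : 0 <= t -> quadrant z -> bmeas f ->
  semigroup t (equilibrate f) z = equilibrate f z.
Proof.
move=> t0 qz bf; apply: semigroup_invariant => //; first exact: bmeas_equilibrate.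
by move=> w _; apply: mixing_line_invariant => w'; exact: equilibrate_line.
Qed.

(** Induction through [mixing f], whose oscillation is smaller by 7/8 and whose equilibrium is the
    same. Once [P t (mixing f)] is close to it, the equation [d/dt P t f = P t (mixing f) - P t f]
    pulls [P t f] to the same distance. In discrete form: the excess of the error over [b + e / 3]
    shrinks by the factor [1 - d] in each Euler step. *)
Lemma semigroup_cvg_rate n f m e : bmeas f -> line_osc f m -> 0 < e ->
  exists2 T, 0 <= T & forall t z, T <= t -> quadrant z ->
    `|semigroup t f z - equilibrate f z| <= (7 / 8) ^+ n * m + e.
Proof.
elim: n => [|n IH] in f m e *.
  move=> bf fm e0; exists 0 => // t z t0 qz; rewrite mul1r.
  rewrite -[in leLHS](semigroup_equilibrate t0 qz bf).
  rewrite /semigroup -(expectB (PT t z))//; last exact: bmeas_equilibrate.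
  apply: (@le_trans _ _ m); last by rewrite lerDl ltW.
  apply: (expect_norm_on (PT t z) mQ (PQ t0 qz)).
    by apply: bmeasB => //; exact: bmeas_equilibrate.
  by move=> w qw; exact: line_osc_equilibrate.
move=> bf fm e0; have e3 : 0 < e / 3 by rewrite divr_gt0.
have bG := bmeas_mixing bf; have bPi := bmeas_equilibrate bf.
have [T T0 HT] := IH _ _ _ bG (line_osc_mixing bf fm) e3.
have [d0 d0_gt0 H] := semigroup_step bf e3.
(* The step length is fixed once for all: below [d0], and at most 1/2 so that [1 - d] lies strictly
   between 0 and 1. *)
pose d := Num.min (d0 / 2) (1 / 2).
have d_gt0 : 0 < d by rewrite lt_min !divr_gt0.
have dd0 : d < d0 by rewrite gt_min; apply/orP; left; lra.
have d1 : d <= 1 / 2 by rewrite ge_min lexx orbT.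
have [_ [C fC]] := bmeasB bf bPi.
have C0 : 0 <= C by apply: le_trans (fC (0, 0)).
have hC t z : 0 <= t -> quadrant z -> `|semigroup t f z - equilibrate f z| <= C.
  move=> t0 qz; rewrite -[in leLHS](semigroup_equilibrate t0 qz bf).
  rewrite /semigroup -(expectB (PT t z))//.
  by apply: (expect_norm_on (PT t z) mQ (PQ t0 qz)) => //; exact: bmeasB.
have [k Hk] := @geometric_small (1 - d) C (e / 3) ltac:(lra) ltac:(lra) e3.
set b := (7 / 8) ^+ n * (7 / 8 * m) + e / 3 in HT *.
have b0 : 0 <= b by apply: le_trans (HT T (0, 0) (lexx T) _); [|split].
have step t z : T <= t -> quadrant z ->
    `|semigroup (t + d) f z - equilibrate f z| - (b + e / 3) <=
    (1 - d) * (`|semigroup t f z - equilibrate f z| - (b + e / 3)).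
  move=> Tt qz; have t0 := le_trans T0 Tt.
  have h := H d t z d_gt0 dd0 t0 qz.
  have := HT t z Tt qz; rewrite equilibrate_mixing// => h1.
  set A := semigroup (t + d) f z in h *.
  set B := semigroup t f z in h *.
  set E := semigroup t (mixing f) z in h h1.
  set F := equilibrate f z in h1 *.
  have -> : A - F = (A - ((1 - d) * B + d * E)) + ((1 - d) * (B - F) + d * (E - F)).
    by ring.
  have := ler_normD (A - ((1 - d) * B + d * E)) ((1 - d) * (B - F) + d * (E - F)).
  have := ler_normD ((1 - d) * (B - F)) (d * (E - F)).
  rewrite !normrM (ger0_norm (ltW d_gt0)) (@ger0_norm _ (1 - d)); last by lra.
  have : d * `|E - F| <= d * b by rewrite ler_wpM2l// ltW.
  lra.
have iter j t z : T <= t -> quadrant z ->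
    `|semigroup (t + d * j%:R) f z - equilibrate f z| - (b + e / 3) <=
    (1 - d) ^+ j * C.
  move=> Tt qz; elim: j => [|j IHj].
    rewrite mulr0 addr0 expr0 mul1r; have := hC t z (le_trans T0 Tt) qz; lra.
  rewrite -natr1 mulrDr mulr1 addrA.
  have Tt' : T <= t + d * j%:R.
    by rewrite (le_trans Tt)// lerDl mulr_ge0// ltW.
  rewrite (le_trans (step _ _ Tt' qz))// exprS -mulrA ler_wpM2l//; lra.
(* Any later time [t] is the end of [k] steps started at [t - d k >= T]. *)
exists (T + d * k%:R); first by rewrite addr_ge0// mulr_ge0// ltW.
move=> t z Tt qz; have := iter k (t - d * k%:R) z; rewrite subrK.
move=> /(_ ltac:(lra) qz) ineq; rewrite exprSr -mulrA.
rewrite /b in ineq; lra.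
Qed.

Lemma semigroup_cvg f e : bmeas f -> 0 < e ->
  exists2 T, 0 <= T & forall t z, T <= t -> quadrant z ->
    `|semigroup t f z - equilibrate f z| <= e.
Proof.
move=> bf e0; have [_ [M fM]] := bf.
have osc : line_osc f (2 * M).
  move=> s s0; exists (- M) => p p01; have := fM (split_state s p).
  by rewrite ler_norml => /andP[? ?]; apply/andP; split; lra.
have e2 : 0 < e / 2 by rewrite divr_gt0.
have [n Hn] := @geometric_small (7 / 8) (2 * M) (e / 2) ltac:(lra) ltac:(lra) e2.
have [T T0 HT] := semigroup_cvg_rate n bf osc e2.
by exists T => // t z Tt qz; rewrite (le_trans (HT t z Tt qz))//; lra.
Qed.

(** [P (r + t) f] and [P r (P t f)] coincide and, as [r] grows, tend to the right and to the left
    side. *)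
Lemma equilibrate_semigroup t f z : 0 <= t -> quadrant z -> bmeas f ->
  equilibrate (semigroup t f) z = equilibrate f z.
Proof.
move=> t0 qz bf; apply/eqP; rewrite -subr_eq0 -normr_le0.
apply/ler_addgt0Pl => e e0; rewrite addr0.
have e2 : 0 < e / 2 by rewrite divr_gt0.
have bPf := bmeas_semigroup t bf.
have [T1 T10 H1] := semigroup_cvg bf e2.
have [T2 T20 H2] := semigroup_cvg bPf e2.
pose r := Num.max T1 T2.
have r1 : T1 <= r by rewrite le_max lexx.
have r2 : T2 <= r by rewrite le_max lexx orbT.
have := H1 (r + t) z (le_trans r1 _) qz; rewrite lerDl => /(_ t0).
rewrite semigroupD// ?(le_trans T10)//.
have := H2 r z r2 qz.
rewrite !ler_norml => /andP[? ?] /andP[? ?]; apply/andP; split; lra.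
Qed.

End semigroup.

(** * Part (a) and the invariance of the split laws *)

Section law.
Context d d' (T : measurableType d) (Y : measurableType d') (R : realType).
Variable Pr : probability T R.

Lemma expect_distribution (X : {mfun T >-> Y}) (h : Y -> R) : bmeas h ->
  \int[distribution Pr X]_y h y = \int[Pr]_w h (X w).
Proof.
move=> bh; rewrite /Rintegral integral_distribution//.
  by case: bh => /measurable_EFinP.
have bhX : bmeas (h \o X) by exact: bmeas_comp.
exact: (bmeas_integrable (@probability_setT _ _ _ Pr) bhX).
Qed.

Lemma eq_measure_expect (mu nu : {measure set Y -> \bar R}) (h : Y -> R) :
  (forall A, measurable A -> mu A = nu A) -> \int[mu]_y h y = \int[nu]_y h y.
Proof.
move=> munu; rewrite /Rintegral; congr fine.
by apply: eq_measure_integral => A mA _; exact: munu.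
Qed.

End law.

Section plane.
Context (R : realType).
Notation beta22 := (@beta22 R).

(** Open sets are countable unions of rational rectangles; in the union over all rectangles, one
    that sticks out of [U] contributes the empty set. *)
Lemma open_measurable_plane (U : set (R * R)) : open U -> measurable U.
Proof.
move=> oU.
pose rect (q : (rat * rat) * (rat * rat)) : set (R * R) :=
  `]ratr q.1.1, ratr q.1.2[%classic `*` `]ratr q.2.1, ratr q.2.2[%classic.
pose F q := if pselect (rect q `<=` U) then rect q else set0.
have -> : U = \bigcup_q F q.
  apply/seteqP; split; last first.
    by move=> z [q _]; rewrite /F; case: pselect => // qU /qU.
  move=> [x y] Uxy; have /nbhs_ballP[e /= e0 He] : nbhs (x, y) U.
    exact: open_nbhs_nbhs.
  have ratb (u v : R) : u < v -> exists2 q : rat, u < ratr q & ratr q < v.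
    by move=> /rat_in_itvoo[q]; rewrite in_itv/= => /andP[uq qv]; exists q.
  have [a a1 a2] : exists2 a : rat, x - e < ratr a & ratr a < x by apply: ratb; lra.
  have [b b1 b2] : exists2 b : rat, x < ratr b & ratr b < x + e by apply: ratb; lra.
  have [a' a1' a2'] : exists2 a : rat, y - e < ratr a & ratr a < y by apply: ratb; lra.
  have [b' b1' b2'] : exists2 b : rat, y < ratr b & ratr b < y + e by apply: ratb; lra.
  exists ((a, b), (a', b')) => //; rewrite /F; case: pselect => [?|].
    by split; rewrite /= in_itv/=; apply/andP.
  case=> -[u v] [/=]; rewrite !in_itv/= => /andP[au ub] /andP[av vb].
  have hu : `|x - u| < e by rewrite ltr_norml; lra.
  have hv : `|y - v| < e by rewrite ltr_norml; lra.
  by apply: He; split.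
apply: countable_bigcupT_measurable => // q.
by rewrite /F; case: pselect => ?; [exact: measurableX|exact: measurable0].
Qed.

Lemma continuous_measurable_plane (f : R * R -> R) :
  continuous f -> measurable_fun setT f.
Proof.
move=> /continuousP cf; apply: (measurability _ (RGenOpens.measurableE R)).
move=> _ [_ [a [b ->] <-]]; rewrite setTI.
by apply: (open_measurable_plane (cf `]a, b[%classic _)); exact: interval_open.
Qed.

Lemma measurable_plane_sum : measurable_fun setT (fun z : R * R => z.1 + z.2).
Proof. exact: measurable_funD. Qed.

Definition split_pair (w : R * R) : R * R := split_state w.1 w.2.

HB.instance Definition _ :=
  isMeasurableFun.Build _ _ _ _ split_pair (@measurable_split R).

Definition splitting (m : probability R R) : probability (R * R)%type R :=
  distribution (m \x beta22)%E split_pair.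

Lemma expect_splitting m (f : R * R -> R) : bmeas f ->
  \int[splitting m]_z f z = \int[m]_s equilibrate f (s, 0).
Proof.
move=> bf; rewrite expect_distribution//.
have bfs : bmeas (fun w : R * R => f (split_state w.1 w.2)).
  exact: (bmeas_comp (@measurable_split R) bf).
rewrite -(expect_prod m beta22 bfs); apply: eq_Rintegral => s _.
by rewrite /equilibrate/= addr0.
Qed.

Lemma splitting_quadrant (m : probability R R) : m `[0, +oo[%classic = 1%E ->
  splitting m (@quadrant R) = 1%E.
Proof.
move=> m0; have mQ := @measurable_quadrant R.
have bQ : bmeas (\1_(@quadrant R) : R * R -> R) by exact: bmeas_indic.
rewrite -(expect_indic (probability_setT (splitting m)) mQ) expect_splitting//.
congr EFin; rewrite -[RHS](expect_cst (probability_setT m)).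
have mi : measurable (`[0, +oo[%classic : set R) by [].
have m01 : measurable (`[0, 1]%classic : set R) by [].
apply: (expect_eq_on (probability_setT m) mi m0).
- apply: (bmeas_comp _ (bmeas_equilibrate bQ)).
  exact: measurable_fun_pair.
- exact: bmeas_cst.
move=> s /=; rewrite in_itv/= andbT => s0.
rewrite /equilibrate -[RHS](expect_cst (probability_setT beta22)).
apply: (expect_eq_on (probability_setT beta22) m01 (@beta2201 R)).
- exact: bmeas_split.
- exact: bmeas_cst.
move=> p /=; rewrite in_itv/= => p01; rewrite indicE mem_set//=.
by apply: split_quadrant => //; rewrite addr0.
Qed.

(** Independence and uniqueness of product measures identify the joint law of [S] and [eps], which
    frees the argument from the probability space of the statement. *)
Lemma splitting_unique d (T : measurableType d) (Pr : probability T R)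
    (S eps : {RV Pr >-> R}) (mu : probability (R * R)%type R) :
  beta22_distributed Pr eps -> independent_rv Pr S eps ->
  (forall A, measurable A ->
     mu A = Pr ((fun w => split_state (S w) (eps w)) @^-1` A)) ->
  forall A, measurable A -> mu A = splitting (distribution Pr S) A.
Proof.
move=> heps hind muE A mA; rewrite muE//.
have mSe : measurable_fun setT (fun w => (S w, eps w)) by exact: measurable_fun_pair.
pose J := image_measure Pr mSe.
have mB : measurable (split_pair @^-1` A).
  by rewrite -[_ @^-1` _]setTI; exact: (@measurable_split R).
transitivity (J (split_pair @^-1` A)) => //.
transitivity ((distribution Pr S \x beta22)%E (split_pair @^-1` A)) => //.
apply: esym; apply: (product_measure_unique (m' := J)) => // B C mB' mC; rewrite /J/= /pushforward/=.
rewrite (_ : _ @^-1` _ = S @^-1` B `&` eps @^-1` C)//.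
by rewrite hind//; congr (_ * _)%E; exact: heps.
Qed.

End plane.

Section invariance.
Context (R : realType) (P : R -> R.-pker (R * R) ~> (R * R)%type).
Hypothesis P_transition : transition_function P.
Hypothesis P_generator : has_generator P (@exchange_generator R).
Notation beta22 := (@beta22 R).
Let mQ := @measurable_quadrant R.

Let PT t z : P t z setT = 1%E. Proof. exact: prob_kernel. Qed.

Lemma integral_kernel_indic (mu : probability (R * R)%type R) t A : measurable A ->
  (\int[mu]_z P t z A)%E = (\int[mu]_z semigroup P t \1_A z)%:E.
Proof.
move=> mA; rewrite -fin_integral_bmeas//; last 2 first.
- exact: probability_setT.
- exact/bmeas_semigroup/bmeas_indic.
by apply: eq_integral => z _; rewrite -(expect_indic (PT t z) mA).
Qed.

Lemma splitting_invariant (m : probability R R) (mu : probability (R * R)%type R) :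
  m `[0, +oo[%classic = 1%E ->
  (forall A, measurable A -> mu A = splitting m A) ->
  invariant_probability P mu.
Proof.
move=> m0 muE; split; first by rewrite muE// splitting_quadrant.
move=> t A t0 mA; have bA : bmeas (\1_A : R * R -> R) by exact: bmeas_indic.
rewrite integral_kernel_indic// muE//.
rewrite -(expect_indic (probability_setT (splitting m)) mA); congr EFin.
rewrite (eq_measure_expect _ muE).
rewrite !expect_splitting//; last exact: bmeas_semigroup.
have mi : measurable (`[0, +oo[%classic : set R) by [].
have mp : measurable_fun setT (fun s : R => (s, 0 : R)) by exact: measurable_fun_pair.
apply: (expect_eq_on (probability_setT m) mi m0).
- exact: (bmeas_comp mp (bmeas_equilibrate (bmeas_semigroup P t bA))).
- exact: (bmeas_comp mp (bmeas_equilibrate bA)).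
move=> s /=; rewrite in_itv/= andbT => s0.
by apply: (equilibrate_semigroup P_transition P_generator).
Qed.

(** By invariance [f] may be replaced by its image under the semigroup at time [T], which is within
    [e] of [equilibrate f] at every point of the quadrant, a set of full measure. *)
Lemma invariant_equilibrate (mu : probability (R * R)%type R) (f : R * R -> R) :
  invariant_probability P mu -> bmeas f ->
  \int[mu]_z f z = \int[mu]_z equilibrate f z.
Proof.
move=> [muQ muP] bf; have muT := probability_setT mu.
have bE := bmeas_equilibrate bf.
apply/eqP; rewrite -subr_eq0 -normr_le0.
apply/ler_addgt0Pl => e e0; rewrite addr0.
have [T T0 HT] := semigroup_cvg P_transition P_generator bf e0.
have -> : \int[mu]_z f z = \int[mu]_z semigroup P T f z.
  by apply: expect_mixture => // A mA; rewrite muP.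
rewrite -expectB//; last exact: bmeas_semigroup.
apply: (expect_norm_on muT mQ muQ); last by move=> z qz; exact: HT.
by apply: bmeasB => //; exact: bmeas_semigroup.
Qed.

(** The law at time [t] comes from the Markov property at time 0 with the sure event, the starting
    point being inserted almost surely. *)
Lemma markov_expect d (T : measurableType d) (Pr : probability T R)
    (Z : R -> {RV Pr >-> (R * R)%type}) (z : R * R) t (f : R * R -> R) :
  markov_jump_process Pr P Z -> {ae Pr, forall w, Z 0 w = z} -> 0 <= t ->
  bmeas f -> 'E_Pr[f \o Z t]%E = (semigroup P t f z)%:E.
Proof.
move=> [_ _ mZ] Z0 t0 bf; rewrite unlock.
have bfZ : bmeas (f \o Z t) by exact: bmeas_comp.
rewrite (fin_integral_bmeas (probability_setT Pr) bfZ); congr EFin.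
rewrite -(expect_distribution Pr (Z t) bf); apply: eq_measure_expect => A mA.
have filT : natural_filtration Z 0 setT.
  by move=> B [[B0 BC _] _]; have := BC set0 B0; rewrite setD0.
have := mZ 0 t setT A (lexx 0) t0 filT mA; rewrite add0r setTI => Pr_eq.
rewrite [LHS]Pr_eq.
have mk := measurable_kernel (P t) A mA.
rewrite -[RHS](integral_probability_cst Pr); apply: ge0_ae_eq_integral => //.
- exact: (measurableT_comp mk).
- by apply: filterS Z0 => w -> _.
Qed.

Lemma markov_cvg d (T : measurableType d) (Pr : probability T R)
    (Z : R -> {RV Pr >-> (R * R)%type}) (x y : R)
    d' (T' : measurableType d') (Pr' : probability T' R) (eps : {RV Pr' >-> R})
    (f : R * R -> R) : 0 <= x -> 0 <= y ->
  markov_jump_process Pr P Z -> {ae Pr, forall w, Z 0 w = (x, y)} ->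
  beta22_distributed Pr' eps -> bmeas f ->
  ('E_Pr[f \o Z t] @[t --> (+oo : set_system R)%R] -->
     'E_Pr'[fun w => f (split_state (x + y) (eps w))])%E.
Proof.
move=> x0 y0 mZ Z0 heps bf.
have -> : ('E_Pr'[fun w => f (split_state (x + y) (eps w))])%E =
    (equilibrate f (x, y))%:E.
  have bs := bmeas_split bf (x + y).
  have bse : bmeas (fun w => f (split_state (x + y) (eps w))).
    exact: (bmeas_comp _ bs).
  rewrite unlock (fin_integral_bmeas (probability_setT Pr') bse); congr EFin.
  rewrite -(expect_distribution Pr' eps bs); exact: eq_measure_expect.
have sg_cvg : semigroup P t f (x, y) @[t --> +oo] --> equilibrate f (x, y).
  apply/cvgrPdist_le => e e0.
  have [T0 _ HT] := semigroup_cvg P_transition P_generator bf e0.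
  apply: filterS (nbhs_pinfty_ge (num_real T0)) => t Tt.
  by rewrite distrC; exact: HT.
apply/fine_cvgP; split.
  apply: filterS (nbhs_pinfty_ge (num_real (0 : R))) => t t0.
  by rewrite (markov_expect mZ Z0).
apply: cvg_trans sg_cvg; apply: near_eq_cvg.
apply: filterS (nbhs_pinfty_ge (num_real (0 : R))) => t t0.
by rewrite /= (markov_expect mZ Z0).
Qed.

End invariance.

(** * M. Riesz's extension theorem and determinate moment problems *)

Section riesz_extension.
Context (R : realType) (T : Type) (D : set T).
Implicit Types (f g : T -> R) (G : set ((T -> R) * R)).

(** Partial functionals are handled as graphs, sets of pairs of a function and a value: extension is
    then inclusion, and Zorn's lemma takes unions. *)
Definition graph_linear G := forall a f c g d,
  G (f, c) -> G (g, d) -> G (fun s => a * f s + g s, a * c + d).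

(* The relation extends to a positive functional: in particular it is the graph
   of a function. *)
Definition graph_positive G := forall f c,
  G (f, c) -> (forall s, D s -> 0 <= f s) -> 0 <= c.

Definition graph_dominates G f :=
  (exists2 gc, G gc & forall s, D s -> gc.1 s <= f s) /\
  (exists2 gc, G gc & forall s, D s -> f s <= gc.1 s).

Lemma graph0 G gc : graph_linear G -> G gc -> G (fun=> 0, 0).
Proof.
case: gc => g c lG Gg; have := lG (-1) _ _ _ _ Gg Gg.
rewrite (_ : (fun s => _) = (fun=> 0)); last by apply/funext => s; ring.
by rewrite (_ : _ + c = 0) //; ring.
Qed.

Lemma graphZ G a f c : graph_linear G -> G (f, c) ->
  G (fun s => a * f s, a * c).
Proof.
move=> lG Gf; have := lG a _ _ _ _ Gf (graph0 lG Gf).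
rewrite (_ : (fun s => _) = (fun s => a * f s)); last first.
  by apply/funext => s; rewrite addr0.
by rewrite addr0.
Qed.

Lemma graph_le G f c g d : graph_linear G -> graph_positive G ->
  G (f, c) -> G (g, d) -> (forall s, D s -> f s <= g s) -> c <= d.
Proof.
move=> lG pG Gf Gg fg; have := pG _ _ (lG (-1) _ _ _ _ Gf Gg).
rewrite mulN1r addrC subr_ge0; apply => s Ds.
by rewrite mulN1r addrC subr_ge0 fg.
Qed.

Lemma graph_extend G f0 : graph_linear G -> graph_positive G ->
  graph_dominates G f0 ->
  exists G', [/\ graph_linear G', graph_positive G', G `<=` G' &
    exists c, G' (f0, c)].
Proof.
move=> lG pG [[[g1 c1] Gg1 /= g1f] [[g2 c2] Gg2 /= fg2]].
pose L := [set c | exists2 g, G (g, c) & forall s, D s -> g s <= f0 s].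
have Lub g c : G (g, c) -> (forall s, D s -> f0 s <= g s) -> ubound L c.
  move=> Gg fg d [h Gh hf]; apply: (graph_le lG pG Gh Gg) => s Ds.
  by rewrite (le_trans (hf _ Ds))// fg.
have hsL : has_sup L.
  by split; [exists c1; exists g1|exists c2; exact: (Lub g2)].
pose y := sup L.
pose G' := [set u : (T -> R) * R | exists g c t, G (g, c) /\
  u = (fun s => g s + t * f0 s, c + t * y)].
have z := graph0 lG Gg1.
exists G'; split.
- move=> a _ _ _ _ [g [c [t [Gg [-> ->]]]]] [h [d [v [Gh [-> ->]]]]].
  exists (fun s => a * g s + h s), (a * c + d), (a * t + v); split; first exact: lG.
  by congr pair; [apply/funext => s; ring|ring].
- move=> _ _ [g [c [t [Gg [-> ->]]]]] H.
  have [t0|t0|t0] := ltgtP t 0; last first.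
  + rewrite t0 mul0r addr0; apply: (pG _ _ Gg) => s Ds.
    by have := H s Ds; rewrite t0 mul0r addr0.
  + have Lc : L (- t^-1 * c).
      exists (fun s => - t^-1 * g s); first exact: graphZ.
      move=> s Ds; rewrite mulNr lerNl mulrC ler_pdivlMr//.
      by have := H s Ds; rewrite mulrC; lra.
    have := ub_le_sup hsL.2 Lc; rewrite -/y mulNr lerNl mulrC ler_pdivlMr//.
    by rewrite mulrC; lra.
  + have Gt := graphZ (- t^-1) lG Gg.
    have : y <= - t^-1 * c.
      apply: ge_sup; first by case: hsL.
      apply: (Lub _ _ Gt) => s Ds.
      rewrite mulNr lerNr mulrC ler_ndivrMr//.
      by have := H s Ds; rewrite mulrC; lra.
    by rewrite mulNr lerNr mulrC ler_ndivrMr// mulrC; lra.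
- move=> [g c] Gg; exists g, c, 0; split => //.
  by congr pair; [apply/funext => s; ring|ring].
- exists y, (fun=> 0), 0, 1; split => //.
  by congr pair; [apply/funext => s; ring|ring].
Qed.

Theorem riesz_extension G0 : G0 !=set0 -> graph_linear G0 -> graph_positive G0 ->
  exists G, [/\ graph_linear G, graph_positive G, G0 `<=` G &
    forall f, graph_dominates G0 f -> exists c, G (f, c)].
Proof.
move=> [gc0 Ggc0] lG0 pG0.
(* Stated for the union of [G0] and [A], so that it also holds for the empty union of an empty
   chain. *)
pose ok A := graph_linear (G0 `|` A) /\ graph_positive (G0 `|` A).
have [F okF totF|A [[lA pA] maxA]] := @Zorn_bigcup _ ok.
  pose V := \bigcup_(X in F) X.
  have pick u v : (G0 `|` V) u -> (G0 `|` V) v ->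
      (G0 u /\ G0 v) \/ exists2 X, F X & (G0 `|` X) u /\ (G0 `|` X) v.
    move=> [G0u|[X FX Xu]] [G0v|[Y FY Yv]]; [by left|..]; right.
    - by exists Y => //; split; [left|right].
    - by exists X => //; split; [right|left].
    - have [XY|YX] := totF X Y FX FY.
        by exists Y => //; split; right => //; exact: XY.
      by exists X => //; split; right => //; exact: YX.
  split.
    move=> a f c g d Vf Vg; have [[G0f G0g]|[X FX [Xf Xg]]] := pick _ _ Vf Vg.
      by left; exact: lG0.
    have [lX _] := okF X FX.
    by have [?|?] := lX a _ _ _ _ Xf Xg; [left|right; exists X].
  move=> f c Vf; have [[G0f _]|[X FX [Xf _]]] := pick _ _ Vf Vf.
    exact: pG0.
  by have [_ pX] := okF X FX; exact: pX.
exists (G0 `|` A); split => // f [[u Gu uf] [v Gv fv]].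
have dom : graph_dominates (G0 `|` A) f.
  by split; [exists u => //; left|exists v => //; left].
have [G' [lG' pG' AG' [c Gc]]] := graph_extend lA pA dom.
exists c; apply: contrapT => nAc.
have G0G' : G0 `|` G' = G'.
  by apply/setUidPr => w G0w; apply: AG'; left.
apply: (maxA G'); last by rewrite /ok G0G'.
split; first by move=> w Aw; apply: AG'; right.
by move/(_ _ Gc) => Ac; apply: nAc; right.
Qed.

End riesz_extension.

(** * Polynomials nonnegative on the half-line *)

Section half_line_positive.
Context (R : realType).
Implicit Types (g h a b : {poly R}).

Definition half_line_square g := exists ab : {poly R} * {poly R},
  g = ab.1 ^+ 2 + 'X * ab.2 ^+ 2.

(* Brahmagupta's identity *)
Lemma half_line_squareM g h :
  half_line_square g -> half_line_square h -> half_line_square (g * h).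
Proof.
move=> [[a b] /= ->] [[c d] /= ->].
by exists (a * c - 'X * (b * d), a * d + b * c) => /=; ring.
Qed.

Lemma half_line_squareC (c : R) : 0 <= c -> half_line_square c%:P.
Proof.
move=> c0; exists ((Num.sqrt c)%:P, 0) => /=.
by rewrite expr0n/= mulr0 addr0 -polyC_exp sqr_sqrtr.
Qed.

Lemma half_line_square_linear (r : R) : r <= 0 -> half_line_square ('X - r%:P).
Proof.
move=> r0; exists ((Num.sqrt (- r))%:P, 1) => /=.
by rewrite -polyC_exp sqr_sqrtr ?oppr_ge0// expr1n mulr1 polyCN addrC.
Qed.

(** With [r] the modulus of the complex root, the polynomial is [(X - r) ^ 2 + 2 (r - x) X], and
    [r >= x]. The case [y = 0] serves for double real roots. *)
Lemma half_line_square_quadratic (x y : R) :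
  half_line_square (('X - x%:P) ^+ 2 + (y ^+ 2)%:P).
Proof.
pose r := Num.sqrt (x ^+ 2 + y ^+ 2).
have r2 : r ^+ 2 = x ^+ 2 + y ^+ 2 by rewrite sqr_sqrtr// addr_ge0// sqr_ge0.
have rx : x <= r.
  have r0 : 0 <= r by exact: sqrtr_ge0.
  have y2 := sqr_ge0 y; rewrite leNgt; apply/negP => xr; rewrite !expr2 in r2 y2; nra.
exists ('X - r%:P, (Num.sqrt (2 * r - 2 * x))%:P) => /=.
rewrite -polyC_exp sqr_sqrtr; last by lra.
rewrite polyCB (polyCM 2 r) (polyCM 2 x).
have -> : (y ^+ 2)%:P = r%:P ^+ 2 - x%:P ^+ 2 :> {poly R}.
  by rewrite -!polyC_exp -polyCB r2; congr polyC; ring.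
rewrite (_ : 2%:P = 2 :> {poly R})//; ring.
Qed.

(** Otherwise [h] keeps its sign near [r] while [X - r] changes sign, so [g] would be negative on
    one side of [r]. *)
Lemma double_root g h (r : R) : 0 < r -> g = h * ('X - r%:P) ->
  (forall s, 0 < s -> 0 <= g.[s]) -> h.[r] = 0.
Proof.
move=> r0 gE g0; apply/eqP; apply: contrapT => /negP hr.
have gs s : g.[s] = h.[s] * (s - r) by rewrite gE hornerM hornerXsubC.
have hc : h.[x] @[x --> r] --> h.[r] by exact: continuous_horner.
have e0 : 0 < `|h.[r]| by rewrite normr_gt0.
have /cvgrPdist_lt/(_ _ e0) := hc.
move=> /nbhs_ballP[d /= d0 Hd].
(* Small enough to stay where [h] keeps its sign, and at most [r / 2] so that [r - e] is still
   positive. *)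
pose e := Num.min (d / 2) (r / 2).
have ep : 0 < e by rewrite lt_min !divr_gt0.
have ed : e < d by rewrite gt_min; apply/orP; left; lra.
have er : e < r by rewrite gt_min; apply/orP; right; lra.
have H1 := Hd (r + e); have H2 := Hd (r - e).
have {}H1 : `|h.[r] - h.[r + e]| < `|h.[r]|.
  by apply: H1; rewrite /ball/= opprD addNKr normrN gtr0_norm.
have {}H2 : `|h.[r] - h.[r - e]| < `|h.[r]|.
  by apply: H2; rewrite /ball/= opprB addrC subrK gtr0_norm.
have G1 : 0 <= h.[r + e].
  have := g0 (r + e) ltac:(lra); rewrite gs.
  by rewrite (_ : r + e - r = e) ?pmulr_lge0//; ring.
have G2 : h.[r - e] <= 0.
  have := g0 (r - e) ltac:(lra); rewrite gs.
  by rewrite (_ : r - e - r = - e) ?mulrN ?oppr_ge0 ?pmulr_lle0//; ring.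
move: H1 H2; rewrite !ltr_norml; have [hp|hn] := leP 0 h.[r].
- by rewrite ger0_norm// => /andP[? ?] /andP[? ?]; lra.
- by rewrite ltr0_norm// => /andP[? ?] /andP[? ?]; lra.
Qed.

(** A complex root exists and is not real. Division by the real quadratic that vanishes there leaves
    a remainder of degree at most 1 with a nonreal root, hence 0. *)
Lemma nonreal_factor g : (1 < size g)%N -> (forall r, ~~ root g r) ->
  exists (x y : R) (h : {poly R}), y != 0 /\ g = h * (('X - x%:P) ^+ 2 + (y ^+ 2)%:P).
Proof.
move=> g1 noroot; pose C := real_complex R.
have /closed_rootP[[x y] /eqP gz] : size (map_poly C g) != 1.
  by rewrite size_map_poly; apply: contraTneq g1 => ->.
have y0 : y != 0.
  apply: contraTneq (noroot x) => y0; rewrite negbK.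
  move: gz; rewrite y0 -/(C x) horner_map => /(congr1 (@complex.Re R))/= gx.
  exact/eqP.
pose q : {poly R} := ('X - x%:P) ^+ 2 + (y ^+ 2)%:P.
have sq : size q = 3%N.
  rewrite /q size_polyDl; first by rewrite size_exp_XsubC.
  by rewrite size_exp_XsubC (leq_ltn_trans (size_polyC_leq1 _)).
have qz : (map_poly C q).[complex.Complex x y] = 0.
  rewrite /q rmorphD rmorphXn rmorphB /= map_polyX !map_polyC /=.
  rewrite hornerD horner_exp hornerXsubC hornerC.
  apply/eqP; rewrite eq_complex /=; apply/andP; split; apply/eqP => /=; ring.
exists x, y, (g %/ q); split => //; rewrite -/q.
suff rem0 : g %% q = 0 by rewrite [LHS](divp_eq g q) rem0 addr0.
have rz : (map_poly C (g %% q)).[complex.Complex x y] = 0.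
  move: gz; rewrite {1}(divp_eq g q) rmorphD rmorphM hornerD hornerM qz mulr0 add0r.
  by [].
have sr : (size (g %% q)%R <= 2)%N.
  by rewrite -ltnS -sq ltn_modpN0// -size_poly_gt0 sq.
have rE : g %% q = (g %% q)`_1 *: 'X + ((g %% q)`_0)%:P.
  apply/polyP => i; rewrite coefD coefZ coefX coefC.
  case: i => [|[|i]]; rewrite /= ?mulr0 ?add0r ?mulr1 ?addr0//.
  by rewrite nth_default// (leq_trans sr).
move: rz; rewrite rE rmorphD /= map_polyZ map_polyX map_polyC /=.
rewrite hornerD hornerZ hornerX hornerC.
set c1 := (g %% q)`_1; set c0 := (g %% q)`_0.
move=> /eqP; rewrite eq_complex /= => /andP[/eqP re /eqP im].
have c10 : c1 = 0.
  have : c1 * y = 0 by move: im => /=; lra.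
  by move/eqP; rewrite mulf_eq0 (negbTE y0) orbF => /eqP.
by move: re; rewrite c10 => re; rewrite scale0r add0r; congr polyC; move: re => /=; lra.
Qed.

(** Strong induction on the size, dividing out a factor that is nonnegative on the half-line and of
    the required form: [X - r] for a root [r <= 0], [(X - r) ^ 2] for a root [r > 0], which must be
    double, and a quadratic for a pair of conjugate roots. *)
Theorem half_line_positive_square g : (forall s, 0 < s -> 0 <= g.[s]) ->
  half_line_square g.
Proof.
elim: {g}_.+1 {-2}g (ltnSn (size g)) => // n IH g; rewrite ltnS => gn g0.
have [g1|g1] := leqP (size g) 1.
  rewrite (size1_polyC g1); apply: half_line_squareC.
  by have := g0 1 ltr01; rewrite {1}(size1_polyC g1) hornerC.
have gN0 : g != 0 by rewrite -size_poly_gt0 (leq_trans _ g1).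
have [[r rg]|noroot] := pselect (exists r, root g r).
  have /factor_theorem[h gE] := rg.
  have hN0 : h != 0 by apply: contraNneq gN0 => h0; rewrite gE h0 mul0r.
  have gs s : g.[s] = h.[s] * (s - r) by rewrite gE hornerM hornerXsubC.
  have sh : (size g = (size h).+1)%N by rewrite gE size_Mmonic ?monicXsubC// size_XsubC addn2.
  have [r0|r0] := leP r 0.
    rewrite gE; apply: half_line_squareM; last exact: half_line_square_linear.
    apply: IH; first by rewrite -sh in gn *.
    by move=> s s0; have := g0 s s0; rewrite gs pmulr_lge0// subr_gt0 (le_lt_trans r0).
  have hr : h.[r] = 0 by exact: (double_root r0 gE g0).
  have /factor_theorem[k kE] : root h r by exact/eqP.
  have kN0 : k != 0 by apply: contraNneq hN0 => k0; rewrite kE k0 mul0r.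
  have sk : (size h = (size k).+1)%N by rewrite kE size_Mmonic ?monicXsubC// size_XsubC addn2.
  have gE2 : g = k * (('X - r%:P) ^+ 2 + (0 ^+ 2)%:P).
    by rewrite gE kE expr0n/= addr0 -mulrA expr2.
  rewrite gE2; apply: half_line_squareM; last exact: half_line_square_quadratic.
  apply: IH; first by rewrite sh sk in gn; exact: ltnW.
  (* At [s = r] the sign of [g] says nothing about the quotient [k]; there continuity is used. *)
  move=> s s0; have [->|sr] := eqVneq s r; last first.
    have := g0 s s0; rewrite gE2 hornerM; rewrite !hornerE /= expr0n/= addr0.
    by rewrite pmulr_lge0// exprn_even_gt0//= subr_eq0.
  have : k.[x] @[x --> r] --> k.[r] by exact: continuous_horner.
  move=> /cvgrPdist_lt kc; rewrite leNgt; apply/negP => kr.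
  have e0 : 0 < - k.[r] by rewrite oppr_gt0.
  have /nbhs_ballP[d /= d0 Hd] := kc _ e0.
  have := Hd (r + d / 2); rewrite /ball/= opprD addNKr normrN gtr0_norm ?divr_gt0//.
  move=> /(_ ltac:(lra)); rewrite ltr_norml => /andP[h1 h2].
  have := g0 (r + d / 2) ltac:(lra); rewrite gE2 hornerM !hornerE /= expr0n/= addr0.
  rewrite pmulr_lge0; first by lra.
  by rewrite exprn_even_gt0//= addrAC subrr add0r gt_eqF// divr_gt0.
have [|x [y [h [y0 gE]]]] := nonreal_factor g1.
  by move=> r; apply/negP => rr; apply: noroot; exists r.
have hN0 : h != 0 by apply: contraNneq gN0 => h0; rewrite gE h0 mul0r.
rewrite gE; apply: half_line_squareM; last exact: half_line_square_quadratic.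
have q0 s : 0 < (('X - x%:P) ^+ 2 + (y ^+ 2)%:P).[s].
  by rewrite !hornerE /= ltr_wpDl ?sqr_ge0// exprn_even_gt0.
apply: IH; last by move=> s s0; have := g0 s s0; rewrite gE hornerM pmulr_lge0.
have sq : size (('X - x%:P) ^+ 2 + (y ^+ 2)%:P) = 3%N.
  rewrite size_polyDl; first by rewrite size_exp_XsubC.
  by rewrite size_exp_XsubC (leq_ltn_trans (size_polyC_leq1 _)).
rewrite gE size_mul// ?sq in gn; last by rewrite -size_poly_gt0 sq.
by rewrite addn3 /= in gn; exact: ltnW.
Qed.

End half_line_positive.

(** * Representing measure of a positive functional on the half-line *)

Section functional_measure.
Context (R : realType).
Implicit Types (f g psi zeta : R -> R) (q : {poly R}).
Let D : set R := [set s | 0 <= s].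
Variable G : set ((R -> R) * R).
Hypotheses (lG : graph_linear G) (pG : graph_positive D G).

Definition poly_bounded f := exists q, forall s, 0 <= s -> `|f s| <= q.[s].

Hypothesis Gtotal : forall f, poly_bounded f -> exists c, G (f, c).
Hypothesis G1 : G (fun=> 1, 1).

Definition functional f : R := xget 0 [set c | G (f, c)].

Let functional_graph f c : G (f, c) -> G (f, functional f).
Proof.
move=> Gc; suff : [set c | G (f, c)] (functional f) by [].
by apply: xgetPex; exists c.
Qed.

Lemma functionalP f : poly_bounded f -> G (f, functional f).
Proof. by move=> /Gtotal[c]; exact: functional_graph. Qed.

Lemma functional_le f g c d : G (f, c) -> G (g, d) ->
  (forall s, 0 <= s -> f s <= g s) -> c <= d.
Proof. exact: (graph_le lG pG). Qed.

Definition above (x s : R) : R := (x < s)%R%:R.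

Let tail x : R := functional (above x).

Lemma above01 x s : 0 <= above x s <= 1.
Proof. by rewrite /above; case: (x < s); rewrite /= ?lexx ?ler01. Qed.

Lemma tailP x : G (above x, tail x).
Proof.
apply: functionalP; exists 1 => s _; rewrite hornerC.
by have /andP[a0 a1] := above01 x s; rewrite ger0_norm.
Qed.

Let tail01 x : 0 <= tail x <= 1.
Proof.
apply/andP; split.
  by apply: (pG (tailP x)) => s _; case/andP: (above01 x s).
by apply: (functional_le (tailP x) G1) => s _; case/andP: (above01 x s).
Qed.

Let tail_nincr x y : x <= y -> tail y <= tail x.
Proof.
move=> xy; apply: (functional_le (tailP y) (tailP x)) => s _.
rewrite /above; have [ys|] := ltP y s; last by case: (x < s) => //=; rewrite ler01.
by rewrite (le_lt_trans xy ys).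
Qed.

(** Markov's inequality for [G]; it bounds the quantile at each [u > 0]. *)
Let tail_lin : exists m1, 0 <= m1 /\ forall x, 0 < x -> tail x <= m1 / x.
Proof.
have [|m1 Gm] := @Gtotal id.
  by exists 'X => s s0; rewrite hornerX ger0_norm.
exists m1; split; first by apply: (pG Gm).
move=> x x0; rewrite mulrC.
apply: (functional_le (tailP x) (graphZ x^-1 lG Gm)) => s s0.
rewrite /above; have [xs|] := ltP x s; last by rewrite mulr_ge0// invr_ge0 ltW.
by rewrite /= mulrC ler_pdivlMr// mul1r ltW.
Qed.

(** The point 0 is included by hand, so that the set is nonempty even where [u] exceeds all
    tails. *)
Let qset u : set R := [set x | 0 <= x /\ (x = 0 \/ u < tail x)].

(* The law of [quantile] under [unif] is the representing measure: up to atoms,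
   its tail is [tail]. *)
Definition quantile u : R := if 0 < u then sup (qset u) else 0.

Let qset_has_sup u : 0 < u -> has_sup (qset u).
Proof.
move=> u0; split; first by exists 0; split; [|left].
have [m1 [m10 Hm]] := tail_lin; exists (m1 / u) => x [x0 [->|ux]].
  by rewrite divr_ge0// ltW.
have [x_eq|x_neq] := eqVneq x 0; first by rewrite x_eq divr_ge0// ltW.
have x_gt0 : 0 < x by rewrite lt0r x_neq.
have := Hm x x_gt0; rewrite ler_pdivlMr// => h.
rewrite ler_pdivlMr// mulrC (le_trans _ h)// ler_wpM2r//.
exact: ltW.
Qed.

Lemma quantile_ge0 u : 0 <= quantile u.
Proof.
rewrite /quantile; case: ifP => // u0; apply: ub_le_sup.
  by case: (qset_has_sup u0).
by split; [|left].
Qed.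

(** With [quantile_ge], this makes [quantile] and [tail] inverse to one another, but only up to
    strictness of the inequalities: [G] is finitely additive, so [tail] need not be
    right-continuous. The mesh [h] of the step functions absorbs the gap. *)
Let quantile_gt u x : 0 <= x -> x < quantile u -> 0 < u /\ u < tail x.
Proof.
move=> x0; rewrite /quantile; case: ifP => [u0 xq|_ /(le_lt_trans x0)]; last by rewrite ltxx.
split=> //; have e0 : 0 < sup (qset u) - x by rewrite subr_gt0.
have [y [y0 [->|uy]]] := sup_adherent e0 (qset_has_sup u0); rewrite subKr => xy.
  by have := le_lt_trans x0 xy; rewrite ltxx.
by rewrite (lt_le_trans uy)// tail_nincr// ltW.
Qed.

Let quantile_ge u x : 0 <= x -> 0 < u -> u < tail x -> x <= quantile u.
Proof.
move=> x0 u0 ut; rewrite /quantile u0; apply: ub_le_sup.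
  by case: (qset_has_sup u0).
by split => //; right.
Qed.

(** The quantile is nonincreasing in [u > 0] and 0 elsewhere, so each set where it exceeds [x] is an
    interval. *)
Lemma measurable_quantile : measurable_fun setT quantile.
Proof.
apply: (measurability _ (RGenOInfty.measurableE R)) => _ [_ [x ->] <-].
rewrite setTI; apply: is_interval_measurable => u1 u2 /=.
rewrite !in_itv/= !andbT => h1 h2 u /andP[u1u uu2].
rewrite in_itv/= andbT; have [x0|x0] := leP 0 x; last first.
  exact: lt_le_trans (quantile_ge0 u).
have [u10 _] := quantile_gt x0 h1; have [u20 _] := quantile_gt x0 h2.
have u0 := lt_le_trans u10 u1u.
apply: (lt_le_trans h2); rewrite /quantile u0 u20.
apply: ge_sup; first by case: (qset_has_sup u20).
move=> y [y0 yt]; apply: ub_le_sup; first by case: (qset_has_sup u0).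
by split => //; case: yt => [->|ut]; [left|right; exact: le_lt_trans ut].
Qed.

HB.instance Definition _ :=
  isMeasurableFun.Build _ _ _ _ quantile measurable_quantile.

Notation unif := (@unif R).
Let unifT : unif setT = 1%E. Proof. exact: probability_setT. Qed.
Let m01 : measurable (`[0, 1]%classic : set R). Proof. by []. Qed.

Let bmeas_bool (p : R -> bool) : measurable_fun setT p ->
  bmeas (fun u => (p u)%:R : R).
Proof.
move=> mp; split; last first.
  by exists 1 => u; case: (p u); rewrite /= ?normr1 ?normr0 ?ler01.
rewrite (_ : (fun u => _) = (fun u => if p u then 1 else 0)).
  exact: measurable_fun_ifT.
by apply/funext => u; case: (p u).
Qed.

Let expect_below c : 0 <= c <= 1 ->
  \int[unif]_u ((0 < u < c)%R%:R : R) = c.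
Proof.
move=> /andP[c0 c1]; have mI : measurable (`]0, c[%classic : set R) by [].
have -> : (fun u => (0 < u < c)%R%:R : R) = \1_(`]0, c[%classic).
  by apply/funext => u; rewrite indicE mem_setE in_itv.
apply: EFin_inj; rewrite (expect_indic unifT mI).
transitivity (\int[unif]_u (\1_(`]0%R, c[%classic) u)%:E)%E.
  by rewrite integral_indic// setIT.
rewrite ge0_integral_unif//; last first.
  by apply/measurable_EFinP; exact: measurable_indic.
have lebc : lebesgue_measure (`]0%R, c[%classic : set R) = c%:E.
  rewrite lebesgue_measure_itv/= lte_fin; case: ifPn; first by rewrite oppr0 adde0.
  by rewrite -leNgt => h; congr EFin; apply/eqP; rewrite eq_le c0.
rewrite integral_indic// -lebc; congr lebesgue_measure.
apply/setIidPl => u /=; rewrite !in_itv/= => /andP[u0 uc].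
by rewrite (ltW u0) (le_trans (ltW uc)).
Qed.

Let mQ := measurable_quantile.

Let bmeas_gtQ x : bmeas (fun u => (x < quantile u)%R%:R : R).
Proof. by apply: bmeas_bool; exact: measurable_fun_ltr. Qed.

Let bmeas_geQ x : bmeas (fun u => (x <= quantile u)%R%:R : R).
Proof. by apply: bmeas_bool; exact: measurable_fun_ler. Qed.

Let bmeas_below (c : R) : bmeas (fun u : R => (0 < u < c)%R%:R : R).
Proof. by apply: bmeas_bool; apply: measurable_and; exact: measurable_fun_ltr. Qed.

Let expect_gtQ x : 0 <= x -> \int[unif]_u ((x < quantile u)%R%:R : R) <= tail x.
Proof.
move=> x0; rewrite -(expect_below (tail01 x)).
apply: (expect_le_on unifT m01 (@unif01 R)) => // u _.
have [xq|_] := ltP x (quantile u); last by rewrite ler0n.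
by have [u0 ut] := quantile_gt x0 xq; rewrite u0 ut.
Qed.

Let expect_geQ x : 0 <= x -> tail x <= \int[unif]_u ((x <= quantile u)%R%:R : R).
Proof.
move=> x0; rewrite -[leLHS](expect_below (tail01 x)).
apply: (expect_le_on unifT m01 (@unif01 R)) => // u _.
have [/andP[u0 ut]|_] := boolP (_ && _); last by rewrite ler0n.
by rewrite (quantile_ge x0 u0 ut).
Qed.

Section steps.
Variables (psi : R -> R) (h : R).
Hypotheses (psi_nd : {homo psi : x y / x <= y}) (h0 : 0 < h).

Let h0' : 0 <= h. Proof. exact: ltW. Qed.

Let incr k := psi (k.+1%:R * h) - psi (k%:R * h).

Let incr_ge0 k : 0 <= incr k.
Proof. by rewrite subr_ge0 psi_nd// ler_pM2r// ler_nat. Qed.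

(** Telescoping: the increments over the mesh cells whose left end is below [t] add up to the value
    of [psi] at the right end of the last one. *)
Lemma step_above K t : 0 <= t ->
  psi (Num.min t (K%:R * h)) - psi 0 <= \sum_(k < K) incr k * (k%:R * h < t)%R%:R.
Proof.
move=> t0; elim: K => [|K IH].
  by rewrite mul0r big_ord0 min_r// subrr.
rewrite big_ord_recr/=; have [Kt|tK] := ltP (K%:R * h) t.
  rewrite mulr1 /incr; move: IH; rewrite (min_r (ltW Kt)) => IH.
  have : psi (Num.min t (K.+1%:R * h)) <= psi (K.+1%:R * h).
    by apply: psi_nd; rewrite ge_min lexx orbT.
  lra.
rewrite mulr0 addr0 (le_trans _ IH)// lerD2r psi_nd// min_l.
  by rewrite min_l.
by rewrite (le_trans tK)// ler_pM2r// ler_nat.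
Qed.

Lemma step_below K t : 0 <= t ->
  \sum_(k < K) incr k * (k.+1%:R * h <= t)%R%:R <= psi (Num.min t (K%:R * h)) - psi 0.
Proof.
move=> t0; elim: K => [|K IH].
  by rewrite mul0r big_ord0 min_r// subrr.
rewrite big_ord_recr/=; have KK : K%:R * h <= K.+1%:R * h by rewrite ler_pM2r// ler_nat.
have [Kt|tK] := leP (K.+1%:R * h) t.
  rewrite mulr1 /incr; move: IH; rewrite (min_r (le_trans KK Kt)) => IH.
  by lra.
by rewrite mulr0 addr0 (le_trans IH)// lerD2r psi_nd// ge_min lexx.
Qed.

Lemma graph_sum K (a : nat -> R) (x : nat -> R) :
  G (fun s => \sum_(k < K) a k * above (x k) s, \sum_(k < K) a k * tail (x k)).
Proof.
elim: K => [|K IH].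
  rewrite big_ord0 (_ : (fun s => _) = (fun=> 0)); first exact: (graph0 lG G1).
  by apply/funext => s; rewrite big_ord0.
have := lG (a K) (tailP (x K)) IH.
rewrite big_ord_recr/= addrC (_ : (fun s => _ + _) =
  (fun s => \sum_(k < K.+1) a k * above (x k) s))//.
by apply/funext => s; rewrite big_ord_recr/= addrC.
Qed.

Let bmeas_sum K (a : nat -> R) (f : nat -> R -> R) : (forall k, bmeas (f k)) ->
  bmeas (fun u => \sum_(k < K) a k * f k u) /\
  \int[unif]_u (\sum_(k < K) a k * f k u) = \sum_(k < K) a k * \int[unif]_u f k u.
Proof.
move=> bf; elim: K => [|K [IHb IHe]].
  rewrite big_ord0; under eq_fun do rewrite big_ord0.
  by split; [exact: bmeas_cst|exact: expect_cst].
rewrite big_ord_recr/=; under eq_fun do rewrite big_ord_recr/=.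
split; first by apply: bmeasD => //; exact: bmeasZ.
by rewrite expectD//; [rewrite IHe expectZ|exact: bmeasZ].
Qed.

(** The step function with jumps at the right ends of the cells lies below [psi], so its [G]-value
    is at most [c]; reading the jumps on the quantile gives [v]. It lags by one cell, hence still
    dominates [psi] at [quantile u - h]. *)
Lemma functional_lower K c : G (psi, c) -> 
  exists v : R -> R, [/\ bmeas v, \int[unif]_u v u <= c,
    forall u, psi 0 <= v u & forall u, quantile u <= K.+1%:R * h ->
    psi (Num.max 0 (quantile u - h)) <= v u].
Proof.
move=> Gc.
have [bv ev] := bmeas_sum K incr (fun k => bmeas_gtQ (k.+1%:R * h)).
exists (fun u => psi 0 + \sum_(k < K) incr k * (k.+1%:R * h < quantile u)%R%:R).
split; first by apply: bmeasD => //; exact: bmeas_cst.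
- rewrite expectD//; last exact: bmeas_cst.
  rewrite (expect_cst unifT) ev.
  apply: (@le_trans _ _ (psi 0 * 1 + \sum_(k < K) incr k * tail (k.+1%:R * h))).
    rewrite mulr1 lerD2l; apply: ler_sum => k _.
    by rewrite ler_wpM2l// expect_gtQ// mulr_ge0.
  apply: (functional_le (lG (psi 0) G1 (graph_sum K incr (fun k => k.+1%:R * h))) Gc).
  move=> s s0; have := step_below K s0.
  have : psi (Num.min s (K%:R * h)) <= psi s by apply: psi_nd; rewrite ge_min lexx.
  have : \sum_(k < K) incr k * above (k.+1%:R * h) s <=
         \sum_(k < K) incr k * (k.+1%:R * h <= s)%R%:R.
    apply: ler_sum => k _; rewrite ler_wpM2l// /above.
    by have [/ltW ->|_] := ltP _ s; rewrite ?ler0n.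
  lra.
- by move=> u; rewrite lerDl sumr_ge0// => k _; rewrite mulr_ge0.
- move=> u qK; set t := Num.max 0 (quantile u - h).
  have t0 : 0 <= t by rewrite le_max lexx.
  have tK : t <= K%:R * h.
    rewrite ge_max mulr_ge0//= lerBlDr -[leRHS]addr0.
    by move: qK; rewrite -natr1 mulrDl mul1r addr0.
  have := step_above K t0; rewrite min_l// lerBlDl => /le_trans; apply.
  rewrite lerD2l; apply: ler_sum => k _; rewrite ler_wpM2l//.
  have [kt|_] := ltP (k%:R * h) t; last by rewrite ler0n.
  have kq : k%:R * h < quantile u - h.
    move: kt; rewrite lt_max => /orP[|//].
    by rewrite ltNge mulr_ge0.
  by rewrite -natr1 mulrDl mul1r -ltrBrDr kq.
Qed.

(** Here the jumps are at the left ends of the cells, and the step function lies above [psi] up to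
    [K h]. Beyond that point [psi s <= chi s / (K h)], which accounts for the term in [c']. *)
Lemma functional_upper K c chi c' : G (psi, c) -> G (chi, c') ->
  (forall s, 0 <= s -> 0 <= psi s) ->
  (forall s, 0 <= s -> s * psi s <= chi s) -> (0 < K)%N ->
  exists v : R -> R, [/\ bmeas v, c <= \int[unif]_u v u + c' / (K%:R * h) & 
    forall u, v u <= psi (quantile u + h)].
Proof.
move=> Gc Gchi psi0 psichi K0.
have Kh : 0 < K%:R * h by rewrite mulr_gt0// ltr0n.
have [bv ev] := bmeas_sum K incr (fun k => bmeas_geQ (k%:R * h)).
exists (fun u => psi 0 + \sum_(k < K) incr k * (k%:R * h <= quantile u)%R%:R).
split; first by apply: bmeasD => //; exact: bmeas_cst.
- rewrite expectD//; last exact: bmeas_cst.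
  rewrite (expect_cst unifT) ev.
  apply: (@le_trans _ _ ((K%:R * h)^-1 * c' +
    (psi 0 * 1 + \sum_(k < K) incr k * tail (k%:R * h)))).
    apply: (functional_le Gc (lG (K%:R * h)^-1 Gchi
      (lG (psi 0) G1 (graph_sum K incr (fun k => k%:R * h))))).
    move=> s s0; rewrite mulr1.
    have := step_above K s0; have [sK|Ks] := leP s (K%:R * h).
      have : 0 <= (K%:R * h)^-1 * chi s.
        rewrite mulr_ge0 ?invr_ge0//; first exact: ltW.
        by rewrite (le_trans _ (psichi s s0))// mulr_ge0// psi0.
      by rewrite /above; lra.
    move=> _; have : psi s <= (K%:R * h)^-1 * chi s.
      rewrite mulrC ler_pdivlMr// mulrC (le_trans _ (psichi s s0))//.
      by rewrite ler_wpM2r ?psi0// ltW.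
    have : 0 <= \sum_(k < K) incr k * above (k%:R * h) s.
      by apply: sumr_ge0 => k _; rewrite mulr_ge0//; case/andP: (above01 (k%:R * h) s).
    have := psi0 0 (lexx 0); lra.
  rewrite mulr1 addrC mulrC lerD2r lerD2l; apply: ler_sum => k _.
  by rewrite ler_wpM2l// expect_geQ// mulr_ge0.
- move=> u; set t := quantile u + h.
  have t0 : 0 <= t by rewrite addr_ge0 ?quantile_ge0.
  have : psi (Num.min t (K%:R * h)) <= psi t by apply: psi_nd; rewrite ge_min lexx.
  have := step_below K t0.
  have -> : \sum_(k < K) incr k * (k.+1%:R * h <= t)%R%:R =
    \sum_(k < K) incr k * (k%:R * h <= quantile u)%R%:R.
    apply: eq_bigr => k _; congr (_ * _%:R); congr nat_of_bool.
    by rewrite -[k.+1%:R]natr1 mulrDl mul1r lerD2r.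
  lra.
Qed.

End steps.

(** Undoes the shift by one cell left by the step functions, at a cost of first order in [h], while
    [zeta] may grow with [s]. *)
Definition modulus psi zeta := forall h s, 0 < h -> h <= 1 -> 0 <= s ->
  psi (s + h) <= psi s + h * zeta s.

Definition ge0_monotone psi := (forall s, 0 <= psi s) /\ {homo psi : x y / x <= y}.

Let measurable_psiQ psi : {homo psi : x y / x <= y} ->
  measurable_fun setT (fun u => psi (quantile u)).
Proof.
by move=> hpsi; apply: (measurableT_comp (nondecreasing_measurable _ hpsi)).
Qed.

Lemma quantile_truncated_le psi zeta c M : ge0_monotone psi -> ge0_monotone zeta ->
  modulus psi zeta -> G (psi, c) -> 0 < M ->
  \int[unif]_u (psi (quantile u) * (quantile u <= M)%R%:R) <= c.
Proof.
move=> [psi0 hpsi] [zeta0 hzeta] pz Gc M0; apply/ler_addgt0Pl => e e0.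
have z1 : 0 < zeta M + 1 by rewrite ltr_wpDl.
(* The mesh is a fraction of [M], at most 1 as [modulus] asks, and so small that undoing a shift by
   [h] below the level [M] costs at most [e]. *)
have d0 : 0 < Num.min 1 (e / (zeta M + 1)) by rewrite lt_min ltr01 divr_gt0.
have [n [n0 hd]] := small_fraction (ltW M0) d0.
set h := M / n%:R in hd; have h0 : 0 < h by rewrite divr_gt0// ltr0n.
have h1 : h <= 1 by move: hd; rewrite lt_min => /andP[/ltW].
have hz : h * zeta M <= e.
  have : h * (zeta M + 1) < e by move: hd; rewrite lt_min ltr_pdivlMr// => /andP[].
  by rewrite mulrDr mulr1; lra.
have nh : n%:R * h = M by rewrite mulrC divfK// pnatr_eq0 -lt0n.
have [v [bv vc v0 vq]] := functional_lower hpsi h0 n Gc.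
have bpsi : bmeas (fun u => psi (quantile u) * (quantile u <= M)%R%:R).
  split.
    apply: measurable_funM; first exact: measurable_psiQ.
    by apply: (bmeas_bool _).1; exact: measurable_fun_ler.
  exists (psi M) => u; have [qM|_] := leP (quantile u) M; last by rewrite mulr0 normr0.
  by rewrite mulr1 ger0_norm// hpsi.
apply: (@le_trans _ _ (\int[unif]_u (h * zeta M + v u))); last first.
  rewrite expectD//; last exact: bmeas_cst.
  by rewrite (expect_cst unifT) lerD.
apply: (expect_le_on unifT m01 (@unif01 R)) => //.
  by apply: bmeasD => //; exact: bmeas_cst.
move=> u _; have hz0 : 0 <= h * zeta M by rewrite mulr_ge0// ltW.
have [qM|_] := leP (quantile u) M; last first.
  by rewrite mulr0 addr_ge0// (le_trans (psi0 0)).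
rewrite mulr1; have q0 := quantile_ge0 u.
have qn : quantile u <= n.+1%:R * h by rewrite -natr1 mulrDl mul1r nh; lra.
rewrite addrC; apply: (le_trans _ (lerD (vq u qn) (lexx _))).
have [qh|hq] := leP (quantile u) h.
  rewrite max_l; last by rewrite subr_le0.
  apply: (@le_trans _ _ (psi (0 + h))); first by rewrite add0r hpsi.
  apply: (le_trans (pz h 0 h0 h1 (lexx 0))); rewrite lerD2l ler_wpM2l ?(ltW h0)//.
  by rewrite hzeta// ltW.
rewrite max_r; last by rewrite subr_ge0 ltW.
have qh0 : 0 <= quantile u - h by rewrite subr_ge0 ltW.
have := pz h (quantile u - h) h0 h1 qh0; rewrite subrK => /le_trans; apply.
by rewrite lerD2l ler_wpM2l ?(ltW h0)// hzeta//; lra.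
Qed.

(** Integrability is part of the conclusion: it comes from the bound [c], by monotone convergence in
    the truncation level. *)
Lemma quantile_expect_le psi zeta c : ge0_monotone psi -> ge0_monotone zeta ->
  modulus psi zeta -> G (psi, c) ->
  unif.-integrable setT (fun u => (psi (quantile u))%:E) /\
  \int[unif]_u psi (quantile u) <= c.
Proof.
move=> mpsi mzeta pz Gc; have [psi0 hpsi] := mpsi.
have mP := measurable_psiQ hpsi.
suff H : (\int[unif]_u (psi (quantile u))%:E <= c%:E)%E.
  have fP : unif.-integrable setT (fun u => (psi (quantile u))%:E).
    apply/integrableP; split; first exact/measurable_EFinP.
    under eq_integral do rewrite gee0_abs ?lee_fin//.
    by rewrite (le_lt_trans H)// ltry.
  by split => //; rewrite -lee_fin fineK//; exact: integrable_fin_num.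
pose t n u := psi (quantile u) * (quantile u <= n%:R)%R%:R.
have mt n : measurable_fun setT (t n).
  apply: measurable_funM => //.
  by apply: (bmeas_bool _).1; exact: measurable_fun_ler.
have t0 n u : 0 <= t n u by rewrite mulr_ge0.
have -> : (\int[unif]_u (psi (quantile u))%:E)%E =
    limn (fun n => \int[unif]_u (t n u)%:E)%E.
  rewrite -monotone_convergence//.
  - apply: eq_integral => u _; apply/esym/cvg_lim => //.
    have [n qn] : exists n : nat, quantile u <= n%:R.
      exists (Num.truncn (quantile u)).+1; exact/ltW/truncnS_gt.
    apply: cvg_near_cst; exists n => // m /= nm.
    rewrite /t (_ : quantile u <= m%:R) ?mulr1//.
    by rewrite (le_trans qn)// ler_nat.
  - by move=> n; exact/measurable_EFinP.
  - by move=> n u _; rewrite lee_fin.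
  - move=> u _ n m nm; rewrite lee_fin /t ler_wpM2l//.
    have [qn|_] := leP (quantile u) n%:R; last by rewrite ler0n.
    by rewrite (le_trans qn)// ler_nat.
apply: lime_le.
  apply: ereal_nondecreasing_is_cvgn => n m nm; apply: ge0_le_integral => //.
  - by move=> u _; rewrite lee_fin.
  - exact/measurable_EFinP.
  - exact/measurable_EFinP.
  - move=> u _; rewrite lee_fin /t ler_wpM2l//.
    have [qn|_] := leP (quantile u) n%:R; last by rewrite ler0n.
    by rewrite (le_trans qn)// ler_nat.
apply: nearW => n.
(* The index is raised by one because [quantile_truncated_le] asks for a positive truncation
   level. *)
have bt : bmeas (t n.+1).
  split => //; exists (psi n.+1%:R) => u; rewrite ger0_norm// /t.
  by have [qn|_] := leP (quantile u) n.+1%:R; rewrite ?mulr1 ?mulr0// hpsi.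
apply: (@le_trans _ _ (\int[unif]_u (t n.+1 u)%:E)%E).
  apply: ge0_le_integral => //.
  - by move=> u _; rewrite lee_fin.
  - exact/measurable_EFinP.
  - exact/measurable_EFinP.
  - move=> u _; rewrite lee_fin /t ler_wpM2l//.
    have [qn|_] := leP (quantile u) n%:R; last by rewrite ler0n.
    by rewrite (le_trans qn)// ler_nat.
rewrite (fin_integral_bmeas unifT bt) lee_fin.
by apply: (quantile_truncated_le mpsi mzeta pz Gc); rewrite ltr0n.
Qed.

(** Two errors of at most [e / 2]: the mesh costs [h] times the mean [J] of the modulus, and the
    truncation at [K h] costs [c' / (K h)]. The mesh is chosen first, then [K]. *)
Lemma quantile_expect_ge psi zeta c chi c' : ge0_monotone psi -> ge0_monotone zeta ->
  modulus psi zeta -> G (psi, c) ->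
  unif.-integrable setT (fun u => (zeta (quantile u))%:E) ->
  G (chi, c') -> (forall s, 0 <= s -> s * psi s <= chi s) ->
  c <= \int[unif]_u psi (quantile u).
Proof.
move=> mpsi mzeta pz Gc iz Gchi psichi; have [psi0 hpsi] := mpsi.
have [ipsi _] := quantile_expect_le mpsi mzeta pz Gc.
set I := \int[unif]_u _; set J := \int[unif]_u zeta (quantile u).
have J0 : 0 <= J by apply: Rintegral_ge0 => u _; case: mzeta.
have c'0 : 0 <= c'.
  by apply: (pG Gchi) => s s0; rewrite (le_trans _ (psichi s s0))// mulr_ge0.
apply/ler_addgt0Pl => e e0.
have J1 : 0 < 2 * (J + 1) by rewrite mulr_gt0// ltr_wpDl.
have d0 : 0 < Num.min 1 (e / (2 * (J + 1))) by rewrite lt_min ltr01 divr_gt0.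
pose h := Num.min 1 (e / (2 * (J + 1))).
have h0 : 0 < h := d0.
have h1 : h <= 1 by rewrite /h ge_min lexx.
have hJ : h * J <= e / 2.
  have : h <= e / (2 * (J + 1)) by rewrite /h ge_min lexx orbT.
  rewrite ler_pdivlMr// => hh; have := ltW h0; lra.
have eh0 : 0 < e / 2 * h by rewrite mulr_gt0// divr_gt0.
have [K [K0 hK]] := small_fraction c'0 eh0.
have [v [bv cv vpsi]] := functional_upper hpsi h0 Gc Gchi (fun s _ => psi0 s) psichi K0.
have Kh : c' / (K%:R * h) <= e / 2.
  by rewrite invfM mulrA ler_pdivrMr// ltW.
have vI : \int[unif]_u v u <= I + h * J.
  have izh : unif.-integrable setT (fun u => (h * zeta (quantile u))%:E).
    by have := integrableZl measurableT h iz.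
  rewrite /I /J -RintegralZl// -RintegralD//.
  apply: le_Rintegral => //.
  - exact: bmeas_integrable.
  - by have := integrableD measurableT ipsi izh.
  - move=> u _; apply: (le_trans (vpsi u)); apply: pz => //; exact: quantile_ge0.
lra.
Qed.

Let graph_ext f g c : poly_bounded g -> G (f, c) -> (forall s, 0 <= s -> f s = g s) ->
  G (g, c).
Proof.
move=> pg Gf fg; have Gg := functionalP pg.
rewrite (_ : c = functional g)//; apply/eqP; rewrite eq_le.
rewrite (functional_le Gf Gg)/=; last by move=> s /fg ->.
by rewrite (functional_le Gg Gf)// => s /fg ->.
Qed.

(** Shifted powers: the modulus of [psi n j] is [psi n j.+1], so the family contains its own moduli,
    and the maximum with 0 makes its members monotone on the whole line. *)
Let psi n j s : R := (Num.max 0 s + j%:R) ^+ n.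

Let psi_monotone n j : ge0_monotone (psi n j).
Proof.
have p0 s : 0 <= Num.max 0 s + j%:R :> R by rewrite addr_ge0// le_max lexx.
split; first by move=> s; rewrite exprn_ge0.
move=> x y xy; rewrite /psi lerXn2r ?nnegrE// lerD2r.
by rewrite ge_max !le_max lexx/= xy orbT.
Qed.

(** Convexity of the power at [s + h = (1 - h) s + h (s + 1)]; the induction step leaves
    [h (1 - h) ((s + 1) ^ n - s ^ n) >= 0]. *)
Lemma exprn_convex_modulus (n : nat) (s h : R) : 0 <= s -> 0 <= h <= 1 ->
  (s + h) ^+ n <= (1 - h) * s ^+ n + h * (s + 1) ^+ n.
Proof.
move=> s0 /andP[h0 h1]; elim: n => [|n IH]; first by rewrite !expr0; lra.
rewrite !exprS; have sh : 0 <= s + h by rewrite addr_ge0.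
apply: (le_trans (ler_wpM2l sh IH)).
have : s ^+ n <= (s + 1) ^+ n by rewrite lerXn2r ?nnegrE ?addr_ge0// lerDl.
set a := s ^+ n; set b := (s + 1) ^+ n => ab.
have : 0 <= h * (1 - h) * (b - a) by rewrite !mulr_ge0// subr_ge0.
lra.
Qed.

Let psi_modulus n j : modulus (psi n j) (psi n j.+1).
Proof.
move=> h s h0 h1 s0; rewrite /psi !max_r//; last by rewrite addr_ge0// ltW.
have sj : 0 <= s + j%:R by rewrite addr_ge0.
rewrite addrAC -natr1 addrA.
apply: (le_trans (exprn_convex_modulus n sj _)); first by rewrite (ltW h0).
by rewrite lerD2r mulrBl mul1r gerBl mulr_ge0 ?exprn_ge0// ltW.
Qed.

Let psi_bounded n j : poly_bounded (psi n j).
Proof.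
exists (('X + j%:R%:P) ^+ n) => s s0; rewrite horner_exp !hornerE.
by rewrite ger0_norm; [rewrite /psi max_r|case: (psi_monotone n j)].
Qed.

Let psi_integrable n j : unif.-integrable setT (fun u => (psi n j (quantile u))%:E).
Proof.
by have [] := quantile_expect_le (psi_monotone n j) (psi_monotone n j.+1)
  (@psi_modulus n j) (functionalP (psi_bounded n j)).
Qed.

Let quantile_expr n c : G (fun s => s ^+ n, c) ->
  \int[unif]_u (quantile u ^+ n) = c.
Proof.
move=> Gc; have Gpsi : G (psi n 0, c).
  apply: (graph_ext (psi_bounded n 0) Gc) => s s0.
  by rewrite /psi max_r// addr0.
have -> : \int[unif]_u (quantile u ^+ n) = \int[unif]_u psi n 0 (quantile u).
  by apply: eq_Rintegral => u _; rewrite /psi max_r ?quantile_ge0// addr0.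
apply/eqP; rewrite eq_le; apply/andP; split.
  by have [] := quantile_expect_le (psi_monotone n 0) (psi_monotone n 1)
    (@psi_modulus n 0) Gpsi.
apply: (quantile_expect_ge (psi_monotone n 0) (psi_monotone n 1) (@psi_modulus n 0)
  Gpsi (psi_integrable n 1) (functionalP (psi_bounded n.+1 0))) => s s0.
by rewrite /psi max_r// addr0 exprS.
Qed.

Let ratio s : R := Num.max 0 s / (1 + Num.max 0 s).

Let ratio_monotone : ge0_monotone ratio.
Proof.
have p0 s : 0 <= Num.max 0 s :> R by rewrite le_max lexx.
split; first by move=> s; rewrite divr_ge0// addr_ge0.
move=> x y xy; rewrite /ratio.
have : Num.max 0 x <= Num.max 0 y by rewrite ge_max !le_max lexx/= xy orbT.
have := p0 x; have := p0 y; move: (Num.max 0 x) (Num.max 0 y) => a b b0 a0 ab.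
rewrite ler_pdivrMr ?ltr_wpDr// mulrAC ler_pdivlMr ?ltr_wpDr//; lra.
Qed.

Let ratio_modulus : modulus ratio (psi 0 0).
Proof.
move=> h s h0 h1 s0; rewrite /ratio /psi expr0 mulr1 !max_r//; last first.
  by rewrite addr_ge0// ltW.
rewrite ler_pdivrMr; last by lra.
rewrite mulrDl mulrAC -lerBlDr ler_pdivlMr; last by lra.
have : 0 <= s * h by rewrite mulr_ge0// ltW.
have : 0 <= h * h by rewrite mulr_ge0// ltW.
have : 0 <= s * s * h by rewrite !mulr_ge0// ltW.
have : 0 <= s * (h * h) by rewrite !mulr_ge0// ltW.
lra.
Qed.

(** The powers are matched for the sake of determinacy, and [s / (1 + s)] to reveal the prescribed
    value of the extension. The latter stands for [1 / (1 + s)] because the step estimates are for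
    nondecreasing functions. *)
Lemma functional_representation : exists mu : probability R R,
  [/\ mu `[0, +oo[%classic = 1%E, finite_moments1 mu,
    forall n c, G (fun s => s ^+ n, c) -> \int[mu]_s (s ^+ n) = c &
    forall c, G (fun s => s / (1 + s), c) ->
      \int[mu]_s (Num.max 0 s / (1 + Num.max 0 s)) = c].
Proof.
have iX n : unif.-integrable setT (fun u => (quantile u ^+ n)%:E).
  rewrite (_ : (fun u => _) = (fun u => (psi n 0 (quantile u))%:E))//.
  by apply/funext => u; rewrite /psi max_r ?quantile_ge0// addr0.
exists (distribution unif quantile); split.
- rewrite /= /distribution /pushforward/= (_ : _ @^-1` _ = setT)//.
  by apply/seteqP; split => // u _ /=; rewrite in_itv/= andbT quantile_ge0.
- move=> n; apply: integrable_pushforward => //; last exact: (iX n).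
  by apply/measurable_EFinP; exact: measurable_funX.
- move=> n c Gc; rewrite -(quantile_expr Gc) /Rintegral integral_distribution//; last exact: (iX n).
  by apply/measurable_EFinP; exact: measurable_funX.
- move=> c Gc; have pr : poly_bounded ratio.
    exists 1 => s s0; rewrite hornerC ger0_norm; last by case: ratio_monotone.
    by rewrite /ratio max_r// ler_pdivrMr ?ltr_wpDr// mul1r lerDr.
  have Gr : G (ratio, c).
    by apply: (graph_ext pr Gc) => s s0; rewrite /ratio max_r.
  have br : bmeas ratio.
    split; first by apply: nondecreasing_measurable => //; case: ratio_monotone.
    exists 1 => s; have [r0 _] := ratio_monotone; rewrite ger0_norm// /ratio.
    have : 0 <= Num.max 0 s by rewrite le_max lexx.
    by move=> m0; rewrite ler_pdivrMr ?ltr_wpDr// mul1r lerDr.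
  rewrite (expect_distribution _ _ br).
  apply/eqP; rewrite eq_le; apply/andP; split.
    by have [] := quantile_expect_le ratio_monotone (psi_monotone 0 0)
      ratio_modulus Gr.
  apply: (quantile_expect_ge ratio_monotone (psi_monotone 0 0) ratio_modulus
    Gr (psi_integrable 0 0) (functionalP (psi_bounded 1 0))) => s s0.
  rewrite /ratio /psi max_r// addr0 expr1 mulrA ler_pdivrMr ?ltr_wpDr//.
  by rewrite mulrDr mulr1 lerDr.
Qed.

End functional_measure.

Section poly_moments.
Context d (T : measurableType d) (R : realType) (P : probability T R).
Variable S : T -> R.
Hypothesis mS : measurable_fun setT S.
Hypothesis iS : forall n, P.-integrable setT (fun z => (S z ^+ n)%:E).

Lemma integrable_poly (q : {poly R}) : P.-integrable setT (fun z => (q.[S z])%:E).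
Proof.
rewrite (_ : (fun z => _) =
    (fun z => \sum_(i < size q) (q`_i)%:E * (S z ^+ i)%:E)%E); last first.
  by apply/funext => z; rewrite horner_coef sumEFin.
by apply: integrable_sum => // i _; exact: integrableZl.
Qed.

Lemma integrable_bmeas_poly (W : T -> R) (q : {poly R}) : bmeas W ->
  P.-integrable setT (fun z => (W z * q.[S z])%:E).
Proof.
move=> [mW [M WM]].
apply: (integrableMr measurableT mW _ (integrable_poly q)).
by exists M; split; [exact: num_real|move=> y My x _ /=; rewrite (le_trans (WM x))// ltW].
Qed.

End poly_moments.

Section expect_integrable.
Context d (T : measurableType d) (R : realType) (P : probability T R).
Variables (D : set T) (mD : measurable D) (PD : P D = 1%E).

Lemma expect_le_integrable (f g : T -> R) :
  P.-integrable setT (EFin \o f) -> P.-integrable setT (EFin \o g) ->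
  (forall z, D z -> f z <= g z) -> \int[P]_z f z <= \int[P]_z g z.
Proof.
move=> fi gi fg.
have onD (h : T -> R) : P.-integrable setT (EFin \o h) ->
    \int[P]_z h z = \int[P]_(z in D) h z.
  move=> hi; rewrite /Rintegral; congr fine.
  have PC : P (~` D) = 0%E by rewrite probability_setC// [X in (_ - X)%E](_ : _ = 1%E)// subee.
  rewrite (negligible_integral _ _ _ PC)//.
  - by rewrite setDE setCK setTI.
  - exact: measurableC.
rewrite !onD//; apply: le_Rintegral => //; exact: (integrableS measurableT mD).
Qed.

End expect_integrable.

(** * Polynomial approximation under a determinate law *)

Section moment_density.
Context (R : realType) (m : probability R R).
Hypothesis m_cond : finite_moments_condition m.
Let m0 : m `[0, +oo[%classic = 1%E. Proof. by case: m_cond. Qed.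
Let im : finite_moments1 m. Proof. by case: m_cond. Qed.
Let mi : measurable (`[0, +oo[%classic : set R). Proof. by []. Qed.
Let mT : m setT = 1%E. Proof. exact: probability_setT. Qed.

Definition ratio (s : R) : R := Num.max 0 s / (1 + Num.max 0 s).

Lemma ratioE s : 0 <= s -> ratio s = s / (1 + s).
Proof. by move=> s0; rewrite /ratio max_r. Qed.

Lemma ratio01 s : 0 <= ratio s <= 1.
Proof.
have p0 : 0 <= Num.max 0 s by rewrite le_max lexx.
by rewrite /ratio divr_ge0 ?addr_ge0//= ler_pdivrMr ?ltr_wpDr// mul1r lerDr.
Qed.

Lemma bmeas_ratio : bmeas ratio.
Proof.
split; last first.
  by exists 1 => s; have /andP[r0 r1] := ratio01 s; rewrite ger0_norm.
apply: nondecreasing_measurable => // x y xy; rewrite /ratio.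
have p0 z : 0 <= Num.max 0 z :> R by rewrite le_max lexx.
have : Num.max 0 x <= Num.max 0 y by rewrite ge_max !le_max lexx/= xy orbT.
have := p0 x; have := p0 y; move: (Num.max 0 x) (Num.max 0 y) => a b b0 a0 ab.
rewrite ler_pdivrMr ?ltr_wpDr// mulrAC ler_pdivlMr ?ltr_wpDr//; lra.
Qed.

Let ip (q : {poly R}) : m.-integrable setT (fun s => (q.[s])%:E).
Proof. exact: (integrable_poly (S := id)). Qed.

Let iw (W : R -> R) (q : {poly R}) : bmeas W ->
  m.-integrable setT (fun s => (W s * q.[s])%:E).
Proof. exact: (integrable_bmeas_poly (S := id)). Qed.

Let mean (q : {poly R}) : R := \int[m]_s q.[s].

Let mean_lin a p q : mean (a *: p + q) = a * mean p + mean q.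
Proof.
rewrite /mean -RintegralZl//; last exact: (ip p).
rewrite -RintegralD//; last 2 first.
- by have := integrableZl measurableT a (ip p).
- exact: (ip q).
by apply: eq_Rintegral => s _; rewrite hornerD hornerZ.
Qed.

Let Phi := 1 - \int[m]_s ratio s.

Let bmeas_1r : bmeas (fun s => 1 - ratio s).
Proof. by apply: bmeasB; [exact: bmeas_cst|exact: bmeas_ratio]. Qed.

Let PhiE : Phi = \int[m]_s (1 - ratio s).
Proof.
by rewrite expectB ?expect_cst//; [exact: bmeas_cst|exact: bmeas_ratio].
Qed.

(* M. Riesz: otherwise the moment functional would have an extension with a
   strictly larger value at [1/(1+s)], hence a second representing measure. *)
Lemma poly_above_inv (e : R) : 0 < e -> exists q : {poly R},
  (forall s, 0 <= s -> (1 + s)^-1 <= q.[s]) /\ mean q <= Phi + e.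
Proof.
move=> e0; apply: contrapT => /forallNP H.
have {}H (q : {poly R}) : (forall s, 0 <= s -> (1 + s)^-1 <= q.[s]) -> Phi + e < mean q.
  by move=> qs; rewrite ltNge; apply/negP => h; apply: (H q).
pose phi s : R := 1 - s / (1 + s).
have phiE s : 0 <= s -> phi s = (1 + s)^-1.
  by move=> s0; rewrite /phi; field; rewrite gt_eqF// ltr_wpDr.
pose G0 : set ((R -> R) * R) := [set u | exists (q : {poly R}) (t : R),
  u = (fun s => q.[s] + t * phi s, mean q + t * (Phi + e))].
have G0p q : G0 (fun s => q.[s], mean q).
  exists q, 0; rewrite mul0r addr0; congr pair.
  by apply/funext => s; rewrite mul0r addr0.
have lG0 : graph_linear G0.
  move=> a _ _ _ _ [p [t [-> ->]]] [q [v [-> ->]]].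
  exists (a *: p + q), (a * t + v); congr pair; last by rewrite mean_lin; ring.
  by apply/funext => s; rewrite hornerD hornerZ; ring.
(* For [t >= 0] positivity holds because [Phi + e] exceeds the mean [Phi] of [phi] under [m]; for
   [t < 0] the polynomial [q / (- t)] lies above [phi], and [H] applies to it. *)
have pG0 : graph_positive [set s | 0 <= s] G0.
  move=> _ _ [q [t [-> ->]]] qt; have [t0|t0] := leP 0 t.
    rewrite mulrDr addrA addr_ge0//; last by rewrite mulr_ge0// ltW.
    have iq2 : m.-integrable setT (fun s => (t * (1 - ratio s))%:E).
      by have := integrableZl measurableT t (bmeas_integrable mT bmeas_1r).
    rewrite PhiE -RintegralZl//; last exact: bmeas_integrable.
    rewrite /mean -RintegralD//; last exact: (ip q).
    rewrite -(expect_cst mT 0).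
    apply: (expect_le_integrable mi m0).
    - exact: (bmeas_integrable mT (bmeas_cst _ _)).
    - by have := integrableD measurableT (ip q) iq2.
    - by move=> s /=; rewrite in_itv/= andbT => s0; have := qt s s0; rewrite /phi ratioE.
  have tN : 0 < - t by rewrite oppr_gt0.
  have mean0 : mean 0 = 0.
    by rewrite /mean; under eq_Rintegral do rewrite horner0; rewrite expect_cst.
  have h : Phi + e < mean q / - t.
    rewrite mulrC -[ltRHS]addr0 -mean0 -mean_lin addr0; apply: H => s s0.
    rewrite hornerZ mulrC ler_pdivlMr// -phiE//.
    by have := qt s s0; lra.
  by move: h; rewrite ltr_pdivlMr//; lra.
have [G [lG pG G0G tot]] := riesz_extension (ex_intro _ _ (G0p 0)) lG0 pG0.
have Gtotal f : poly_bounded f -> exists c, G (f, c).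
  move=> [q fq]; apply: tot; split.
    exists (fun s => (-1 *: q + 0).[s], mean (-1 *: q + 0)); first exact: G0p.
    move=> s s0; rewrite [(_, _).1]/=.
    by have := fq s s0; rewrite addr0 hornerZ mulN1r ler_norml => /andP[].
  exists (fun s => q.[s], mean q); first exact: G0p.
  move=> s s0; rewrite [(_, _).1]/=.
  by have := fq s s0; rewrite ler_norml => /andP[].
have G1 : G (fun=> 1, 1).
  apply: G0G; have := G0p 1; rewrite (_ : mean 1 = 1); last first.
    by rewrite /mean; under eq_Rintegral do rewrite hornerC; rewrite expect_cst.
  by rewrite (_ : (fun s => _) = (fun=> 1))//; apply/funext => s; rewrite hornerC.
have [mu [mu0 mumom muX muratio]] := functional_representation lG pG Gtotal G1.
have muE : forall A, measurable A -> mu A = m A.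
  case: m_cond => _ _; apply => // n.
  have GX : G (fun s => s ^+ n, mean 'X^n).
    apply: G0G; have := G0p 'X^n.
    by rewrite (_ : (fun s => _) = (fun s => s ^+ n))//; apply/funext => s; rewrite hornerXn.
  have meanX : mean 'X^n = \int[m]_s (s ^+ n).
    by apply: eq_Rintegral => s _; rewrite hornerXn.
  have := muX n _ GX; rewrite meanX.
  move=> eqX; rewrite -[LHS]fineK; last by apply: integrable_fin_num; last exact: mumom.
  rewrite -[RHS]fineK; last by apply: integrable_fin_num; last exact: im.
  exact: (congr1 EFin eqX).
have Gr : G (fun s => s / (1 + s), 1 - (Phi + e)).
  apply: G0G; exists 1, (-1); congr pair.
    by apply/funext => s; rewrite hornerC /phi; ring.
  rewrite (_ : mean 1 = 1); first by ring.
  by rewrite /mean; under eq_Rintegral do rewrite hornerC; rewrite expect_cst.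
(* The representing measure is [m], yet it gives [s / (1 + s)] the mean [1 - (Phi + e)] instead of
   [1 - Phi]. *)
have h : \int[m]_s ratio s = 1 - (Phi + e).
  by rewrite -(muratio _ Gr); apply/esym/eq_measure_expect.
by move: h e0; rewrite /Phi; lra.
Qed.

(* M. Riesz's trick: [(1 + s) q - 1] is nonnegative on the half-line but equals
   [-1] at [s = -1], so in its decomposition [a^2 + s b^2] one has [|b(-1)| >= 1]. *)
Lemma christoffel_vanishing (e : R) : 0 < e -> exists b : {poly R},
  b.[-1] = 1 /\ \int[m]_s (ratio s * (b ^+ 2).[s]) <= e.
Proof.
move=> e0; have [q [qs qe]] := poly_above_inv e0.
have [|[a b] /= gE] := @half_line_positive_square R ((1 + 'X) * q - 1).
  move=> s s0; rewrite !hornerE /=; have s1 : 0 < 1 + s by rewrite ltr_wpDr// ltW.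
  have := ler_wpM2l (ltW s1) (qs s (ltW s0)); rewrite mulfV ?gt_eqF//; lra.
have bN1 : 1 <= b.[-1] ^+ 2.
  have := congr1 (horner^~ (-1)) gE; rewrite !hornerE/= => h.
  have := sqr_ge0 a.[-1]; lra.
(* Divide [(1 + s) q - 1 = a ^ 2 + s b ^ 2] by [1 + s] and drop [a ^ 2]; what remains on the right,
   [q] minus [1 / (1 + s)], has mean at most [e]. *)
have le_b s : 0 <= s -> ratio s * (b ^+ 2).[s] <= q.[s] - (1 - ratio s).
  move=> s0.
  have h : (1 + s) * q.[s] - 1 = a.[s] ^+ 2 + s * b.[s] ^+ 2.
    by have := congr1 (horner^~ s) gE; rewrite !(hornerE, horner_exp).
  rewrite horner_exp ratioE//.
  have s1 : 0 < 1 + s by rewrite ltr_wpDr.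
  rewrite -(ler_pM2l s1); have a2 := sqr_ge0 a.[s].
  have -> : (1 + s) * (s / (1 + s) * b.[s] ^+ 2) = s * b.[s] ^+ 2.
    by field; rewrite gt_eqF.
  have -> : (1 + s) * (q.[s] - (1 - s / (1 + s))) = (1 + s) * q.[s] - 1.
    by field; rewrite gt_eqF.
  lra.
have Ib : \int[m]_s (ratio s * (b ^+ 2).[s]) <= e.
  apply: (@le_trans _ _ (\int[m]_s (q.[s] - (1 - ratio s)))).
    apply: (expect_le_integrable mi m0).
    - exact: (iw _ bmeas_ratio).
    - by have := integrableB measurableT (ip q) (bmeas_integrable mT bmeas_1r).
    - by move=> s /=; rewrite in_itv/= andbT => /le_b.
  rewrite RintegralB//; [|exact: (ip q)|exact: (bmeas_integrable mT bmeas_1r)].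
  by rewrite -PhiE lerBlDl.
have b0 : b.[-1] != 0.
  by apply: contraTneq bN1 => ->; rewrite expr0n/= -ltNge ltr01.
(* Normalization at -1 can only decrease the integral, as [b.[-1] ^ 2 >= 1]. *)
exists (b.[-1]^-1 *: b); split; first by rewrite hornerZ mulVf.
rewrite (_ : (fun s => _) = (fun s => (b.[-1] ^+ 2)^-1 * (ratio s * (b ^+ 2).[s]))).
  rewrite RintegralZl//; last exact: (iw _ bmeas_ratio).
  rewrite mulrC ler_pdivrMr; last by lra.
  by rewrite (le_trans Ib)// ler_peMr// ltW.
apply/funext => s; rewrite !horner_exp hornerZ exprMn exprVn; ring.
Qed.

End moment_density.

Lemma expect_cvg d (T : measurableType d) (R : realType) (P : probability T R)
    (f_ : nat -> T -> R) (f : T -> R) (M : R) :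
  (forall n, measurable_fun setT (f_ n)) -> measurable_fun setT f ->
  (forall n z, `|f_ n z| <= M) -> (forall z, f_ n z @[n --> \oo] --> f z) ->
  \int[P]_z f_ n z @[n --> \oo] --> \int[P]_z f z.
Proof.
move=> mf_ mf fM f_f; have PT := probability_setT P.
have bf : bmeas f.
  split => //; exists M => z; apply: (cvgr_to_le (cvg_norm (f_f z))).
  exact: nearW.
apply: fine_cvg; rewrite -(fin_integral_bmeas PT bf).
have [] // := @dominated_convergence _ _ _ P setT measurableT
  (fun n z => (f_ n z)%:E) (EFin \o f) (cst M%:E).
- by move=> n; exact/measurable_EFinP.
- exact/measurable_EFinP.
- by apply: aeW => z _; apply: cvg_EFin; [exact: nearW|exact: f_f].
- exact: (bmeas_integrable PT (bmeas_cst _ M)).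
- by apply: aeW => z n _; rewrite abse_EFin lee_fin.
Qed.

Section law_integral.
Context d (T : measurableType d) (R : realType) (P : probability T R).
Variables (S : T -> R) (m : probability R R).
Hypotheses (mS : measurable_fun setT S).
Hypothesis mE : forall A, measurable A -> m A = P (S @^-1` A).

Lemma ge0_integral_law (f : R -> \bar R) : measurable_fun setT f ->
  (forall s, (0 <= f s)%E) -> (\int[m]_s f s = \int[P]_z f (S z))%E.
Proof.
move=> mf f0; rewrite (eq_measure_integral (image_measure P mS)); last first.
  by move=> A mA _; exact: mE.
by rewrite ge0_integral_pushforward.
Qed.

Lemma expect_law (f : R -> R) : bmeas f -> \int[m]_s f s = \int[P]_z f (S z).
Proof.
move=> bf; have [M [bfM f0 fME]] := bmeas_shift bf.
have bfS : bmeas (f \o S) by exact: bmeas_comp.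
apply: (addIr M); rewrite -(fME m (probability_setT m)).
rewrite -[X in _ + X](expect_cst (probability_setT P) M).
rewrite -(expectD (probability_setT P) bfS (bmeas_cst _ M)).
rewrite /Rintegral; congr fine; apply: (ge0_integral_law (f := fun s => (f s + M)%:E)) => //.
by apply/measurable_EFinP; case: bfM.
Qed.

End law_integral.

Section pushforward_density.
Context d (T : measurableType d) (R : realType) (P : probability T R).
Variables (S g : T -> R).
Hypotheses (mS : measurable_fun setT S) (mg : measurable_fun setT g).
Hypothesis g0 : forall z, 0 <= g z.
Local Open Scope ereal_scope.

(** The measure with density [g], pushed forward by [S], is written as a mixture over [z] of point
    masses of weight [g z] at [S z], so that [ge0_integral_mixture] computes its integrals. *)
Definition density_kernel (z : T) : {measure set R -> \bar R} :=
  mscale (NngNum (g0 z)) (\d_(S z)).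

Let density_kernelE z A : density_kernel z A = (g z)%:E * (\1_A (S z))%:E.
Proof. by rewrite /density_kernel/= /mscale/= diracE indicE. Qed.

Let measurable_density_kernel A : measurable A ->
  measurable_fun setT (density_kernel ^~ A).
Proof.
move=> mA; rewrite (_ : density_kernel ^~ A =
    (fun z => (g z * \1_A (S z))%:E)); last first.
  by apply/funext => z; rewrite density_kernelE.
apply/measurable_EFinP; apply: measurable_funM => //.
by apply: measurableT_comp => //; exact: measurable_indic.
Qed.

HB.instance Definition _ :=
  isKernel.Build _ _ _ _ _ density_kernel measurable_density_kernel.

(* The unused proofs let the measure instance be inferred from the term. *)
Definition density_measure (_ : measurable_fun setT S) (_ : measurable_fun setT g)
  (A : set R) : \bar R := \int[P]_z density_kernel z A.
Local Notation dens := (density_measure mS mg).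

Let density_measure0 : dens set0 = 0.
Proof.
by rewrite /density_measure; under eq_integral do rewrite measure0; rewrite integral0.
Qed.

Let density_measure_ge0 A : 0 <= dens A.
Proof. exact: integral_ge0. Qed.

Let density_measure_sigma_additive : semi_sigma_additive dens.
Proof.
move=> U mU tU mUU; rewrite [X in _ --> X](_ : _ =
  \int[P]_z (\sum_(n <oo) density_kernel z (U n))); last first.
  apply: eq_integral => V _.
  by apply/esym/cvg_lim => //; exact/measure_semi_sigma_additive.
apply/cvg_closeP; split.
  by apply: is_cvg_nneseries => n _ _; exact: integral_ge0.
rewrite closeE// integral_nneseries// => n.
exact: measurable_density_kernel.
Qed.

HB.instance Definition _ := isMeasure.Build _ _ _ dens
  density_measure0 density_measure_ge0 density_measure_sigma_additive.

Lemma ge0_integral_density (f : R -> \bar R) : measurable_fun setT f ->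
  (forall s, 0 <= f s) ->
  \int[dens]_s f s = \int[P]_z ((g z)%:E * f (S z)).
Proof.
move=> mf f0; rewrite (@ge0_integral_mixture _ _ _ _ _ P density_kernel)//.
apply: eq_integral => z _; rewrite ge0_integral_mscale// integral_dirac//.
by rewrite diracT mul1e.
Qed.

End pushforward_density.

Section bmeas_polynomial.
Context d (T : measurableType d) (R : realType).

Lemma bmeasX (f : T -> R) n : bmeas f -> bmeas (fun z => f z ^+ n).
Proof.
move=> bf; elim: n => [|n IH].
  by rewrite (_ : (fun z => _) = (fun=> 1)); [exact: bmeas_cst|apply/funext].
rewrite (_ : (fun z => _) = (fun z => f z * f z ^+ n)); first exact: bmeasM.
by apply/funext => z; rewrite exprS.
Qed.

Lemma bmeas_sum n (f : nat -> T -> R) : (forall j, bmeas (f j)) ->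
  bmeas (fun z => \sum_(j < n) f j z).
Proof.
move=> bf; elim: n => [|n IH].
  by under eq_fun do rewrite big_ord0; exact: bmeas_cst.
by under eq_fun do rewrite big_ord_recr; exact: bmeasD.
Qed.

End bmeas_polynomial.

(** * Orthogonality to polynomials *)

Section annihilator.
Context d (T : measurableType d) (R : realType) (P : probability T R).
Variables (S W : T -> R) (m : probability R R) (i : nat).
Hypotheses (mS : measurable_fun setT S) (S0 : P (S @^-1` `[0, +oo[%classic) = 1%E).
Hypothesis iS : forall n, P.-integrable setT (fun z => (S z ^+ n)%:E).
Hypothesis m_cond : finite_moments_condition m.
Hypothesis mE : forall A, measurable A -> m A = P (S @^-1` A).
Hypotheses (mW : measurable_fun setT W) (W1 : forall z, `|W z| <= 1).
Hypothesis annih : forall n, \int[P]_z (W z * S z ^+ (i + n)) = 0.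

Let PT : P setT = 1%E. Proof. exact: probability_setT. Qed.
Let mD : measurable (S @^-1` `[0, +oo[%classic).
Proof. by rewrite -[_ @^-1` _]setTI; exact: mS. Qed.
Let bW : bmeas W. Proof. by split => //; exists 1. Qed.
Let r z := ratio (S z).
Let br : bmeas r. Proof. exact: (bmeas_comp mS (@bmeas_ratio R)). Qed.
Let r01 z : 0 <= r z <= 1. Proof. exact: ratio01. Qed.
Let bt : bmeas (fun z => 1 - r z).
Proof. by apply: bmeasB => //; exact: bmeas_cst. Qed.

Let iwq w (q : {poly R}) : bmeas w -> P.-integrable setT (fun z => (w z * q.[S z])%:E).
Proof. exact: integrable_bmeas_poly. Qed.

Let iwX w n : bmeas w -> P.-integrable setT (fun z => (w z * S z ^+ n)%:E).
Proof.
by move=> bw; have := iwq 'X^n bw; under eq_fun do rewrite hornerXn.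
Qed.

Let eqD (f g : T -> R) : P.-integrable setT (EFin \o f) ->
  P.-integrable setT (EFin \o g) ->
  (forall z, 0 <= S z -> f z = g z) -> \int[P]_z f z = \int[P]_z g z.
Proof.
move=> fi gi fg; apply/eqP; rewrite eq_le; apply/andP; split;
  apply: (expect_le_integrable mD S0) => // z /=; rewrite in_itv/= andbT => Sz;
  by rewrite fg.
Qed.

Section descent.
Variable w : T -> R.
Hypotheses (bw : bmeas w) (w1 : forall z, `|w z| <= 1).
Hypothesis annihw : forall n, \int[P]_z (w z * S z ^+ (i + n)) = 0.

Let annihq (c : {poly R}) : \int[P]_z (w z * (S z ^+ i * c.[S z])) = 0.
Proof.
have E z : w z * (S z ^+ i * c.[S z]) = \sum_(k < size c) c`_k * (w z * S z ^+ (i + k)).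
  rewrite horner_coef mulr_sumr mulr_sumr; apply: eq_bigr => k _.
  by rewrite exprD; ring.
under eq_Rintegral do rewrite E.
elim: (size c) => [|n IH].
  by under eq_Rintegral do rewrite big_ord0; rewrite expect_cst.
under eq_Rintegral do rewrite big_ord_recr/=.
have iZ : P.-integrable setT (fun z => (c`_n * (w z * S z ^+ (i + n)))%:E).
  by have := integrableZl measurableT c`_n (iwX (i + n) bw).
rewrite RintegralD//; last first.
  rewrite (_ : EFin \o _ = fun z =>
    (\sum_(k < n) (c`_k)%:E * (w z * S z ^+ (i + k))%:E)%E); last first.
    by apply/funext => z; rewrite /= -sumEFin.
  by apply: integrable_sum => // k _; apply: integrableZl => //; exact: iwX.
by rewrite IH RintegralZl ?annihw ?mulr0 ?addr0//; exact: iwX.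
Qed.

(* As [b.[-1] = 1], replacing [1] by [b.[S z]] changes the integrand by
   [w z * S z ^+ i.+1] times a polynomial in [S z], divisible by [S z ^+ i]; the
   integral with [b] is then small by the AM-GM inequality. *)
Let annihr : \int[P]_z (w z * (r z * S z ^+ i)) = 0.
Proof.
have iwr : P.-integrable setT (fun z => (w z * (r z * S z ^+ i))%:E).
  have := iwX i (bmeasM bw br); apply: eq_integrable => // z _.
  by rewrite mulrA.
pose M := \int[P]_z (S z ^+ (i + i)).
have M0 : 0 <= M by apply: Rintegral_ge0 => z _; rewrite exprD -expr2 sqr_ge0.
apply/eqP; rewrite -normr_le0; apply/ler_addgt0Pl => e e0; rewrite addr0.
have im2 b : m.-integrable setT (fun s => (ratio s * (b ^+ 2).[s])%:E).
  apply: (integrable_bmeas_poly (S := id)) => //; last exact: bmeas_ratio.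
  by case: m_cond.
have M1 : 0 < M + 1 by rewrite ltr_wpDl.
(* AM-GM in the form [x y <= dl x ^ 2 + y ^ 2 / (4 dl)], with [x = S z ^+ i] and [y] the absolute
   value of [b]: the first term contributes [dl M], the second [dl] because of the bound [4 dl ^ 2]
   on the integral with [b], and [dl (M + 1) = e]. *)
pose dl := e / (M + 1); have d0 : 0 < dl by rewrite divr_gt0.
have d4 : 0 < 4 * dl ^+ 2 by rewrite mulr_gt0// exprn_gt0.
have [b [b1 Hb]] := christoffel_vanishing m_cond d4.
have /factor_theorem[c cE] : root (1 - b) (-1).
  by rewrite /root !hornerE b1 subrr.
have cs s : 1 - b.[s] = c.[s] * (s + 1).
  by have := congr1 (horner^~ s) cE; rewrite !hornerE/= opprK.
have irb : P.-integrable setT (fun z => (w z * (r z * b.[S z] * S z ^+ i))%:E).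
  have := iwq (b * 'X^i) (bmeasM bw br); apply: eq_integrable => // z _.
  by rewrite hornerM hornerXn !mulrA.
have -> : \int[P]_z (w z * (r z * S z ^+ i)) =
          \int[P]_z (w z * (r z * b.[S z] * S z ^+ i)).
  rewrite -[RHS]addr0 -(annihq ('X * c)) -RintegralD//; last first.
    have := iwq ('X^i * ('X * c)) bw; apply: eq_integrable => // z _.
    by rewrite hornerM hornerXn.
  apply: eqD => //.
    have iq : P.-integrable setT (fun z => (w z * (S z ^+ i * ('X * c).[S z]))%:E).
      have := iwq ('X^i * ('X * c)) bw; apply: eq_integrable => // z _.
      by rewrite hornerM hornerXn.
    by have := integrableD measurableT irb iq.
  move=> z Sz; rewrite /r ratioE// !hornerE/=.
  have -> : b.[S z] = 1 - c.[S z] * (S z + 1) by rewrite -cs; ring.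
  by field; rewrite gt_eqF// ltr_wpDr.
have iM : P.-integrable setT (fun z => (dl * S z ^+ (i + i))%:E).
  by have := integrableZl measurableT dl (iS (i + i)).
have irb2 : P.-integrable setT (fun z => (r z * (b ^+ 2).[S z])%:E) by exact: iwq.
have irb24 : P.-integrable setT (fun z => ((4 * dl)^-1 * (r z * (b ^+ 2).[S z]))%:E).
  by have := integrableZl measurableT (4 * dl)^-1 irb2.
apply: (@le_trans _ _ (dl * M + (4 * dl)^-1 * (4 * dl ^+ 2))); last first.
  have -> : dl * M + (4 * dl)^-1 * (4 * dl ^+ 2) = dl * (M + 1).
    by field; rewrite gt_eqF.
  by rewrite /dl divfK// gt_eqF.
apply: (le_trans (le_normr_Rintegral measurableT irb)).
apply: (@le_trans _ _ (\int[P]_z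
    (dl * S z ^+ (i + i) + (4 * dl)^-1 * (r z * (b ^+ 2).[S z])))); last first.
  rewrite (RintegralD measurableT iM irb24)// (RintegralZl _ measurableT (iS (i + i)))//.
  rewrite (RintegralZl _ measurableT irb2)// lerD2l ler_wpM2l//.
    by rewrite invr_ge0 mulr_ge0// ltW.
  apply: le_trans Hb; rewrite le_eqVlt; apply/orP; left; apply/eqP.
  rewrite /Rintegral (ge0_integral_law mS mE)//.
  - by apply/measurable_EFinP; case/integrableP: (im2 b) => /measurable_EFinP.
  - move=> s; rewrite lee_fin horner_exp mulr_ge0 ?sqr_ge0//.
    by have /andP[] := ratio01 s.
apply: (expect_le_integrable mD S0).
- by have := integrable_abse irb.
- by have := integrableD measurableT iM irb24.
move=> z /=; rewrite in_itv/= andbT => Sz.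
have [r0 r1] : 0 <= r z /\ r z <= 1 by apply/andP.
have Si : 0 <= S z ^+ i by rewrite exprn_ge0.
have -> : `|w z * (r z * b.[S z] * S z ^+ i)| = `|w z| * (r z * `|b.[S z]| * S z ^+ i).
  by rewrite normrM normrM normrM (ger0_norm r0) (ger0_norm Si).
rewrite horner_exp exprD.
set s := S z ^+ i in Si *; set bb := b.[S z].
have b2 : bb ^+ 2 = `|bb| ^+ 2 by rewrite real_normK// num_real.
rewrite b2; have := normr_ge0 bb; move: `|bb| => y y0.
have amgm : s * y <= dl * (s * s) + (4 * dl)^-1 * y ^+ 2.
  have -> : dl * (s * s) + (4 * dl)^-1 * y ^+ 2 =
     s * y + (4 * dl)^-1 * (2 * dl * s - y) ^+ 2 by field; rewrite gt_eqF.
  by rewrite lerDl mulr_ge0 ?sqr_ge0// invr_ge0 mulr_ge0// ltW.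
apply: (@le_trans _ _ (1 * (r z * y * s))).
  apply: ler_wpM2r; last exact: w1.
  by apply: mulr_ge0 => //; apply: mulr_ge0.
rewrite mul1r -mulrA [y * s]mulrC; apply: (le_trans (ler_wpM2l r0 amgm)).
rewrite mulrDr lerD//; last by rewrite mulrCA.
apply: ler_piMl => //; apply: mulr_ge0; first exact: ltW.
exact: mulr_ge0.
Qed.

(** On the half-line [1 - r] is [1 / (1 + S)]. The case [n = 0] is [annihw 0] minus [annihr], and [S
    ^ (n + 1) / (1 + S) = S ^ n - S ^ n / (1 + S)] gives the induction. As [i] is unchanged, the
    lemma applies again to [w (1 - r)]. *)
Lemma descent n : \int[P]_z (w z * (1 - r z) * S z ^+ (i + n)) = 0.
Proof.
elim: n => [|n IH].
  have := subrr (0 : R); rewrite -[X in X - _](annihw 0) -[X in _ - X]annihr addn0.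
  rewrite -RintegralB//; last 2 first.
  - exact: (iwX i bw).
  - have := iwX i (bmeasM bw br); apply: eq_integrable => // z _.
    by rewrite /= mulrA.
  by move=> h; rewrite -[RHS]h; apply: eq_Rintegral => z _; ring.
have := subrr (0 : R); rewrite -[X in X - _](annihw n) -[X in _ - X]IH.
have bwr : bmeas (fun z => w z * (1 - r z)) by exact: bmeasM.
rewrite -RintegralB//; last 2 first.
- exact: (iwX _ bw).
- exact: (iwX _ bwr).
move=> h; rewrite -[RHS]h; apply: eqD.
- exact: (iwX _ bwr).
- by have := integrableB measurableT (iwX (i + n) bw) (iwX (i + n) bwr).
move=> z Sz; rewrite addnS exprS /r ratioE//; field.
by rewrite gt_eqF// ltr_wpDr.
Qed.

End descent.

Let v z := W z * r z ^+ i.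
Let bv : bmeas v. Proof. by apply: bmeasM => //; exact: bmeasX. Qed.
Let v1 z : `|v z| <= 1.
Proof.
have /andP[r0 r1] := r01 z.
rewrite normrM normrX (ger0_norm r0); apply: mulr_ile1 => //; first exact: exprn_ge0.
exact: exprn_ile1.
Qed.

Let annihv n : \int[P]_z (v z * S z ^+ n) = 0.
Proof.
have H k : [/\ bmeas (fun z => W z * (1 - r z) ^+ k),
    forall z, `|W z * (1 - r z) ^+ k| <= 1 &
    forall n, \int[P]_z (W z * (1 - r z) ^+ k * S z ^+ (i + n)) = 0].
  have b1 k' : bmeas (fun z => W z * (1 - r z) ^+ k') by apply: bmeasM => //; exact: bmeasX.
  elim: k => [|k [bk wk Hk]].
    split => // [z|n']; first by rewrite expr0 mulr1.
    by rewrite -[RHS](annih n'); apply: eq_Rintegral => z _; rewrite expr0 mulr1.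
  split => // [z|n'].
    have /andP[r0 r1] := r01 z.
    rewrite normrM normrX (@ger0_norm _ (1 - r z)); last by lra.
    apply: mulr_ile1 => //; first by apply: exprn_ge0; lra.
    by apply: exprn_ile1; lra.
  rewrite -[RHS](descent bk wk Hk n').
  by apply: eq_Rintegral => z _; rewrite exprSr mulrA.
have [bk _ Hk] := H i; rewrite -[RHS](Hk n); apply: eqD.
- exact: (iwX _ bv).
- exact: (iwX _ bk).
(* On the half-line [r = S (1 - r)]: the [i] factors [1 - r] gained by the descent and the [i]
   lowest factors [S] combine into [r ^ i]. *)
move=> z Sz; rewrite /v exprD !mulrA; congr (_ * _); rewrite -!mulrA -exprMn.
congr (_ * _ ^+ _); rewrite /r ratioE//; field.
by rewrite gt_eqF// ltr_wpDr.
Qed.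

Let g z := 1 + v z.
Let g0 z : 0 <= g z.
Proof. by have := v1 z; rewrite /g ler_norml; lra. Qed.
Let bg : bmeas g. Proof. by apply: bmeasD => //; exact: bmeas_cst. Qed.
Let mg : measurable_fun setT g. Proof. by case: bg. Qed.

Let density := density_measure P g0 mS mg.

Let densityE (f : R -> R) : measurable_fun setT f -> (forall s, 0 <= f s) ->
  (\int[density]_s (f s)%:E = \int[P]_z (g z * f (S z))%:E)%E.
Proof.
move=> mf f0; rewrite ge0_integral_density//; first by apply/measurable_EFinP.
Qed.

Let densityI A : measurable A -> density A = (\int[P]_z (g z * \1_A (S z)))%:E.
Proof.
move=> mA; transitivity (\int[density]_s (\1_A s)%:E)%E.
  by rewrite integral_indic ?setIT.
rewrite densityE; [|exact: measurable_indic|by move=> s; rewrite indicE].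
apply: fin_integral_bmeas => //; apply: bmeasM => //.
exact: (bmeas_comp mS (bmeas_indic R mA)).
Qed.

Let expectg (f : T -> R) n : (forall z, 0 <= S z -> f z = S z ^+ n) ->
  P.-integrable setT (EFin \o f) ->
  \int[P]_z (g z * f z) = \int[P]_z f z.
Proof.
move=> fE fi.
have gfi : P.-integrable setT (fun z => (g z * f z)%:E).
  case: bg => _ [M gM]; apply: (integrableMr measurableT mg _ fi).
  by exists M; split; [exact: num_real|move=> y My x _ /=; rewrite (le_trans (gM x))// ltW].
transitivity (\int[P]_z (f z + v z * S z ^+ n)).
  apply: eqD => //.
    by have := integrableD measurableT fi (iwX n bv).
  by move=> z Sz; rewrite fE// /g mulrDl mul1r.
by rewrite (RintegralD measurableT fi (iwX n bv)) annihv addr0.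
Qed.

Let density01 : density setT = 1%E /\ density `[0, +oo[%classic = 1%E.
Proof.
have i1 A : measurable A -> P.-integrable setT (EFin \o (fun z => \1_A (S z) : R)).
  by move=> mA; apply: bmeas_integrable => //; exact: (bmeas_comp mS (bmeas_indic R mA)).
have mp : measurable (`[0, +oo[%classic : set R) by [].
split; rewrite densityI//; congr EFin; rewrite (@expectg _ 0)//.
- by under eq_Rintegral do rewrite indicT; rewrite expect_cst.
- by move=> z _; rewrite indicT.
- exact: (i1 _ measurableT).
- rewrite -[RHS](expect_cst PT); apply: eqD.
  + exact: i1.
  + exact: (bmeas_integrable PT (bmeas_cst _ 1)).
  + by move=> z Sz; rewrite indicE mem_set//= in_itv/= Sz.
- by move=> z Sz; rewrite indicE mem_set ?expr0//= in_itv/= Sz.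
- exact: i1.
Qed.

Let densityP A : measurable A -> density A = m A.
Proof.
have [dT d0] := density01.
pose mu : probability R R := HB.pack (density_measure P g0 mS mg)
  (Measure_isProbability.Build _ _ _ (density_measure P g0 mS mg) dT).
have mX n : measurable_fun setT (fun s : R => `|s| ^+ n).
  by apply: measurable_funX; exact: normr_measurable.
have iSa n : P.-integrable setT (EFin \o (fun z => `|S z| ^+ n)).
  have := integrable_abse (iS n); apply: eq_integrable => // z _ /=.
  by rewrite normrX.
have iga n : P.-integrable setT (fun z => (g z * `|S z| ^+ n)%:E).
  case: bg => _ [M gM]; apply: (integrableMr measurableT mg _ (iSa n)).
  by exists M; split; [exact: num_real|move=> y My x _ /=; rewrite (le_trans (gM x))// ltW].
(* The density formula is for nonnegative integrands, whence [|s| ^ n]; it equals [s ^ n] almost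
   everywhere, as the measures are carried by the half-line. *)
have abs_muE n : (\int[mu]_s (`|s| ^+ n)%:E)%E = (\int[P]_z (S z ^+ n))%:E.
  rewrite [LHS](densityE (mX n)); last by move=> s; exact: exprn_ge0.
  rewrite -[LHS]fineK; last by apply: integrable_fin_num; first exact: measurableT.
  congr EFin; transitivity (\int[P]_z (g z * `|S z| ^+ n)) => //.
  rewrite (@expectg _ n)//; last by move=> z Sz; rewrite ger0_norm.
  by apply: eqD (iSa n) (iS n) _ => z Sz; rewrite ger0_norm.
have abs_mE n : (\int[m]_s (`|s| ^+ n)%:E)%E = (\int[P]_z (S z ^+ n))%:E.
  rewrite (ge0_integral_law mS mE); [|exact/measurable_EFinP|
    by move=> s; rewrite lee_fin exprn_ge0].
  rewrite -[LHS]fineK; last exact: (integrable_fin_num measurableT (iSa n)).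
  congr EFin; transitivity (\int[P]_z (`|S z| ^+ n)) => //.
  by apply: eqD (iSa n) (iS n) _ => z Sz; rewrite ger0_norm.
have rm (nu : probability R R) n : nu `[0, +oo[%classic = 1%E ->
    (\int[nu]_s (s ^+ n)%:E = \int[nu]_s (`|s| ^+ n)%:E)%E.
  move=> nu0; apply: ae_eq_integral => //.
  - exact/measurable_EFinP/measurable_funX.
  - exact/measurable_EFinP.
  - exists (~` `[0, +oo[%classic); split.
    + exact: measurableC.
    + have mp : measurable (`[0, +oo[%classic : set R) by [].
      by rewrite [LHS]probability_setC// [X in (_ - X)%E](_ : _ = 1%E)// subee.
    + move=> s /=; apply: contra_not => + _; rewrite in_itv/= andbT => s0.
    by rewrite ger0_norm.
case: m_cond => m0 im mdet; apply: (mdet mu) => //.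
- move=> n; apply/integrableP; split; first exact/measurable_EFinP/measurable_funX.
  under eq_integral do rewrite abse_EFin normrX.
  by rewrite abs_muE ltry.
- by move=> n; rewrite !rm// abs_muE abs_mE.
Qed.

(** Equality of the law under the density [1 + v] with [m] makes [v = W r ^ i] orthogonal to bounded
    functions of [S]. Dividing by [r ^ i] is not bounded near 0; instead [(1 - (1 - r) ^ k) ^ i],
    which is [r ^ i] times a bounded function of [S], tends to 1 where [S > 0], and dominated
    convergence removes it. *)
Lemma annihilator (A : set R) : measurable A -> A `<=` `]0, +oo[%classic ->
  \int[P]_z (W z * \1_A (S z)) = 0.
Proof.
move=> mA A0.
have densX (f : R -> R) : bmeas f -> (forall s, 0 <= f s) ->
    \int[P]_z (v z * f (S z)) = 0.
  move=> bf f0; have bfS : bmeas (f \o S) by exact: bmeas_comp.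
  apply: (addrI (\int[P]_z f (S z))); rewrite addr0 -expectD//; last exact: bmeasM.
  transitivity (\int[P]_z (g z * f (S z))).
    by apply: eq_Rintegral => z _; rewrite /g mulrDl mul1r.
  have mf : measurable_fun setT f by case: bf.
  rewrite -(expect_law mS mE bf) /Rintegral -densityE//.
  by congr fine; apply: eq_measure_integral => B mB _; exact: densityP.
pose h k z : R := \1_A (S z) * (1 - (1 - r z) ^+ k) ^+ i.
have hE k z : h k z * W z = v z * (\1_A (S z) * (\sum_(j < k) (1 - r z) ^+ j) ^+ i).
  rewrite /h /v (_ : 1 - (1 - r z) ^+ k = r z * \sum_(j < k) (1 - r z) ^+ j).
    by rewrite exprMn; ring.
  have := subrX1 (1 - r z) k; rewrite (_ : 1 - r z - 1 = - r z); last by ring.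
  by move=> E; apply: oppr_inj; rewrite opprB E mulNr.
have r1 z : 0 <= 1 - r z <= 1 by have := r01 z; lra.
have h1 k z : `|h k z| <= 1.
  have /andP[a0 a1] := r1 z.
  have b0 : 0 <= (1 - r z) ^+ k by exact: exprn_ge0.
  have b1 : (1 - r z) ^+ k <= 1 by exact: exprn_ile1.
  rewrite /h normrM; apply: mulr_ile1 => //.
    by rewrite indicE; case: (_ \in _); rewrite ?normr1// normr0.
  by rewrite ger0_norm; [apply: exprn_ile1|apply: exprn_ge0]; lra.
have b1A : bmeas (fun z => \1_A (S z) : R) by exact: (bmeas_comp mS (bmeas_indic R mA)).
have bh k : bmeas (h k).
  by apply: bmeasM => //; apply: bmeasX; apply: bmeasB; [exact: bmeas_cst|exact: bmeasX].
have h_cvg z : h k z * W z @[k --> \oo] --> \1_A (S z) * W z.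
  apply: cvgM; last exact: cvg_cst.
  rewrite /h indicE; have [SA|_] := boolP (S z \in A); last first.
    by rewrite mulr0n; under eq_fun do rewrite mul0r; exact: cvg_cst.
  have Sz : 0 < S z by move: SA; rewrite inE => /A0/=; rewrite in_itv/= andbT.
  rewrite mulr1n; under eq_fun do rewrite mul1r.
  have q_cvg : 1 - (1 - r z) ^+ k @[k --> \oo] --> (1 : R).
    rewrite -[X in _ --> X]subr0; apply: cvgB; first exact: cvg_cst.
    apply: cvg_expr; have /andP[a0 a1] := r1 z; rewrite ger0_norm//.
    by rewrite ltrBlDr ltrDl /r ratioE ?ltW// divr_gt0// addr_gt0.
  have := cvg_comp _ _ q_cvg (@exprn_continuous _ i (1 : R)).
  by rewrite expr1n.
have mhW k : measurable_fun setT (fun z => h k z * W z) by have [] := bmeasM (bh k) bW.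
have m1W : measurable_fun setT (fun z => \1_A (S z) * W z) by have [] := bmeasM b1A bW.
have lim_h : \int[P]_z (h k z * W z) @[k --> \oo] --> \int[P]_z (\1_A (S z) * W z).
  by apply: (expect_cvg (M := 1)) => // k z; rewrite normrM mulr_ile1.
have h0 k : \int[P]_z (h k z * W z) = 0.
  under eq_Rintegral do rewrite hE.
  apply: (densX (fun s => \1_A s * (\sum_(j < k) (1 - ratio s) ^+ j) ^+ i)).
    apply: bmeasM; first exact: bmeas_indic.
    apply/bmeasX/(bmeas_sum _ (f := fun j s => (1 - ratio s) ^+ j)) => j.
    by apply/bmeasX/bmeasB; [exact: bmeas_cst|exact: bmeas_ratio].
  move=> s; rewrite indicE mulr_ge0// exprn_ge0// sumr_ge0// => j _.
  by rewrite exprn_ge0//; have /andP[] := ratio01 s; lra.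
have {lim_h} := lim_h; under eq_fun do rewrite h0.
move=> /cvg_unique/(_ (cvg_cst _)) E; rewrite -[RHS]E//.
by apply: eq_Rintegral => z _; rewrite mulrC.
Qed.

End annihilator.

Section integrable_on.
Context d (T : measurableType d) (R : realType) (P : probability T R).
Variables (D : set T) (mD : measurable D) (PD : P D = 1%E).

Let PC : P (~` D) = 0%E.
Proof. by rewrite [LHS]probability_setC// [X in (_ - X)%E](_ : _ = 1%E)// subee. Qed.

Lemma integral_eq_on (f g : T -> \bar R) : measurable_fun setT f ->
  measurable_fun setT g -> (forall z, D z -> f z = g z) ->
  (\int[P]_z f z = \int[P]_z g z)%E.
Proof.
move=> mf mg fg; apply: ae_eq_integral => //; exists (~` D); split => //.
  exact: measurableC.
by move=> z /=; apply: contra_not => Dz _; exact: fg.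
Qed.

Lemma integrable_eq_on (f g : T -> R) : measurable_fun setT f ->
  P.-integrable setT (EFin \o g) -> (forall z, D z -> f z = g z) ->
  P.-integrable setT (EFin \o f).
Proof.
move=> mf /integrableP[mg ig] fg; apply/integrableP; split.
  exact/measurable_EFinP.
rewrite (@integral_eq_on _ (fun z => `|(g z)%:E|%E))//.
- exact/measurableT_comp/measurable_EFinP.
- exact: measurableT_comp.
- by move=> z Dz; rewrite /= fg.
Qed.

Lemma expect_eq_integrable (f g : T -> R) : measurable_fun setT f ->
  measurable_fun setT g -> (forall z, D z -> f z = g z) ->
  \int[P]_z f z = \int[P]_z g z.
Proof.
move=> mf mg fg; rewrite /Rintegral (@integral_eq_on _ (EFin \o g))//.
- exact/measurable_EFinP.
- exact/measurable_EFinP.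
- by move=> z Dz; rewrite fg.
Qed.

End integrable_on.

Section product_moment.
Context d d' (X : measurableType d) (Y : measurableType d') (R : realType).
Variables (m1 : probability X R) (m2 : probability Y R) (f : X -> R) (g : Y -> R).
Hypotheses (fi : m1.-integrable setT (EFin \o f)) (gi : m2.-integrable setT (EFin \o g)).

Let mfg : measurable_fun setT (fun z : X * Y => (f z.1 * g z.2)%:E).
Proof.
case/integrableP: fi => /measurable_EFinP mf _.
case/integrableP: gi => /measurable_EFinP mg _.
apply/measurable_EFinP; apply: measurable_funM; exact: measurableT_comp.
Qed.

Lemma integrable_prod_mul :
  (m1 \x m2)%E.-integrable setT (fun z => (f z.1 * g z.2)%:E).
Proof.
apply/integrableP; split => //.
rewrite fubini_tonelli1//; last exact: measurableT_comp.
case/integrableP: fi => /measurable_EFinP mf fo.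
case/integrableP: gi => /measurable_EFinP mg go.
rewrite (@eq_integral _ _ _ m1 setT
  (fun x => (`|f x|%:E * \int[m2]_y `|(g y)%:E|)%E)); last first.
  move=> x _; rewrite -ge0_integralZl//; last by apply: measurableT_comp => //; exact/measurable_EFinP.
  by apply: eq_integral => y _; rewrite abse_EFin normrM EFinM.
have g0 : (0 <= \int[m2]_y `|(g y)%:E|)%E by exact: integral_ge0.
rewrite ge0_integralZr//; last by apply/measurable_EFinP; exact: measurableT_comp.
by apply: lte_mul_pinfty => //; [exact: integral_ge0|rewrite ge0_fin_numE//; exact: integral_ge0].
Qed.

Lemma expect_prod_mul : \int[(m1 \x m2)%E]_z (f z.1 * g z.2) =
  \int[m1]_x f x * \int[m2]_y g y.
Proof.
rewrite {1}/Rintegral -(integral12_prod_meas1 integrable_prod_mul).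
rewrite -RintegralZr//; congr fine; apply: eq_integral => x _.
rewrite /= -RintegralZl//.
rewrite -[LHS]fineK//.
have := integrableZl measurableT (f x) gi => /(integrable_fin_num measurableT).
by [].
Qed.

End product_moment.

Section splitting_moments.
Context (R : realType).
Notation beta22 := (@beta22 R).

Definition beta_moment (i j : nat) : R := \int[beta22]_e (e ^+ i * (1 - e) ^+ j).

Let m01 : measurable (`[0, 1]%classic : set R). Proof. by []. Qed.

Let ib i j : beta22.-integrable setT (fun e : R => (e ^+ i * (1 - e) ^+ j)%:E).
Proof.
have mf : measurable_fun setT (fun e : R => e ^+ i * (1 - e) ^+ j).
  apply: measurable_funM; first exact: measurable_funX.
  by apply: measurable_funX; exact: measurable_funB.
pose c (e : R) := Num.min 1 (Num.max 0 e).
have c01 e : 0 <= c e <= 1.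
  by rewrite /c le_min ler01 le_max lexx/= ge_min lexx.
have bc : bmeas c.
  split; last by exists 1 => e; have /andP[a b] := c01 e; rewrite ger0_norm.
  by apply: measurable_minr => //; exact: measurable_maxr.
have bg : bmeas (fun e => c e ^+ i * (1 - c e) ^+ j).
  by apply: bmeasM; apply: bmeasX => //; apply: bmeasB => //; exact: bmeas_cst.
apply: (integrable_eq_on m01 (@beta2201 R) mf
  (bmeas_integrable (probability_setT beta22) bg)) => e /=.
by rewrite in_itv/= => /andP[e0 e1]; rewrite /c max_r// min_r.
Qed.

Lemma beta_moment01 i j : 0 <= beta_moment i j <= 1.
Proof.
have bT := probability_setT beta22; have ic c := bmeas_integrable bT (bmeas_cst _ c).
rewrite -{1}(expect_cst bT 0) -[X in _ && (_ <= X)](expect_cst bT 1).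
apply/andP; split; apply: (expect_le_integrable m01 (@beta2201 R)) => //; try exact: ib;
  move=> e /=; rewrite in_itv/= => /andP[e0 e1].
- by rewrite mulr_ge0// exprn_ge0// subr_ge0.
- by rewrite mulr_ile1 ?exprn_ge0 ?exprn_ile1 ?subr_ge0// gerBl.
Qed.

Variable m : probability R R.
Hypothesis im : finite_moments1 m.

Let iprod i j n : (m \x beta22)%E.-integrable setT
  (fun w : R * R => (w.1 ^+ (i + j + n) * (w.2 ^+ i * (1 - w.2) ^+ j))%:E).
Proof. exact: (integrable_prod_mul (im (i + j + n)) (ib i j)). Qed.

Let splitE i j n : (fun z : R * R => (z.1 ^+ i * z.2 ^+ j * (z.1 + z.2) ^+ n)%:E)
    \o @split_pair R =
  (fun w : R * R => (w.1 ^+ (i + j + n) * (w.2 ^+ i * (1 - w.2) ^+ j))%:E).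
Proof.
apply/funext => -[s e]; rewrite /= /split_pair /split_state/=.
rewrite (_ : s * e + s * (1 - e) = s); last by ring.
by rewrite !exprMn !exprD; congr EFin; ring.
Qed.

Let mmon i j n :
  measurable_fun setT (fun z : R * R => (z.1 ^+ i * z.2 ^+ j * (z.1 + z.2) ^+ n)%:E).
Proof.
apply/measurable_EFinP; apply: measurable_funM; last first.
  by apply: measurable_funX; exact: measurable_plane_sum.
by apply: measurable_funM; apply: measurable_funX.
Qed.

(** The power of the sum is carried along because the orthogonality relations come from the moments
    of [x ^ i (x + y) ^ n]; it separates from the fraction since [s e + s (1 - e) = s]. *)
Lemma splitting_moment i j n :
  (\int[splitting m]_z (z.1 ^+ i * z.2 ^+ j * (z.1 + z.2) ^+ n)%:E =
  (beta_moment i j * \int[m]_s (s ^+ (i + j + n)))%:E)%E.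
Proof.
rewrite integral_distribution//; last by rewrite splitE; exact: iprod.
rewrite splitE -[LHS]fineK; last exact: (integrable_fin_num measurableT (iprod i j n)).
congr EFin; rewrite mulrC.
exact: (expect_prod_mul (im (i + j + n)) (ib i j)).
Qed.

Lemma splitting_finite_moments : finite_moments2 (splitting m).
Proof.
move=> i j; have := mmon i j 0; have := splitE i j 0.
under eq_fun do rewrite expr0 mulr1.
move=> E mf; apply: integrable_pushforward; rewrite // E; exact: iprod.
Qed.

End splitting_moments.

(** * Determinacy of the split laws *)

Section hausdorff.
Context (R : realType).

(** The geometric sum [(1 - t ^ n) / (1 - t)] has [n] terms, each at least [t ^ n]. *)
Lemma natmul_expr_le (t : R) n : 0 <= t -> t <= 1 ->
  n%:R * t ^+ n * (1 - t) <= 1 - t ^+ n.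
Proof.
move=> t0 t1; elim: n => [|n IH]; first by rewrite !mul0r expr0 subrr.
have h0 : 0 <= t ^+ n by exact: exprn_ge0.
have h1 : t ^+ n <= 1 by exact: exprn_ile1.
have := ler_wpM2l t0 IH.
have : 0 <= (1 - t) * (1 - t * t ^+ n).
  by rewrite mulr_ge0 ?subr_ge0// mulr_ile1.
rewrite -natr1 exprS; lra.
Qed.

(** Write [q = t r] with [r] midway between [q] and 1: [n t ^ n] stays below [1 / (1 - t)], and
    [r ^ n] tends to 0. *)
Lemma cvg_natmul_expr (q : R) : 0 <= q < 1 -> n%:R * q ^+ n @[n --> \oo] --> (0 : R).
Proof.
move=> /andP[q0 q1]; pose r := (1 + q) / 2; pose t := q / r.
have r0 : 0 < r by rewrite /r; lra.
have r1 : r < 1 by rewrite /r; lra.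
have t0 : 0 <= t by rewrite divr_ge0// ltW.
have t1 : t < 1 by rewrite ltr_pdivrMr// mul1r /r; lra.
have t1' : 0 < 1 - t by rewrite subr_gt0.
apply: (@squeeze_cvgr _ _ _ _ (fun=> 0) (fun n => (1 - t)^-1 * r ^+ n)).
- apply: nearW => n; rewrite mulr_ge0 ?exprn_ge0//=.
  have -> : q ^+ n = t ^+ n * r ^+ n by rewrite -exprMn divfK// gt_eqF.
  rewrite mulrA ler_pM2r ?exprn_gt0//.
  rewrite -(ler_pM2r t1') mulVf ?gt_eqF//; apply: (le_trans (natmul_expr_le n t0 (ltW t1))).
  by rewrite gerBl exprn_ge0.
- exact: cvg_cst.
- rewrite -(mulr0 (1 - t)^-1); apply: cvgM; first exact: cvg_cst.
  by apply: cvg_expr; rewrite ger0_norm// ltW.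
Qed.

Lemma bernoulli_le (y : R) N : 0 <= y -> y <= 1 -> 1 - (1 - y) ^+ N <= N%:R * y.
Proof.
move=> y0 y1; elim: N => [|N IH]; first by rewrite expr0 mul0r subrr.
have h0 : 0 <= (1 - y) ^+ N by rewrite exprn_ge0// subr_ge0.
have h1 : (1 - y) ^+ N <= 1 by rewrite exprn_ile1 ?subr_ge0// gerBl.
rewrite exprS -natr1; set w := (1 - y) ^+ N in IH h0 h1 *; nra.
Qed.

(** The counterpart of Bernoulli's inequality; each factor is absorbed by
    [(1 - y) (1 + (N + 1) y) <= 1 + N y]. *)
Lemma expr_onem_le (y : R) N : 0 <= y -> y <= 1 -> (1 - y) ^+ N * (1 + N%:R * y) <= 1.
Proof.
move=> y0 y1; elim: N => [|N IH]; first by rewrite expr0 mul0r addr0 mulr1.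
have h0 : 0 <= (1 - y) ^+ N by rewrite exprn_ge0// subr_ge0.
have N0 : 0 <= N%:R :> R by [].
apply: le_trans IH; rewrite exprS -natr1.
set w := (1 - y) ^+ N in h0 *; set k := N%:R in N0 *.
rewrite mulrAC [leRHS]mulrC; apply: ler_wpM2r => //.
by rewrite -subr_ge0 (_ : _ - _ = (1 + k) * y ^+ 2);
  [rewrite mulr_ge0 ?sqr_ge0// addr_ge0|ring].
Qed.

(* With [N n] close to [n a^-n], [N n * x^n] tends to 0 for [x < a] and to
   infinity for [a <= x <= 1]. *)
Lemma indicator_approx (a : R) : exists u : nat -> {poly R},
  forall x : R, 0 <= x <= 1 ->
    (forall n, 0 <= (u n).[x] <= 1) /\ ((u n).[x] : R) @[n --> \oo] --> ((x < a)%R%:R : R).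
Proof.
have [a0|a0] := leP a 0.
  exists (fun=> 0) => x /andP[x0 x1]; rewrite ltNge (le_trans a0 x0)/=.
  by split=> [n|]; [rewrite horner0 lexx ler01|under eq_fun do rewrite horner0; exact: cvg_cst].
have [a1|a1] := ltP 1 a.
  exists (fun=> 1) => x /andP[x0 x1]; rewrite (le_lt_trans x1 a1)/=.
  by split=> [n|]; [rewrite hornerC lexx ler01|under eq_fun do rewrite hornerC; exact: cvg_cst].
(* Rounded up, [N n] lies between [n a ^- n] and twice that, as [a ^- n >= 1]; the lower bound is
   for [x >= a], the upper one for [x < a]. *)
pose N n := (n * (Num.truncn (a ^- n)).+1)%N.
exists (fun n => (1 - 'X^n) ^+ N n) => x /andP[x0 x1].
have uE n : ((1 - 'X^n) ^+ N n).[x] = (1 - x ^+ n) ^+ N n.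
  by rewrite horner_exp !hornerE.
have y0 n : 0 <= x ^+ n by exact: exprn_ge0.
have y1 n : x ^+ n <= 1 by exact: exprn_ile1.
have an n : 0 < a ^+ n by exact: exprn_gt0.
have u01 n : 0 <= (1 - x ^+ n) ^+ N n <= 1.
  by rewrite exprn_ge0 ?subr_ge0// exprn_ile1 ?subr_ge0// gerBl.
split=> [n|]; first by rewrite uE.
have [xa|ax] := ltP x a.
- rewrite mulr1n; suff u0 : 1 - (1 - x ^+ n) ^+ N n @[n --> \oo] --> (0 : R).
    rewrite -[X in _ --> X]subr0.
    rewrite (_ : (fun n => _) = (fun n => 1 - (1 - (1 - x ^+ n) ^+ N n))).
      by apply: cvgB => //; exact: cvg_cst.
    by apply/funext => n; rewrite uE subKr.
  pose q := x / a.
  have q01 : 0 <= q < 1 by rewrite divr_ge0 ?(ltW a0)//= ltr_pdivrMr// mul1r.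
  apply: (@squeeze_cvgr _ _ _ _ (fun=> 0) (fun n => 2 * (n%:R * q ^+ n))).
  + apply: nearW => n; have /andP[u0 u1] := u01 n; rewrite subr_ge0 u1/=.
    apply: (le_trans (bernoulli_le _ (y0 n) (y1 n))).
    rewrite /N natrM -mulrA [leRHS]mulrCA; apply: ler_wpM2l => //.
    have -> : 2 * q ^+ n = (2 * a ^- n) * x ^+ n by rewrite /q expr_div_n; ring.
    apply: ler_wpM2r => //; rewrite -natr1.
    have t : (Num.truncn (a ^- n))%:R <= a ^- n.
      by rewrite truncn_le invr_ge0 ltW.
    have i1 : 1 <= a ^- n by rewrite invf_ge1// exprn_ile1// ltW.
    lra.
  + exact: cvg_cst.
  + by rewrite -(mulr0 2); apply: cvgM; [exact: cvg_cst|exact: cvg_natmul_expr].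
- rewrite mulr0n; apply: (@squeeze_cvgr _ _ _ _ (fun=> 0) harmonic).
  + apply: nearW => n; rewrite uE; have /andP[u0 u1] := u01 n; rewrite u0/= /harmonic/=.
    have n0 : 0 < n.+1%:R :> R by [].
    rewrite -(ler_pM2r n0) mulVf ?gt_eqF//.
    apply: le_trans (expr_onem_le (N n) (y0 n) (y1 n)); apply: ler_wpM2l => //.
    rewrite -natr1 addrC lerD2l /N natrM -mulrA ler_peMr//.
    apply: (@le_trans _ _ (a ^- n * a ^+ n)); first by rewrite mulVf// gt_eqF.
    apply: ler_pM; rewrite ?invr_ge0 ?(ltW (an n))//.
      by apply/ltW; rewrite truncnS_gt.
    by apply: lerXn2r => //; rewrite nnegrE// ltW.
  + exact: cvg_cst.
  + exact: cvg_harmonic.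
Qed.

End hausdorff.

Lemma measure_rays_unique (R : realType) (m1 m2 : {measure set R -> \bar R}) :
  (m1 setT < +oo)%E -> (forall a, m1 `]-oo, a[%classic = m2 `]-oo, a[%classic) ->
  forall A, measurable A -> m1 A = m2 A.
Proof.
move=> m1T m12; apply: (@measure_unique _ _ _ (@RGenInftyO.G R)
    (fun n => `]-oo, n%:R[%classic)).
- exact: RGenInftyO.measurableE.
- move=> _ _ [a ->] [b ->]; exists (Num.min a b).
  by apply/seteqP; split => x /=; rewrite !in_itv/= lt_min => /andP.
- by move=> n; exists n%:R.
- apply/seteqP; split => // x _; exists (Num.truncn x).+1 => //=.
  by rewrite in_itv/= truncnS_gt.
- by move=> _ [a ->].
- move=> n; apply: le_lt_trans m1T; apply: le_measure; rewrite ?inE//.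
Qed.

Section hausdorff_expect.
Context d (T : measurableType d) (R : realType) (P : probability T R).
Variables q V : T -> R.
Hypotheses (bq : bmeas q) (bV : bmeas V) (q01 : forall z, 0 <= q z <= 1).

Let PT : P setT = 1%E. Proof. exact: probability_setT. Qed.

Lemma expect_sum n (f : nat -> T -> R) : (forall j, bmeas (f j)) ->
  \int[P]_z (\sum_(j < n) f j z) = \sum_(j < n) \int[P]_z f j z.
Proof.
move=> bf; elim: n => [|n IH].
  by under eq_Rintegral do rewrite big_ord0; rewrite big_ord0 expect_cst.
under eq_Rintegral do rewrite big_ord_recr/=.
by rewrite expectD// ?IH ?big_ord_recr//; exact: bmeas_sum.
Qed.

Lemma expect_horner (u : {poly R}) : \int[P]_z (u.[q z] * V z) =
  \sum_(j < size u) u`_j * \int[P]_z (q z ^+ j * V z).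
Proof.
have b j : bmeas (fun z => q z ^+ j * V z) by apply: bmeasM => //; exact: bmeasX.
under [RHS]eq_bigr do rewrite -(expectZ PT _ (b _)).
rewrite -(expect_sum _ (f := fun j z => u`_j * (q z ^+ j * V z))); last first.
  by move=> j; exact: bmeasZ.
apply: eq_Rintegral => z _; rewrite horner_coef mulr_suml.
by apply: eq_bigr => j _; rewrite mulrA.
Qed.

Lemma expect_ray_cvg (a : R) (u : nat -> {poly R}) :
  (forall x : R, 0 <= x <= 1 -> (forall n, 0 <= (u n).[x] <= 1) /\
     ((u n).[x] : R) @[n --> \oo] --> ((x < a)%R%:R : R)) ->
  \int[P]_z ((u n).[q z] * V z) @[n --> \oo] -->
  \int[P]_z (\1_(`]-oo, a[%classic) (q z) * V z).
Proof.
move=> ua; have [mV [M VM]] := bV.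
have mq : measurable_fun setT q by case: bq.
apply: (expect_cvg (M := M)).
- move=> n; apply: measurable_funM => //; under eq_fun do rewrite horner_coef.
  have [] // := bmeas_sum (size (u n)) (f := fun j z => (u n)`_j * q z ^+ j).
  by move=> j; apply/bmeasZ/bmeasX.
- by apply: measurable_funM => //; apply: measurableT_comp => //; exact: measurable_indic.
- move=> n z; have [/(_ n)/andP[u0 u1] _] := ua _ (q01 z).
  rewrite normrM (ger0_norm u0) -[M]mul1r; apply: ler_pM => //.
- move=> z; apply: cvgM; last exact: cvg_cst.
  have [_] := ua _ (q01 z); rewrite indicE.
  suff -> : (q z \in `]-oo, a[%classic) = (q z < a) by [].
  by rewrite mem_setE in_itv.
Qed.

End hausdorff_expect.

(** The bounded polynomial approximation of a ray passes to the limit under the integrals. The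
    weights [V] and [V'] take the place of conditioning: with the indicator of an event as weight,
    the law of [q] on that event is compared without normalization. *)
Lemma hausdorff_expect d d' (T : measurableType d) (T' : measurableType d')
    (R : realType) (P : probability T R) (P' : probability T' R)
    (q V : T -> R) (q' V' : T' -> R) :
  bmeas q -> bmeas V -> (forall z, 0 <= q z <= 1) ->
  bmeas q' -> bmeas V' -> (forall z, 0 <= q' z <= 1) ->
  (forall i, \int[P]_z (q z ^+ i * V z) = \int[P']_z (q' z ^+ i * V' z)) ->
  forall a, \int[P]_z (\1_(`]-oo, a[%classic) (q z) * V z) =
            \int[P']_z (\1_(`]-oo, a[%classic) (q' z) * V' z).
Proof.
move=> bq bV q01 bq' bV' q01' E a; have [u ua] := indicator_approx a.
have h := expect_ray_cvg (P := P) bq bV q01 ua.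
have h' := expect_ray_cvg (P := P') bq' bV' q01' ua.
have uE : (fun n => \int[P]_z ((u n).[q z] * V z)) =
    (fun n => \int[P']_z ((u n).[q' z] * V' z)).
  by apply/funext => n; rewrite !expect_horner//; apply: eq_bigr => j _; rewrite E.
by rewrite uE in h; exact: (cvg_unique _ h h').
Qed.

Section mixed_moments.
Context (R : realType).

Lemma integrable_mixed_moment (mu : probability (R * R)%type R) i j n :
  finite_moments2 mu ->
  mu.-integrable setT (fun z => (z.1 ^+ i * z.2 ^+ j * (z.1 + z.2) ^+ n)%:E).
Proof.
move=> im; elim: n i j => [|n IH] i j.
  by under eq_fun do rewrite expr0 mulr1; exact: im.
have := integrableD measurableT (IH i.+1 j) (IH i j.+1).
apply: eq_integrable => // -[x y] _ /=.
by rewrite -EFinD; congr EFin; rewrite !exprS; ring.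
Qed.

Lemma eq_mixed_moment (mu nu : probability (R * R)%type R) i j n :
  finite_moments2 mu -> finite_moments2 nu ->
  (forall i j : nat, (\int[nu]_z (z.1 ^+ i * z.2 ^+ j)%:E =
                      \int[mu]_z (z.1 ^+ i * z.2 ^+ j)%:E)%E) ->
  (\int[nu]_z (z.1 ^+ i * z.2 ^+ j * (z.1 + z.2) ^+ n)%:E =
   \int[mu]_z (z.1 ^+ i * z.2 ^+ j * (z.1 + z.2) ^+ n)%:E)%E.
Proof.
move=> im im' E; elim: n i j => [|n IH] i j.
  by under eq_integral do rewrite expr0 mulr1; under [RHS]eq_integral do rewrite expr0 mulr1.
have D (m : probability (R * R)%type R) : finite_moments2 m ->
  (\int[m]_z (z.1 ^+ i * z.2 ^+ j * (z.1 + z.2) ^+ n.+1)%:E =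
   \int[m]_z (z.1 ^+ i.+1 * z.2 ^+ j * (z.1 + z.2) ^+ n)%:E +
   \int[m]_z (z.1 ^+ i * z.2 ^+ j.+1 * (z.1 + z.2) ^+ n)%:E)%E.
  move=> fm; rewrite -integralD//; try exact: integrable_mixed_moment.
  apply: eq_integral => -[x y] _ /=.
  by rewrite -EFinD; congr EFin; rewrite !exprS; ring.
by rewrite !D// !IH.
Qed.

End mixed_moments.

Lemma splitting_ext (R : realType) (m m' : probability R R) :
  (forall A, measurable A -> m A = m' A) ->
  forall A, measurable A -> splitting m A = splitting m' A.
Proof.
move=> mm' A mA; have bA := bmeas_indic R mA.
rewrite -(expect_indic (probability_setT (splitting m)) mA).
rewrite -(expect_indic (probability_setT (splitting m')) mA).
by congr EFin; rewrite !expect_splitting//; exact: eq_measure_expect.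
Qed.

Section unit_clip.
Context (R : realType).

Definition clip (e : R) : R := Num.min 1 (Num.max 0 e).

Lemma clip01 e : 0 <= clip e <= 1.
Proof. by rewrite /clip le_min ler01 le_max lexx/= ge_min lexx. Qed.

Lemma clipE e : 0 <= e <= 1 -> clip e = e.
Proof. by move=> /andP[e0 e1]; rewrite /clip max_r// min_r. Qed.

Lemma bmeas_clip : bmeas clip.
Proof.
split; last by exists 1 => e; have /andP[a b] := clip01 e; rewrite ger0_norm.
by apply: measurable_minr => //; exact: measurable_maxr.
Qed.

End unit_clip.

Section splitting_determinate.
Context (R : realType) (m : probability R R) (nu : probability (R * R)%type R).
Hypotheses (m_cond : finite_moments_condition m) (nuQ : nu (@quadrant R) = 1%E).
Hypothesis nu_fin : finite_moments2 nu.
Hypothesis nuE : forall i j : nat, (\int[nu]_z (z.1 ^+ i * z.2 ^+ j)%:E =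
  \int[splitting m]_z (z.1 ^+ i * z.2 ^+ j)%:E)%E.
Notation beta22 := (@beta22 R).

Let mQ : measurable (@quadrant R). Proof. exact: measurable_quadrant. Qed.
Let m01 : measurable (`[0, 1]%classic : set R). Proof. by []. Qed.
Let nuT : nu setT = 1%E. Proof. exact: probability_setT. Qed.
Let bT : beta22 setT = 1%E. Proof. exact: probability_setT. Qed.
Let im : finite_moments1 m. Proof. by case: m_cond. Qed.
Let S (z : R * R) : R := z.1 + z.2.
Let mS : measurable_fun setT S. Proof. exact: measurable_plane_sum. Qed.
Let B i := beta_moment R i 0.

Let moment i n : (\int[nu]_z (z.1 ^+ i * S z ^+ n)%:E =
  (B i * \int[m]_s (s ^+ (i + n)))%:E)%E.
Proof.
have := @eq_mixed_moment _ _ _ i 0 n (splitting_finite_moments im) nu_fin nuE.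
rewrite splitting_moment// addn0 => <-.
by apply: eq_integral => z _; rewrite expr0 mulr1.
Qed.

Let imoment i n : nu.-integrable setT (fun z => (z.1 ^+ i * S z ^+ n)%:E).
Proof.
have := integrable_mixed_moment i 0 n nu_fin; apply: eq_integrable => // z _.
by rewrite expr0 mulr1.
Qed.

Let B0 : B 0 = 1.
Proof.
rewrite /B /beta_moment; under eq_Rintegral do rewrite !expr0 mulr1.
exact: expect_cst.
Qed.

Let iS n : nu.-integrable setT (fun z => (S z ^+ n)%:E).
Proof.
have := imoment 0 n; apply: eq_integrable => // z _.
by rewrite expr0 mul1r.
Qed.

Let ES n : (\int[nu]_z (S z ^+ n)%:E)%E = (\int[m]_s (s ^+ n))%:E.
Proof.
have := moment 0 n; rewrite B0 mul1r => <-.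
by apply: eq_integral => z _; rewrite expr0 mul1r.
Qed.

Let S0 : nu (S @^-1` `[0, +oo[%classic) = 1%E.
Proof.
have mI : measurable (S @^-1` `[0, +oo[%classic) by rewrite -[_ @^-1` _]setTI; exact: mS.
apply/eqP; rewrite eq_le probability_le1//= -nuQ; apply: le_measure; rewrite ?inE//.
by move=> z [z1 z2] /=; rewrite in_itv/= andbT addr_ge0.
Qed.

Let mE (A : set R) : measurable A -> m A = nu (S @^-1` A).
Proof.
move=> mA; pose S_ : {RV nu >-> R} := HB.pack S (isMeasurableFun.Build _ _ _ _ _ mS).
case: m_cond => _ _ mdet; rewrite -(mdet (distribution nu S_))//.
- move=> n; apply: integrable_pushforward; [exact: mS|exact/measurable_EFinP/measurable_funX|exact: iS|by []].
- move=> n; have E : (\int[distribution nu S_]_s (s ^+ n)%:E = \int[nu]_z (S z ^+ n)%:E)%E.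
    rewrite integral_distribution; [by []|exact/measurable_EFinP/measurable_funX|exact: iS].
  rewrite E ES; apply: fineK; exact: (integrable_fin_num measurableT (im n)).
Qed.

(** The quotient is written with a real power, measurable in [S z] on the whole line, and clipped so
    that it stays in [[0, 1]] outside the quadrant too; at the origin it is 0. *)
Let p (z : R * R) : R := clip (z.1 * (S z) `^ (-1)).
Let bp : bmeas p.
Proof.
apply: (bmeas_comp _ (@bmeas_clip R)); apply: measurable_funM => //.
exact: (measurableT_comp (measurable_powR _) mS).
Qed.
Let p01 z : 0 <= p z <= 1. Proof. exact: clip01. Qed.

Let Sp z : quadrant z -> S z * p z = z.1.
Proof.
case: z => x y [/= x0 y0]; rewrite /p /S/=.
have := addr_ge0 x0 y0; rewrite le_eqVlt => /predU1P[s0|s0].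
  by rewrite -s0 mul0r; apply/esym/eqP; rewrite eq_le x0 andbT s0 lerDl.
rewrite powR_inv1 ?ltW// clipE; last first.
  by rewrite divr_ge0 ?(ltW s0)//= ler_pdivrMr// mul1r lerDl.
by rewrite mulrC divfK// gt_eqF.
Qed.

Let B01 i : 0 <= B i <= 1. Proof. exact: beta_moment01. Qed.

Let bpi i : bmeas (fun z => p z ^+ i). Proof. exact: bmeasX. Qed.

Let bSA (A : set R) : measurable A -> bmeas (fun z => \1_A (S z) : R).
Proof. by move=> mA; exact: (bmeas_comp mS (bmeas_indic R mA)). Qed.

(** On the quadrant [p ^ i S ^ i = x ^ i], so the known moments give relations for [W] from degree
    [i] on, and [annihilator] turns them into this. At the origin [p] is a mere convention, whence
    the restriction to positive sums. *)
Let fraction_moment i (A : set R) : measurable A -> A `<=` `]0, +oo[%classic ->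
  \int[nu]_z (p z ^+ i * \1_A (S z)) = B i * \int[nu]_z \1_A (S z).
Proof.
move=> mA A0; pose W z := p z ^+ i - B i.
have bW : bmeas W by apply: bmeasB => //; exact: bmeas_cst.
have W1 z : `|W z| <= 1.
  have /andP[b0 b1] := B01 i; have /andP[p0 p1] := p01 z.
  have h0 : 0 <= p z ^+ i by exact: exprn_ge0.
  have h1 : p z ^+ i <= 1 by exact: exprn_ile1.
  by rewrite /W ler_norml; lra.
have annih n : \int[nu]_z (W z * S z ^+ (i + n)) = 0.
  have E : \int[nu]_z (z.1 ^+ i * S z ^+ n) = B i * \int[m]_s (s ^+ (i + n)).
    by rewrite /Rintegral moment.
  have E' : \int[nu]_z (S z ^+ (i + n)) = \int[m]_s (s ^+ (i + n)).
    by rewrite {1}/Rintegral ES.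
  have iBS : nu.-integrable setT (fun z => (B i * S z ^+ (i + n))%:E).
    by have := integrableZl measurableT (B i) (iS (i + n)).
  transitivity (\int[nu]_z (z.1 ^+ i * S z ^+ n - B i * S z ^+ (i + n))); last first.
    rewrite (RintegralB measurableT (imoment i n) iBS).
    by rewrite (RintegralZl _ measurableT (iS (i + n))) E E' subrr.
  have mSX k : measurable_fun setT (fun z => S z ^+ k) by exact: measurable_funX.
  apply: (expect_eq_integrable mQ nuQ).
  - by apply: measurable_funM => //; case: bW.
  - apply: measurable_funB; apply: measurable_funM => //.
    exact: measurable_funX.
  - move=> z Qz; rewrite /W mulrBl; congr (_ - _).
    by rewrite exprD mulrA -exprMn [p z * _]mulrC Sp.
have := annihilator mS S0 iS m_cond mE (proj1 bW) W1 annih mA A0.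
rewrite (_ : (fun z => _) = (fun z => p z ^+ i * \1_A (S z) - B i * \1_A (S z))); last first.
  by apply/funext => z; rewrite /W mulrBl.
rewrite expectB//; last 2 first.
- by apply: bmeasM => //; exact: bSA.
- by apply: bmeasZ; exact: bSA.
by rewrite expectZ//; [move/eqP; rewrite subr_eq0 => /eqP|exact: bSA].
Qed.

Notation PP := (nu \x beta22)%E.
Let S1 (w : (R * R) * R) : R := S w.1.
(** Where the sum vanishes, [p] does not have the right law; an independent Beta(2,2) variable is
    put in its place. This leaves the split state at the origin and makes [q] independent of [S1]
    even if 0 is an atom of [m]. *)
Let q (w : (R * R) * R) : R := if 0 < S1 w then p w.1 else clip w.2.

Let mS1 : measurable_fun setT S1.
Proof. by apply: measurableT_comp => //; exact: mS. Qed.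

Let q01 w : 0 <= q w <= 1.
Proof. by rewrite /q; case: ifP => _; exact: clip01. Qed.

Let Pos : set R := `]0, +oo[%classic.
Let mPos : measurable Pos. Proof. exact: measurable_itv. Qed.
Let PosE s : (s \in Pos) = (0 < s).
Proof. by rewrite mem_setE in_itv/= andbT. Qed.

Let bS1 (A : set R) : measurable A -> bmeas (fun w => \1_A (S1 w) : R).
Proof. by move=> mA; exact: (bmeas_comp mS1 (bmeas_indic R mA)). Qed.

Let bq : bmeas q.
Proof.
rewrite (_ : q = fun w => \1_Pos (S1 w) * p w.1 + (1 - \1_Pos (S1 w)) * clip w.2).
  have b1 := bS1 mPos; have b11 : bmeas (fun w => 1 - \1_Pos (S1 w) : R).
    by apply: bmeasB => //; exact: bmeas_cst.
  apply: bmeasD; apply: bmeasM => //.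
    exact: (bmeas_comp _ bp).
  exact: (bmeas_comp _ (@bmeas_clip R)).
apply/funext => w; rewrite /q indicE PosE; case: ifP => _.
  by rewrite subrr mul0r addr0 mul1r.
by rewrite subr0 mul0r add0r mul1r.
Qed.

Let Bclip i : \int[beta22]_e (clip e ^+ i) = B i.
Proof.
have bc : bmeas (fun e : R => clip e ^+ i) by exact/bmeasX/bmeas_clip.
apply: (expect_eq_integrable m01 (@beta2201 R)).
- by case: bc.
- by apply: measurable_funM; [exact: measurable_funX|exact/measurable_funX/measurable_funB].
- by move=> e /=; rewrite in_itv/= => e01; rewrite clipE// expr0 mulr1.
Qed.

(** On positive sums this is [fraction_moment]; on the rest the inserted variable is independent of
    [nu]. Both yield the same constant [B i]. *)
Let joint_moment i (A : set R) : measurable A ->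
  \int[PP]_w (q w ^+ i * \1_A (S1 w)) = B i * \int[nu]_z \1_A (S z).
Proof.
move=> mA; pose A1 := A `&` Pos; pose A2 := A `\` Pos.
have mA1 : measurable A1 by exact: measurableI.
have mA2 : measurable A2 by exact: measurableD.
have bc : bmeas (fun e : R => clip e ^+ i) by exact/bmeasX/bmeas_clip.
have bpA : bmeas (fun z => p z ^+ i * \1_A1 (S z)) by apply: bmeasM => //; exact: bSA.
have b1 : bmeas (fun _ : R => 1 : R) by exact: bmeas_cst.
have [ipA i2] := (bmeas_integrable nuT bpA, bmeas_integrable nuT (bSA mA2)).
have [ic i1] := (bmeas_integrable bT bc, bmeas_integrable bT b1).
transitivity (\int[PP]_w ((p w.1 ^+ i * \1_A1 (S w.1)) * 1 + \1_A2 (S w.1) * clip w.2 ^+ i)).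
  apply: eq_Rintegral => w _; rewrite /q !indicE in_setI in_setD PosE.
  by rewrite /S1; case: ifP => _; case: (_ \in A);
    rewrite /= ?(mulr0, mulr1, mul0r, addr0, mul1r, add0r).
rewrite (RintegralD measurableT (integrable_prod_mul ipA i1) (integrable_prod_mul i2 ic)).
rewrite (expect_prod_mul ipA i1) (expect_prod_mul i2 ic) expect_cst// mulr1 Bclip.
rewrite fraction_moment//; last by move=> s [].
rewrite [X in _ + X]mulrC -mulrDr -expectD//; [|exact: bSA|exact: bSA].
congr (_ * _); apply: eq_Rintegral => z _.
rewrite !indicE in_setI in_setD PosE.
by case: (_ \in A); case: (_ < _); rewrite /= ?addr0 ?add0r.
Qed.

(** For fixed [A] both sides are finite measures in [C]; [hausdorff_expect], with the indicator of
    [A] at [S1] against the constant weight [c], shows that they agree on rays. *)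
Let joint_law (A C : set R) : measurable A -> measurable C ->
  PP (q @^-1` C `&` S1 @^-1` A) = (nu (S @^-1` A) * beta22 C)%E.
Proof.
move=> mA; have mq : measurable_fun setT q by case: bq.
have mSA : measurable (S1 @^-1` A) by rewrite -[_ @^-1` _]setTI; exact: mS1.
have mSA' : measurable (S @^-1` A) by rewrite -[_ @^-1` _]setTI; exact: mS.
pose c := \int[nu]_z \1_A (S z).
have c0 : 0 <= c by apply: Rintegral_ge0 => z _; rewrite indicE.
have nuA : nu (S @^-1` A) = c%:E by rewrite -(expect_indic nuT mSA').
pose m1 := image_measure (mrestr PP mSA) mq.
pose m2 : {measure set R -> \bar R} := mscale (NngNum c0) beta22.
suff E B' : measurable B' -> m1 B' = m2 B'.
  by move=> mC; rewrite nuA; exact: E.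
apply: measure_rays_unique.
  rewrite /m1/= /pushforward/= /mrestr; apply: (@le_lt_trans _ _ 1%E); last exact: ltry.
  by apply: probability_le1; apply: measurableI => //; rewrite preimage_setT.
move=> a; have ma : measurable (`]-oo, a[%classic : set R) by [].
have mqa : measurable (q @^-1` `]-oo, a[%classic).
  by rewrite -[_ @^-1` _]setTI; exact: (mq measurableT _ ma).
have mm := measurableI _ _ mqa mSA.
have PPT : PP setT = 1%E by exact: probability_setT.
have bc : bmeas (fun _ : R => c) by exact: bmeas_cst.
have H := hausdorff_expect (P := PP) (P' := beta22) (V := fun w => \1_A (S1 w)) (V' := fun=> c)
  bq (bS1 mA) q01 (@bmeas_clip R) bc (@clip01 R).
have {}H := H _ a.
transitivity ((\int[PP]_w (\1_(`]-oo, a[%classic) (q w) * \1_A (S1 w)))%:E).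
  rewrite /m1/= /pushforward/= /mrestr -(expect_indic PPT mm); congr EFin.
  by apply: eq_Rintegral => w _; rewrite !indicE in_setI -natrM mulnb.
rewrite H; last first.
  move=> i; rewrite joint_moment//.
  rewrite (_ : (fun e => _) = (fun e : R => c * clip e ^+ i)); last first.
    by apply/funext => e; rewrite mulrC.
  by rewrite expectZ// ?Bclip 1?mulrC//; exact/bmeasX/bmeas_clip.
rewrite /m2/= /mscale/= -(expect_indic bT ma) -EFinM; congr EFin.
have b1 := bmeas_indic R ma.
rewrite -expectZ//; apply: (expect_eq_on bT m01 (@beta2201 R)).
- by apply: bmeasM => //; exact: (bmeas_comp (proj1 (@bmeas_clip R)) b1).
- exact: bmeasZ.
- by move=> e /=; rewrite in_itv/= => e01; rewrite clipE// mulrC.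
Qed.

Let S1_law (A : set R) : measurable A -> PP (S1 @^-1` A) = m A.
Proof.
move=> mA; have := joint_law mA measurableT.
by rewrite preimage_setT setTI bT mule1 -mE.
Qed.

Let q_law (C : set R) : measurable C -> PP (q @^-1` C) = beta22 C.
Proof.
move=> mC; have := joint_law measurableT mC.
by rewrite !preimage_setT setIT nuT mul1e.
Qed.

Let split_q (w : (R * R) * R) : quadrant w.1 -> split_state (S1 w) (q w) = w.1.
Proof.
case: w => -[x y] e /= [/= x0 y0]; rewrite /q; case: ifPn => [_|].
  have E : S (x, y) * p (x, y) = x by apply: Sp.
  by rewrite /split_state mulrBr mulr1 E /S1/= /S/= addrAC subrr add0r.
rewrite -leNgt /S1/= /S/= => s0.
have [-> ->] : x = 0 /\ y = 0 by lra.
by rewrite /split_state addr0 !mul0r.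
Qed.

(** [S1] and [q] are independent with laws [m] and Beta(2,2), and [split_state] recovers the point
    of the plane almost surely, so [splitting_unique] applies to [nu]. *)
Lemma splitting_determinate (A : set (R * R)) : measurable A -> nu A = splitting m A.
Proof.
pose S_ : {RV PP >-> R} := HB.pack S1 (isMeasurableFun.Build _ _ _ _ _ mS1).
pose Q_ : {RV PP >-> R} := HB.pack q (isMeasurableFun.Build _ _ _ _ _ (proj1 bq)).
have PPT : PP setT = 1%E by exact: probability_setT.
have heps : beta22_distributed PP Q_ by move=> C mC; exact: q_law.
have hind : independent_rv PP S_ Q_.
  move=> C D mC mD; rewrite setIC [LHS](joint_law mC mD) -mE//.
  by congr (_ * _)%E; [rewrite [RHS]S1_law|rewrite [RHS]q_law].
have nu_split C : measurable C ->
    nu C = PP ((fun w => split_state (S_ w) (Q_ w)) @^-1` C).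
  move=> mC; have bC := bmeas_indic R mC.
  have msq : measurable_fun setT (fun w => split_state (S_ w) (Q_ w)).
    apply: (measurableT_comp (@measurable_split R) (_ : measurable_fun setT (fun w => (S_ w, Q_ w)))).
    exact: measurable_fun_pair.
  have mD : measurable (@quadrant R `*` (setT : set R)) by exact: measurableX.
  have PD : PP (@quadrant R `*` setT) = 1%E.
    by rewrite [LHS]product_measure1E// [X in (_ * X)%E](_ : _ = 1%E)// mule1.
  have msC : measurable ((fun w => split_state (S_ w) (Q_ w)) @^-1` C).
    by rewrite -[_ @^-1` _]setTI; exact: (msq measurableT _ mC).
  transitivity (PP (C `*` setT)).
    by rewrite [RHS]product_measure1E// [X in (_ * X)%E](_ : _ = 1%E)// mule1.
  have mCT : measurable (C `*` (setT : set R)) by exact: measurableX.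
  rewrite -(expect_indic PPT mCT) -(expect_indic PPT msC); congr EFin.
  apply: (expect_eq_on PPT mD PD).
  - exact: bmeas_indic.
  - exact: bmeas_indic.
  move=> w [/= Qw _]; rewrite !indicE; congr (_%:R); congr nat_of_bool.
  apply/idP/idP; rewrite !inE/= split_q//; first by case.
move=> mA; rewrite (splitting_unique heps hind nu_split mA).
by apply: splitting_ext => // C mC; exact: S1_law.
Qed.

End splitting_determinate.

Section splitting_laws.
Context (R : realType).
Notation beta22 := (@beta22 R).

Lemma eq_measure_integrable d (T : measurableType d) (mu nu : probability T R)
    (f : T -> \bar R) : (forall A, measurable A -> mu A = nu A) ->
  mu.-integrable setT f -> nu.-integrable setT f.
Proof.
move=> munu /integrableP[mf fi]; apply/integrableP; split => //.
by rewrite (@eq_measure_integral _ _ _ setT mu)// => A mA _; apply/esym; exact: munu.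
Qed.

Lemma finite_moments_condition_ext (m m' : probability R R) :
  (forall A, measurable A -> m A = m' A) ->
  finite_moments_condition m -> finite_moments_condition m'.
Proof.
move=> mm' [m0 im mdet]; split; first by rewrite -mm'.
  by move=> n; exact: eq_measure_integrable (im n).
move=> nu nu0 inu nuE A mA; rewrite -mm'//; apply: mdet => // n.
by rewrite nuE; apply: eq_measure_integral => C mC _; apply/esym/mm'.
Qed.

Lemma splitting_sum (m : probability R R) (A : set R) : measurable A ->
  splitting m ((fun z : R * R => z.1 + z.2) @^-1` A) = m A.
Proof.
move=> mA.
have -> : splitting m ((fun z : R * R => z.1 + z.2) @^-1` A) =
    (m \x beta22)%E (A `*` setT).
  congr (_ \x _)%E; apply/seteqP; split => -[s e] /=.
    by rewrite (_ : s * e + s * (1 - e) = s)//; ring.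
  by rewrite (_ : s * e + s * (1 - e) = s)//; [case|ring].
rewrite [LHS]product_measure1E//.
by transitivity (m A * 1)%E; [congr (_ * _)%E; exact: probability_setT|rewrite mule1].
Qed.

(** On the product space the first coordinate is nonnegative only almost surely; the absolute value
    makes it so at every point without changing its law. *)
Lemma splitting_realization (m : probability R R) : m `[0, +oo[%classic = 1%E ->
  exists d (T : measurableType d) (Pr : probability T R) (S eps : {RV Pr >-> R}),
    [/\ forall w, 0 <= S w, forall A, measurable A -> distribution Pr S A = m A,
        beta22_distributed Pr eps & independent_rv Pr S eps].
Proof.
move=> m0; have mT := probability_setT m.
have mi : measurable (`[0, +oo[%classic : set R) by [].
have mabs : measurable_fun setT (fun w : R * R => `|w.1|) by exact: measurableT_comp.
have msnd : measurable_fun setT (fun w : R * R => w.2) by exact: measurable_snd.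
pose S : {RV (m \x beta22)%E >-> R} :=
  HB.pack (fun w : R * R => `|w.1|) (isMeasurableFun.Build _ _ _ _ _ mabs).
pose eps : {RV (m \x beta22)%E >-> R} :=
  HB.pack (fun w : R * R => w.2) (isMeasurableFun.Build _ _ _ _ _ msnd).
have mabsm (A : set R) : measurable A -> measurable ((fun s : R => `|s|) @^-1` A).
  by move=> mA; rewrite -[_ @^-1` _]setTI; exact: (@normr_measurable R setT measurableT _ mA).
have absE (A : set R) : measurable A -> m ((fun s : R => `|s|) @^-1` A) = m A.
  move=> mA; have mA' := mabsm _ mA.
  rewrite -(expect_indic mT mA) -(expect_indic mT mA'); congr EFin.
  apply: (expect_eq_on mT mi m0); [exact: bmeas_indic|exact: bmeas_indic|].
  move=> s /=; rewrite in_itv/= andbT => s0; rewrite !indicE; congr (_%:R).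
  by congr nat_of_bool; apply/idP/idP; rewrite !inE/= ger0_norm.
have joint (A C : set R) : measurable A -> measurable C ->
    (m \x beta22)%E (S @^-1` A `&` eps @^-1` C) = (m A * beta22 C)%E.
  move=> mA mC; rewrite -(absE _ mA).
  by rewrite -[RHS](product_measure1E m beta22 (mabsm _ mA) mC).
have SE (A : set R) : measurable A -> (m \x beta22)%E (S @^-1` A) = m A.
  move=> mA; have := joint A setT mA measurableT; rewrite preimage_setT setIT => ->.
  by rewrite [X in (_ * X)%E](_ : _ = 1%E)// ?mule1//; exact: (probability_setT beta22).
have epsE (C : set R) : measurable C -> (m \x beta22)%E (eps @^-1` C) = beta22 C.
  move=> mC; have := joint setT C measurableT mC; rewrite preimage_setT setTI => ->.
  by rewrite [X in (X * _)%E](_ : _ = 1%E)// mul1e.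
exists _, _, (m \x beta22)%E, S, eps; split => // [w|A C mA mC].
  exact: normr_ge0.
rewrite [LHS]joint//.
by congr (_ * _)%E; apply/esym; [exact: SE|exact: epsE].
Qed.

End splitting_laws.

(** * Both directions of part (b) *)

Section invariant_measures.
Context (R : realType) (P : R -> R.-pker (R * R) ~> (R * R)%type).
Hypothesis P_transition : transition_function P.
Hypothesis P_generator : has_generator P (@exchange_generator R).

Lemma in_Pf_splitting (m : probability R R) (mu : probability (R * R)%type R) :
  finite_moments_condition m -> (forall A, measurable A -> mu A = splitting m A) ->
  in_Pf mu.
Proof.
move=> m_cond muE; have [m0 im _] := m_cond; split.
- by rewrite muE ?splitting_quadrant//; exact: measurable_quadrant.
- move=> i j; apply: (eq_measure_integrable _ (splitting_finite_moments im i j)).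
  by move=> A mA; rewrite muE.
move=> nu nuQ nu_fin nuE A mA; rewrite muE//.
apply: splitting_determinate => // i j; rewrite nuE.
by apply: eq_measure_integral => C mC _; exact: muE.
Qed.

(** Determinacy passes from [mu] down to the law [m] of the sum: if [nu] has the moments of [m], its
    splitting has those of [mu], hence is [mu], and the sum of the coordinates recovers [nu]. *)
Lemma invariant_splitting (mu : probability (R * R)%type R) :
  invariant_probability P mu -> in_Pf mu ->
  exists m : probability R R, finite_moments_condition m /\
    (forall A, measurable A -> mu A = splitting m A).
Proof.
move=> inv [muQ mu_fin mu_det]; have muT := probability_setT mu.
have mQ := @measurable_quadrant R.
pose S : {RV mu >-> R} :=
  HB.pack (fun z : R * R => z.1 + z.2) (isMeasurableFun.Build _ _ _ _ _ (@measurable_plane_sum R)).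
pose m : probability R R := distribution mu S.
have mi : measurable (`[0, +oo[%classic : set R) by [].
have m0 : m `[0, +oo[%classic = 1%E.
  have mI : measurable (S @^-1` `[0, +oo[%classic).
    by rewrite -[_ @^-1` _]setTI; exact: (@measurable_plane_sum R measurableT _ mi).
  apply/eqP; rewrite eq_le probability_le1//= -muQ; apply: le_measure; rewrite ?inE//.
  by move=> z [z1 z2] /=; rewrite in_itv/= andbT addr_ge0.
have im : finite_moments1 m.
  move=> n; apply: integrable_pushforward => //.
  - exact/measurable_EFinP/measurable_funX.
  - have := integrable_mixed_moment 0 0 n mu_fin; apply: eq_integrable => // z _.
    by rewrite /= !expr0 !mul1r.
have muE A : measurable A -> mu A = splitting m A.
  move=> mA; have bA := bmeas_indic R mA.
  rewrite -(expect_indic muT mA) -(expect_indic (probability_setT (splitting m)) mA).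
  congr EFin; rewrite (invariant_equilibrate P_transition P_generator inv bA).
  rewrite expect_splitting// expect_distribution//; last first.
    by apply: (bmeas_comp _ (bmeas_equilibrate bA)); exact: measurable_fun_pair.
  by apply: eq_Rintegral => z _; rewrite /equilibrate/= addr0.
exists m; split => //; split => // nu nu0 inu nuE A mA.
rewrite -splitting_sum// -[RHS]splitting_sum//.
have mSA : measurable ((fun z : R * R => z.1 + z.2) @^-1` A).
  by rewrite -[_ @^-1` _]setTI; exact: (@measurable_plane_sum R measurableT _ mA).
rewrite -muE//; apply: mu_det => //.
- exact: splitting_quadrant.
- exact: splitting_finite_moments.
move=> i j; have mom (m' : probability R R) : finite_moments1 m' ->
    (\int[splitting m']_z (z.1 ^+ i * z.2 ^+ j)%:E =
     (beta_moment R i j * \int[m']_s (s ^+ (i + j)))%:E)%E.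
  move=> im'; have := splitting_moment im' i j 0; rewrite addn0 => <-.
  by apply: eq_integral => z _; rewrite expr0 mulr1.
rewrite mom//; transitivity (\int[splitting m]_z (z.1 ^+ i * z.2 ^+ j)%:E)%E.
  by rewrite mom// /Rintegral nuE.
by apply: eq_measure_integral => C mC _; apply/esym/muE.
Qed.

End invariant_measures.

Theorem theorem2p3 (R : realType) (P : R -> R.-pker (R * R) ~> (R * R)%type)
    (P_transition : transition_function P)
    (P_generator : has_generator P (@exchange_generator R)) :
  (forall (d : measure_display) (T : measurableType d) (Pr : probability T R)
      (Z : R -> {RV Pr >-> (R * R)%type}) (x y : R)
      (d' : measure_display) (T' : measurableType d') (Pr' : probability T' R)
      (eps : {RV Pr' >-> R}),
    0 <= x -> 0 <= y ->
    markov_jump_process Pr P Z -> {ae Pr, forall w, Z 0 w = (x, y)} ->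
    beta22_distributed Pr' eps ->
    forall f : R * R -> R, continuous f -> bounded_fun f ->
      ('E_Pr[f \o Z t] @[t --> (+oo : set_system R)%R] -->
        'E_Pr'[fun w => f (split_state (x + y) (eps w))])%E)
  /\
  (forall mu : probability (R * R)%type R,
    (invariant_probability P mu /\ in_Pf mu) <->
    exists (d : measure_display) (T : measurableType d) (Pr : probability T R)
        (S eps : {RV Pr >-> R}),
      [/\ forall w, 0 <= S w,
          finite_moments_condition (distribution Pr S),
          beta22_distributed Pr eps,
          independent_rv Pr S eps &
          forall A, measurable A ->
            mu A = Pr ((fun w => split_state (S w) (eps w)) @^-1` A)]).
Proof.
split=> [d T Pr Z x y d' T' Pr' eps x0 y0 mZ Z0 heps f cf bf|mu].
  apply: (markov_cvg P_transition P_generator x0 y0 mZ Z0 heps).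
  by apply: bounded_bmeas => //; exact: continuous_measurable_plane.
split=> [[inv Pf]|[d [T [Pr [S [eps [S0 m_cond heps hind muE]]]]]]].
  have [m [m_cond muE]] := invariant_splitting P_transition P_generator inv Pf.
  have [m0 _ _] := m_cond.
  have [d [T [Pr [S [eps [S0 SE heps hind]]]]]] := splitting_realization m0.
  exists d, T, Pr, S, eps; split => //.
    by apply: finite_moments_condition_ext m_cond => A mA; apply/esym/SE.
  have mse : measurable_fun setT (fun w => split_state (S w) (eps w)).
    apply: (measurableT_comp (@measurable_split R)
      (_ : measurable_fun setT (fun w => (S w, eps w)))).
    exact: measurable_fun_pair.
  pose Z : {RV Pr >-> (R * R)%type} := HB.pack (fun w => split_state (S w) (eps w))
    (isMeasurableFun.Build _ _ _ _ _ mse).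
  move=> A mA; rewrite muE// (splitting_ext (m' := distribution Pr S))//.
    by rewrite -(splitting_unique (mu := distribution Pr Z) heps hind).
  by move=> C mC; apply/esym/SE.
have muE' := splitting_unique heps hind muE; have [m0 _ _] := m_cond; split.
  exact: (splitting_invariant P_transition P_generator m0 muE').
exact: (in_Pf_splitting m_cond muE').
Qed.
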